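(* Let $W_0$ be a uniform $k$-block graphon. Let $H$ be a finite $d$-regular graph, let $\tau=t(H,\cdot)$, write $t_{\max}=t^\tau_{\max}(\tilde{\mathcal W}_\Omega)$, and let $f_{\max}$ be the step function which is equal to $1$ on all relevant blocks and equal to $W_0$ on all irrelevant (i.e. not relevant) blocks. Then $\tilde f_{\max}$ is the unique minimizer of $\min\{J_{W_0}(\tilde f):\tilde f\in\tilde{\mathcal W},\ t(H,\tilde f)\ge t_{\max}\}$. Moreover, for any $\epsilon>0$ there exists a constant $C>0$ such that, for all sufficiently large $n$, $$\mathbb P_{kn,W_0}\Big(\delta_\square(f^{G_{kn}},\tilde f_{\max})<\epsilon\ \Big|\ t(H,G_{kn})\ge t_{\max}\Big)\ge1-\exp(-Cn^2),$$ implying that as $n\to\infty$ the conditional distribution of $\tilde f^{G_{kn}}$ given the event $t(H,G_{kn})\ge t_{\max}$ converges to the point mass at $\tilde f_{\max}$.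
   Context: A graphon is a measurable symmetric function $f:[0,1]^2\to[0,1]$; $\mathcal W$ is the set of graphons. $d_\square(f,g)=\sup_{S,T\subseteq[0,1]}\left|\int_{S\times T}(f-g)\right|$ over measurable $S,T$; $\delta_\square(f,g)=\inf_{\phi}d_\square(f,g^\phi)$ over bijective Lebesgue-measure-preserving $\phi:[0,1]\to[0,1]$, where $g^\phi(x,y)=g(\phi(x),\phi(y))$. $\tilde f$ is the class of $f$ under $f\sim g\iff\delta_\square(f,g)=0$, and $\tilde{\mathcal W}=\mathcal W/\!\sim$ with metric $\delta_\square$ (a compact metric space). A uniform $k$-block graphon is $W_0=(p_{ij})_{i,j\in[k]}$, $p_{ij}=p_{ji}\in[0,1]$, taking value $p_{ij}$ on $I_i\times I_j$, where $I_1=[0,1/k]$, $I_j=((j-1)/k,j/k]$ for $j\ge2$. $G_{kn}$ is the random simple graph on $[kn]$ where each pair $i\neq j$ is independently an edge with probability $p_{\lceil i/n\rceil,\lceil j/n\rceil}$. The empirical graphon $f^G$ of a graph $G$ on $[N]$ is $1$ at $(x,y)$ if $(\vartheta_N(x),\vartheta_N(y))$ is an edge and $0$ otherwise, with $\vartheta_N(x)=i$ for $\frac{i-1}N<x\le\frac iN$, $\vartheta_N(0)=1$. $\mathbb P_{kn,W_0}$ denotes the law of $f^{G_{kn}}$. For a finite simple graph $H$ on $v$ vertices, $t(H,f)=\int_{[0,1]^v}\prod_{(i,j)\in E(H)}f(x_i,x_j)\,dx_1\cdots dx_v$ (well defined on $\tilde{\mathcal W}$), and $t(H,G)=t(H,f^G)$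 for a graph $G$. A block $I_a\times I_b$ is relevant if $p_{ab}>0$ and $t(H,W_0)$ strictly decreases if $p_{ab}$ $(=p_{ba})$ is lowered. $h_p(u)=u\log\frac up+(1-u)\log\frac{1-u}{1-p}$ (with $0\log0=0$, $0\log(0/0)=0$, value $+\infty$ if $p\in\{0,1\}$, $u\ne p$); $I_{W_0}(f)=\frac12\int_{[0,1]^2}h_{W_0(x,y)}(f(x,y))\,dx\,dy$; $\Omega=\{W_0\in(0,1)\}$; $\mathcal W_\Omega$ is the set of graphons equal to $W_0$ a.e. on $\Omega^c$; $\tilde{\mathcal W}_\Omega$ is the set of classes $\tilde f$ with $\delta_\square(\tilde f,g)=0$ for some $g\in\mathcal W_\Omega$. $J_{W_0}(\tilde f)=\sup_{\eta>0}\inf\{I_{W_0}(h):h\in\mathcal W,\delta_\square(\tilde f,h)\le\eta\}$ if $\tilde f\in\tilde{\mathcal W}_\Omega$ and $\infty$ otherwise. $t^\tau_{\max}(\tilde{\mathcal W}_\Omega)=\max_{\tilde f\in\tilde{\mathcal W}_\Omega}\tau(\tilde f)$.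
   Formalization: The conditional claims are stated only for those n at which the event t(H,G_kn) ≥ t_max has positive probability; otherwise conditioning is undefined (e.g. k=1, 0<p<1, H=K_2, where t_max=1 but t(H,G_n) ≤ 1−1/n for every n). *)

(* Defs.v *)
From HB Require Import structures.
From mathcomp Require Import all_boot all_order all_algebra.
From mathcomp Require Import all_classical all_reals all_analysis.
From mathcomp Require Import measurable_realfun.

Set Implicit Arguments.
Unset Strict Implicit.
Unset Printing Implicit Defensive.

Import Order.TTheory GRing.Theory Num.Theory.
Import numFieldNormedType.Exports.

Local Open Scope classical_set_scope.
Local Open Scope ring_scope.

(* [lebesgue_measure] lives on [measurableTypeR R], i.e. R with its Borel
   sets, so all measurability conditions are stated over that type. *)
Notation mR R := (measurableTypeR R).

Definition unitI {R : realType} : set (mR R) := [set` `[0%R, 1%R]].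

Definition unitSq {R : realType} : set (mR R * mR R) := unitI `*` unitI.

Notation leb2 R := (@lebesgue_measure R \x @lebesgue_measure R)%E.

(* A graphon is carried by a function on R * R; only its values on the unit
   square matter (measurable = Borel measurable). *)
Record graphon (R : realType) := Graphon {
  gfun :> R -> R -> R;
  gfun_measurable : measurable_fun (unitSq) (fun z => gfun z.1 z.2);
  gfun_sym : forall x y, unitI x -> unitI y -> gfun x y = gfun y x;
  gfun_ge0_le1 : forall x y, unitI x -> unitI y -> 0 <= gfun x y <= 1
}.

HB.instance Definition _ (R : realType) := gen_eqMixin (graphon R).
HB.instance Definition _ (R : realType) := gen_choiceMixin (graphon R).

Definition cut_set (R : realType) (f g : R -> R -> R) : set R :=
  [set r | exists S T : set (mR R),
    [/\ measurable S, measurable T, S `<=` unitI, T `<=` unitI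
      & r = `| \int[leb2 R]_(z in S `*` T) (f z.1 z.2 - g z.1 z.2) |]].

Definition cut_dist (R : realType) (f g : R -> R -> R) : R :=
  sup (cut_set f g).

(* Bijections of [0,1] preserving Lebesgue measure.  For Borel maps the third
   clause (the inverse is measurable too) is automatic by Lusin-Souslin. *)
Definition mp_bijection (R : realType) (phi : mR R -> mR R) : Prop :=
  [/\ set_bij (unitI) (unitI) phi,
      measurable_fun (unitI) phi,
      forall A, measurable A -> A `<=` unitI -> measurable (phi @` A)
    & forall A, measurable A -> A `<=` unitI ->
        lebesgue_measure (unitI `&` phi @^-1` A) = lebesgue_measure A].

Definition relabel (R : realType) (phi : mR R -> mR R) (g : R -> R -> R) :
  R -> R -> R := fun x y => g (phi x) (phi y).

Definition cut_delta (R : realType) (f g : R -> R -> R) : R :=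
  inf [set cut_dist f (relabel phi g) | phi in @mp_bijection R].

Section Delta.
Variable R : realType.
Local Notation I := (@unitI R).
Local Notation mu := (@lebesgue_measure R).
Implicit Types (f g h : graphon R) (phi psi : mR R -> mR R).

Let mI : measurable I. Proof. exact: measurable_itv. Qed.

Lemma mp_bijection_id : mp_bijection (@idfun (mR R)).
Proof.
split.
- by split=> [x//|x y _ _ //|x Ix]; exists x.
- exact: measurable_id.
- by move=> A mA _; rewrite image_id.
- by move=> A mA AI; congr (mu _); rewrite preimage_id; exact: setIidr.
Qed.

Lemma mp_bij_in phi : mp_bijection phi -> forall x, I x -> I (phi x).
Proof. by move=> [[h _ _] _ _ _] x Ix; apply: h. Qed.

Lemma mp_bijection_comp phi psi :
  mp_bijection phi -> mp_bijection psi -> mp_bijection (phi \o psi).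
Proof.
move=> hphi hpsi; have := hphi; have := hpsi.
move=> [bpsi mpsi ipsi ppsi] [bphi mphi iphi pphi]; split.
- exact: set_bij_comp bpsi bphi.
- apply: (measurable_comp mI _ mphi mpsi).
  by move=> _ [x Ix <-]; exact: mp_bij_in hpsi _ Ix.
- move=> A mA AI; rewrite -image_comp; apply: iphi; first exact: ipsi.
  by move=> _ [x Ax <-]; apply: mp_bij_in hpsi _ _; exact: AI.
- move=> A mA AI.
  rewrite -(pphi _ mA AI) -(ppsi (I `&` phi @^-1` A)).
  + congr (mu _); rewrite seteqP; split => x /=.
      by move=> [Ix Ax]; split => //; split => //; exact: mp_bij_in hpsi _ Ix.
    by move=> [Ix [_ Ax]].
  + exact: mphi.
  + by move=> x [].
Qed.

Lemma mp_bijection_inv phi : mp_bijection phi ->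
  exists2 psi, mp_bijection psi &
    (forall x, I x -> phi (psi x) = x) /\ (forall x, I x -> psi (phi x) = x).
Proof.
move=> hphi; have [bphi mphi iphi pphi] := hphi.
have [fI inj_phi surj_phi] := bphi.
pose psi := 'pinv_(fun=> 0) I phi.
have phiK x : I x -> psi (phi x) = x.
  by move=> Ix; apply: (@pinvKV _ _ _ _ phi inj_phi); rewrite inE.
have psiK x : I x -> phi (psi x) = x.
  by move=> Ix; apply: (surjpK _ surj_phi); rewrite inE.
have bpsi : set_bij I I psi by apply: bijpinv_bij.
have psiI x : I x -> I (psi x) by case: bpsi => h _ _; exact: h.
have imE A : A `<=` I -> phi @` A = I `&` psi @^-1` A.
  move=> AI; rewrite seteqP; split => x /=.
    by move=> [y Ay <-]; split; [exact/fI/AI | rewrite phiK//; exact: AI].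
  by move=> [Ix Apx]; exists (psi x) => //; rewrite psiK.
have im'E A : A `<=` I -> psi @` A = I `&` phi @^-1` A.
  move=> AI; rewrite seteqP; split => x /=.
    by move=> [y Ay <-]; split; [exact/psiI/AI | rewrite psiK//; exact: AI].
  by move=> [Ix Apx]; exists (phi x) => //; rewrite phiK.
exists psi; split => //.
- move=> _ A mA.
  have -> : I `&` psi @^-1` A = phi @` (I `&` A).
    rewrite imE; last by move=> x [].
    rewrite seteqP; split => x /=; first by move=> [Ix Ax]; split=> //; split=> //; exact: psiI.
    by move=> [Ix [_ Ax]].
  by apply: iphi; [exact: measurableI | move=> x []].
- by move=> A mA AI; rewrite im'E//; exact: mphi.
- move=> A mA AI; rewrite -imE// -[LHS]pphi.
  + congr (mu _); rewrite seteqP; split => x /=.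
      by move=> [Ix [y Ay]] yx; rewrite -(phiK x)// -yx phiK//; exact: AI.
    by move=> Ax; split; [exact: AI | exists x].
  + exact: iphi.
  + by rewrite imE// => x [].
Qed.


Lemma Rintegral_relabel phi (h : mR R * mR R -> R) (S T : set (mR R)) :
  mp_bijection phi -> measurable_fun unitSq h ->
  (forall z, unitSq z -> `|h z| <= 1) ->
  measurable S -> measurable T -> S `<=` I -> T `<=` I ->
  \int[leb2 R]_(z in S `*` T) h (phi z.1, phi z.2) =
  \int[leb2 R]_(z in (phi @` S) `*` (phi @` T)) h z.
Proof.
move=> hphi mh h1 mS mT SI TI; have [[fI inj_phi surj_phi] mphi iphi pphi] := hphi.
pose phi' x := if x \in I then phi x else x.
have phi'I x : I x -> phi' x = phi x by move=> Ix; rewrite /phi' mem_set.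
have mphi' : measurable_fun setT phi'.
  rewrite -(setUv I); apply/measurable_funU => //; first exact: measurableC.
  split.
    by apply: eq_measurable_fun mphi => x xI; rewrite /phi' xI.
  have mid : measurable_fun (~` I) (@idfun (mR R)) by exact: measurable_id.
  by apply: eq_measurable_fun mid => x; rewrite in_setC /phi' => /negbTE ->.
have pre A : measurable A -> mu (phi' @^-1` A) = mu A.
  move=> mA.
  have E : phi' @^-1` A = (I `&` phi @^-1` (A `&` I)) `|` (A `&` ~` I).
    rewrite seteqP; split => x /=.
      rewrite /phi'; case: ifPn => [/set_mem Ix Ax|/negP xI Ax].
        by left; split => //; split => //; exact: fI.
      by right; split => // /mem_set.
    move=> [[Ix [Ax _]]|[Ax /negP nI]]; first by rewrite phi'I.
    by rewrite /phi' ifN//; apply/negP => /set_mem; exact/negP.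
  have mAI : measurable (A `&` I) by exact: measurableI.
  have mA' : measurable (A `&` ~` I).
    by apply: measurableI => //; exact: measurableC.
  have mB : measurable (I `&` phi @^-1` (A `&` I)) by exact: mphi.
  rewrite E; apply: (etrans (measureU mu mB mA' _)).
    by rewrite -subset0 => x [[? _] [_]].
  have e1 := pphi _ mAI (@subIsetr _ _ _).
  apply: (etrans (congr1 (fun r => (r + _)%E) e1)).
  apply: (etrans (esym (measureU mu mAI mA' _))).
    by rewrite -subset0 => x [[_ ?] [_]].
  by congr (mu _); rewrite -setIUr setUv setIT.
pose Phi (z : mR R * mR R) := (phi' z.1, phi' z.2).
have mPhi : measurable_fun setT Phi.
  by apply: measurable_fun_pair; apply: measurableT_comp.
have PhiE A B : Phi @^-1` (A `*` B) = (phi' @^-1` A) `*` (phi' @^-1` B) by [].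
have eqm A : measurable A -> leb2 R A = pushforward (leb2 R) Phi A.
  have [m' m'E] : exists m' : {measure set (mR R * mR R)%type -> \bar R},
      forall B, m' B = leb2 R (Phi @^-1` B).
    by exists (@measure_function_pushforward__canonical__measure_function_Measure
      _ _ _ _ _ (leb2 R) _ mPhi).
  move=> mA; rewrite /pushforward -m'E; 
  have H := @product_measure_unique _ _ _ _ R mu mu m'.
  apply: H => // B C mB mC.
  rewrite m'E PhiE; apply: etrans (product_measure1E mu mu _ _) _.
  - by rewrite -[X in measurable X]setTI; exact: mphi'.
  - by rewrite -[X in measurable X]setTI; exact: mphi'.
  - by congr (_ * _)%E; exact: pre.
pose k := h \_ unitSq.
have mSq : measurable (@unitSq R) by exact: measurableX.
have mk : measurable_fun setT k by apply/(measurable_restrictT h mSq).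
have k1 z : `|k z| <= 1.
  rewrite /k patchE; case: ifPn => [/set_mem /h1//|_]; by rewrite normr0.
have mphiS : measurable (phi @` S) by exact: iphi.
have mphiT : measurable (phi @` T) by exact: iphi.
have preS A : A `<=` I -> phi' @^-1` (phi @` A) = A.
  move=> AI; rewrite seteqP; split => x /=.
    move=> [y Ay]; rewrite /phi'; case: ifPn => [xI yx|/negP xI yx].
      by rewrite -(inj_phi _ _ _ _ yx)// inE; exact: AI.
    by case: xI; rewrite -yx inE; exact/fI/AI.
  by move=> Ax; exists x => //; rewrite phi'I//; exact: AI.
have E2 : \int[leb2 R]_(z in S `*` T) h (phi z.1, phi z.2) =
          \int[leb2 R]_(z in S `*` T) (k \o Phi) z.
  apply: eq_Rintegral => -[x y] /set_mem /= [/SI Ix /TI Iy].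
  rewrite /k /Phi /= patchE !phi'I// ifT//.
  by rewrite inE; split; exact: fI.
have E3 : \int[leb2 R]_(z in (phi @` S) `*` (phi @` T)) h z =
          \int[leb2 R]_(z in (phi @` S) `*` (phi @` T)) k z.
  apply: eq_Rintegral => -[x y] /set_mem /= [[a /SI Ia <-] [b /TI Ib <-]].
  by rewrite /k patchE ifT// inE; split; exact: fI.
rewrite E2 E3 /Rintegral; congr fine.
have := @integral_pushforward _ _ _ _ R Phi mPhi (leb2 R)
  ((phi @` S) `*` (phi @` T)) (EFin \o k).
rewrite PhiE !preS// => <-.
- by apply: eq_measure_integral => A mA _; exact/esym/eqm.
- exact/measurable_EFinP.
- apply: measurable_bounded_integrable.
  + exact: measurableX.
    apply: (@le_lt_trans _ _ (leb2 R unitSq)).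
      apply: le_measure; rewrite ?inE//; first exact: measurableX.
      by move=> -[x y] [/SI ? /TI ?].
    apply: (@le_lt_trans _ _ (mu I * mu I)%E); first by rewrite product_measure1E.
    by rewrite lebesgue_measure_itv /= lte_fin ltr01 EFinN sube0 mule1 ltry.
  + apply: measurable_funTS; exact: measurableT_comp.
  + exists 1; split => // x x1 z _ /=; exact: le_trans (k1 _) (ltW x1).
- exact: measurableX.
Qed.

Lemma relabel_graphon phi g : mp_bijection phi ->
  exists g' : graphon R, gfun g' = relabel phi g.
Proof.
move=> hphi; have phiI := mp_bij_in hphi; have [_ mphi _ _] := hphi.
have mSq : measurable (@unitSq R) by exact: measurableX.
have m : measurable_fun unitSq (fun z : mR R * mR R => relabel phi g z.1 z.2).
  have mP : measurable_fun unitSq (fun z : mR R * mR R => (phi z.1, phi z.2)).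
    pose phi' (x : mR R) : mR R := if x \in I then phi x else x.
    have mphi' : measurable_fun setT phi'.
      rewrite -(setUv I); apply/measurable_funU => //; first exact: measurableC.
      split; first by apply: eq_measurable_fun mphi => x xI; rewrite /phi' xI.
      have mid : measurable_fun (~` I) (@idfun (mR R)) by exact: measurable_id.
      by apply: eq_measurable_fun mid => x; rewrite in_setC /phi' => /negbTE ->.
    have mPhi : measurable_fun setT (fun z : mR R * mR R => (phi' z.1, phi' z.2)).
      by apply: measurable_fun_pair; apply: measurableT_comp.
    apply: eq_measurable_fun (measurable_funTS mPhi) => -[x y] /set_mem[Ix Iy] /=.
    by rewrite /phi' !mem_set.
  apply: (measurable_comp mSq _ (gfun_measurable g) mP).
  by move=> _ [[x y] [/= Ix Iy] <-]; split; exact: phiI.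
by exists (@Graphon R (relabel phi g) m
  (fun x y Ix Iy => gfun_sym g (phiI x Ix) (phiI y Iy))
  (fun x y Ix Iy => gfun_ge0_le1 g (phiI x Ix) (phiI y Iy))).
Qed.

Lemma graphonB_measurable f g :
  measurable_fun unitSq (fun z : mR R * mR R => f z.1 z.2 - g z.1 z.2).
Proof. by apply: measurable_funB; exact: gfun_measurable. Qed.

Lemma graphonB_le1 f g (z : mR R * mR R) : unitSq z ->
  `|f z.1 z.2 - g z.1 z.2| <= 1.
Proof.
move=> [/= I1 I2]; have /andP[f0 f1] := gfun_ge0_le1 f I1 I2.
have /andP[g0 g1] := gfun_ge0_le1 g I1 I2.
rewrite ler_norml; apply/andP; split.
  by rewrite lerBrDr (le_trans _ f0)// addrC subr_le0.
by rewrite lerBlDr (le_trans f1)// lerDl.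
Qed.

Section Rect.
Variables S T : set (mR R).
Hypotheses (mS : measurable S) (mT : measurable T) (SI : S `<=` I) (TI : T `<=` I).

Let mST : measurable (S `*` T). Proof. exact: measurableX. Qed.

Let ST1 : (leb2 R (S `*` T) <= 1)%E.
Proof.
have mSq : measurable (@unitSq R) by exact: measurableX.
apply: (@le_trans _ _ (leb2 R unitSq)).
  apply: le_measure; rewrite ?inE//.
  by move=> -[x y] [/SI ? /TI ?].
apply: (@le_trans _ _ (mu I * mu I)%E); first by rewrite product_measure1E.
by rewrite lebesgue_measure_itv /= lte_fin ltr01 EFinN sube0 mule1.
Qed.

Lemma graphonB_integrable f g :
  (leb2 R).-integrable (S `*` T) (EFin \o (fun z => f z.1 z.2 - g z.1 z.2)).
Proof.
apply: measurable_bounded_integrable => //.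
- by rewrite (le_lt_trans ST1)// ltry.
- apply: measurable_funS (graphonB_measurable f g) => //; first exact: measurableX.
  by move=> -[x y] [/SI ? /TI ?].
- exists 1; split => // x x1 z [/SI ? /TI ?] /=.
  by apply: le_trans (ltW x1); exact: graphonB_le1.
Qed.

Lemma graphonB_integral_le1 f g :
  `| \int[leb2 R]_(z in S `*` T) (f z.1 z.2 - g z.1 z.2) | <= 1.
Proof.
have hi := graphonB_integrable f g.
rewrite -lee_fin EFin_normr_Rintegral//.
have hm := measurable_int _ hi.
apply: le_trans (le_abse_integral _ mST hm) _.
apply: le_trans (integral_le_bound 1%E mST hm _ _) _ => //.
  by apply: aeW => z [/SI ? /TI ?] /=; rewrite lee_fin; exact: graphonB_le1.
by rewrite mul1e.
Qed.

End Rect.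

Lemma cut_set_has_sup f g : has_sup (cut_set f g).
Proof.
split; last first.
  by exists 1 => _ [S [T [mS mT SI TI ->]]]; exact: graphonB_integral_le1.
exists `| \int[leb2 R]_(z in set0 `*` set0) (f z.1 z.2 - g z.1 z.2) |.
have s0 : set0 `<=` I by [].
by exists set0, set0; split.
Qed.

Lemma cut_dist_ub f g S T : measurable S -> measurable T -> S `<=` I -> T `<=` I ->
  `| \int[leb2 R]_(z in S `*` T) (f z.1 z.2 - g z.1 z.2) | <= cut_dist f g.
Proof.
move=> mS mT SI TI; apply: ub_le_sup; last by exists S, T.
by case: (cut_set_has_sup f g).
Qed.

Lemma cut_dist_le f g c :
  (forall S T : set (mR R), measurable S -> measurable T -> S `<=` I -> T `<=` I ->
   `| \int[leb2 R]_(z in S `*` T) (f z.1 z.2 - g z.1 z.2) | <= c) ->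
  cut_dist f g <= c.
Proof.
move=> H; apply: ge_sup; first by case: (cut_set_has_sup f g).
by move=> _ [S [T [mS mT SI TI ->]]]; exact: H.
Qed.

Lemma cut_dist_ge0 f g : 0 <= cut_dist f g.
Proof.
have s0 : set0 `<=` I by [].
by apply: le_trans (cut_dist_ub f g measurable0 measurable0 s0 s0).
Qed.

Lemma cut_dist_triangle f g h : cut_dist f h <= cut_dist f g + cut_dist g h.
Proof.
apply: cut_dist_le => S T mS mT SI TI.
have := lerD (cut_dist_ub f g mS mT SI TI) (cut_dist_ub g h mS mT SI TI).
apply: le_trans; apply: le_trans (ler_normD _ _).
rewrite -RintegralD; first last.
- exact: graphonB_integrable.
- exact: graphonB_integrable.
- exact: measurableX.
rewrite le_eqVlt; apply/orP; left; apply/eqP; congr `| _ |.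
by apply: eq_Rintegral => z _; rewrite addrA subrK.
Qed.

Lemma cut_dist_sym f g : cut_dist f g = cut_dist g f.
Proof.
suff H f' g' : cut_dist f' g' <= cut_dist g' f' by apply/eqP; rewrite eq_le !H.
apply: cut_dist_le => S T mS mT SI TI.
apply: le_trans (cut_dist_ub g' f' mS mT SI TI).
rewrite -[leRHS]normrN -mulN1r -RintegralZl; first last.
- exact: graphonB_integrable.
- exact: measurableX.
rewrite le_eqVlt; apply/orP; left; apply/eqP; congr `| _ |.
by apply: eq_Rintegral => z _; rewrite mulN1r opprB.
Qed.

Lemma cut_dist_eq f g (f' g' : R -> R -> R) :
  (forall x y, I x -> I y -> f x y = f' x y) ->
  (forall x y, I x -> I y -> g x y = g' x y) -> cut_dist f g = cut_dist f' g'.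
Proof.
move=> ff gg; congr sup; rewrite seteqP; split => r [S [T [mS mT SI TI ->]]];
  exists S, T; split => //; congr `| _ |; apply: eq_Rintegral => -[x y] /set_mem[/SI ? /TI ?] /=;
  by rewrite ff// gg.
Qed.

Lemma cut_distxx f : cut_dist f f = 0.
Proof.
apply/eqP; rewrite eq_le cut_dist_ge0 andbT; apply: cut_dist_le => S T *.
rewrite (@eq_Rintegral _ _ _ _ _ (cst 0)); last by move=> z _; rewrite subrr.
by rewrite /Rintegral integral0 normr0.
Qed.

Lemma cut_dist_relabel phi f g : mp_bijection phi ->
  cut_dist (relabel phi f) (relabel phi g) <= cut_dist f g.
Proof.
move=> hphi; have [f' f'E] := relabel_graphon f hphi.
have [g' g'E] := relabel_graphon g hphi.
rewrite -f'E -g'E; apply: cut_dist_le => S T mS mT SI TI; rewrite f'E g'E.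
rewrite (@Rintegral_relabel phi (fun z => f z.1 z.2 - g z.1 z.2))//.
- have [_ _ iphi _] := hphi; apply: cut_dist_ub; try exact: iphi.
    by move=> _ [x /SI Ix <-]; exact: mp_bij_in.
  by move=> _ [x /TI Ix <-]; exact: mp_bij_in.
- exact: graphonB_measurable.
- exact: graphonB_le1.
Qed.

Lemma cut_delta_has_inf f g :
  has_inf [set cut_dist f (relabel phi g) | phi in @mp_bijection R].
Proof.
split; first by exists (cut_dist f (relabel idfun g)); exists idfun => //; exact: mp_bijection_id.
exists 0 => _ [phi hphi <-]; have [g' <-] := relabel_graphon g hphi.
exact: cut_dist_ge0.
Qed.

Lemma cut_delta_ge0 f g : 0 <= cut_delta f g.
Proof.
apply: lb_le_inf; first by case: (cut_delta_has_inf f g).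
move=> _ [phi hphi <-]; have [g' <-] := relabel_graphon g hphi.
exact: cut_dist_ge0.
Qed.

Lemma cut_delta_lb phi f g : mp_bijection phi ->
  cut_delta f g <= cut_dist f (relabel phi g).
Proof.
move=> hphi; apply: ge_inf; last by exists phi.
by case: (cut_delta_has_inf f g).
Qed.

Lemma cut_deltaxx f : cut_delta f f = 0.
Proof.
apply/eqP; rewrite eq_le cut_delta_ge0 andbT.
by apply: le_trans (cut_delta_lb f f mp_bijection_id) _; rewrite cut_distxx.
Qed.

Lemma cut_delta_sym f g : cut_delta f g = cut_delta g f.
Proof.
suff H f' g' : cut_delta f' g' <= cut_delta g' f' by apply/eqP; rewrite eq_le !H.
apply/ler_addgt0Pl => e e0.
have [_ [phi hphi <-] lt] := inf_adherent e0 (cut_delta_has_inf g' f').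
have [psi hpsi [phiK psiK]] := mp_bijection_inv hphi.
apply: le_trans (cut_delta_lb f' g' hpsi) _.
rewrite addrC; apply: le_trans (ltW lt).
have [f1 f1E] := relabel_graphon f' hphi.
have [g1 g1E] := relabel_graphon g' hpsi.
have [f2 f2E] := relabel_graphon f1 hpsi.
rewrite -g1E -f1E cut_dist_sym; apply: le_trans (cut_dist_relabel g' f1 hpsi).
rewrite -f2E -g1E (@cut_dist_eq g1 f' g1 f2)// => x y Ix Iy.
by rewrite f2E f1E /relabel !phiK.
Qed.

Lemma cut_delta_triangle g f h : cut_delta f h <= cut_delta f g + cut_delta g h.
Proof.
apply/ler_addgt0Pl => e e0; have e20 : 0 < e / 2 by rewrite divr_gt0.
have [_ [phi hphi <-] lt1] := inf_adherent e20 (cut_delta_has_inf f g).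
have [_ [psi hpsi <-] lt2] := inf_adherent e20 (cut_delta_has_inf g h).
apply: le_trans (cut_delta_lb f h (mp_bijection_comp hpsi hphi)) _.
have [g1 g1E] := relabel_graphon g hphi.
have [h1 h1E] := relabel_graphon h hpsi.
have [h2 h2E] := relabel_graphon h1 hphi.
have -> : relabel (psi \o phi) h = h2 by rewrite h2E h1E.
apply: le_trans (cut_dist_triangle f g1 h2) _.
rewrite (splitr e) [leRHS]addrACA; apply: lerD.
  by rewrite g1E addrC; exact: (ltW lt1).
rewrite g1E h2E; apply: le_trans (cut_dist_relabel g h1 hphi) _.
by rewrite h1E addrC; exact: (ltW lt2).
Qed.

End Delta.

Section GraphonClass.
Variable R : realType.

Definition cut_equiv (f g : graphon R) : bool := cut_delta f g == 0.

Let cut_equiv_refl : reflexive cut_equiv.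
Proof. by move=> f; rewrite /cut_equiv cut_deltaxx. Qed.

Let cut_equiv_sym : symmetric cut_equiv.
Proof. by move=> f g; rewrite /cut_equiv cut_delta_sym. Qed.

Let cut_equiv_trans : transitive cut_equiv.
Proof.
move=> g f h /eqP fg /eqP gh; apply/eqP/le_anti; rewrite cut_delta_ge0 andbT.
by apply: le_trans (cut_delta_triangle g f h) _; rewrite fg gh addr0.
Qed.

Canonical cut_equiv_canonical :=
  EquivRel cut_equiv cut_equiv_refl cut_equiv_sym cut_equiv_trans.

Local Open Scope quotient_scope.

Definition graphon_class : Type := {eq_quot cut_equiv}.
HB.instance Definition _ := Choice.on graphon_class.
HB.instance Definition _ := EqQuotient.on graphon_class.

Definition cls (f : graphon R) : graphon_class := \pi_graphon_class f.

Definition class_dist (F G : graphon_class) : R := cut_delta (repr F) (repr G).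

Lemma cut_delta_repr f : cut_delta (repr (cls f)) f = 0.
Proof. by have /eqmodP/eqP := reprK (cls f). Qed.

Lemma class_dist_cls f g : class_dist (cls f) (cls g) = cut_delta f g.
Proof.
apply/eqP; rewrite eq_le; apply/andP; split.
  apply: le_trans (cut_delta_triangle f _ _) _; rewrite cut_delta_repr add0r.
  apply: le_trans (cut_delta_triangle g _ _) _.
  by rewrite [X in _ + X]cut_delta_sym cut_delta_repr addr0.
apply: le_trans (cut_delta_triangle (repr (cls f)) _ _) _.
rewrite cut_delta_sym cut_delta_repr add0r.
apply: le_trans (cut_delta_triangle (repr (cls g)) _ _) _.
by rewrite cut_delta_repr addr0.
Qed.

Let class_distxx F : class_dist F F = 0. Proof. exact: cut_deltaxx. Qed.

Let class_dist_pos F G : class_dist F G = 0 -> F = G.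
Proof.
by move=> /eqP FG; rewrite -[F]reprK -[G]reprK; apply/eqmodP.
Qed.

Let class_dist_sym F G : class_dist F G = class_dist G F.
Proof. exact: cut_delta_sym. Qed.

Let class_dist_triangle G F H :
  class_dist F H <= class_dist F G + class_dist G H.
Proof. exact: cut_delta_triangle. Qed.

HB.instance Definition _ := isMetric.Build R graphon_class
  class_distxx class_dist_pos class_dist_sym class_dist_triangle.

End GraphonClass.

(* Indices are shifted by one: [block i] is the interval I_(i+1). *)
Definition block (R : realType) (k : nat) (i : 'I_k) : set (mR R) :=
  if i == 0%N :> nat then [set` `[0%R, k%:R^-1]]
  else [set` `]i%:R / k%:R, i.+1%:R / k%:R] ].

Arguments block R {k} i.

Definition step_fun (R : realType) (k : nat) (a : 'M[R]_k) (x y : R) : R :=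
  \sum_(i < k) \sum_(j < k) a i j * (\1_(block R i) x * \1_(block R j) y).

Record block_matrix (R : realType) (k : nat) := BlockMatrix {
  block_mx :> 'M[R]_k;
  block_mx_sym : forall i j, block_mx i j = block_mx j i;
  block_mx_ge0_le1 : forall i j, 0 <= block_mx i j <= 1
}.

Section BlockGraphon.
Variables (R : realType) (k : nat) (p : block_matrix R k).

Let block_lt (i j : 'I_k) x : (i < j)%N -> block R i x -> ~ block R j x.
Proof.
move=> ij; have j0 : (nat_of_ord j == 0%N) = false.
  by apply/negbTE; rewrite -lt0n; exact: leq_ltn_trans ij.
have k0 : 0 < k%:R :> R by rewrite ltr0n; exact: leq_ltn_trans (ltn_ord j).
have xle : block R i x -> x <= i.+1%:R / k%:R.
  rewrite /block; case: eqP => [->|_] /=; rewrite in_itv /= => /andP[_ h] //.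
  by rewrite mul1r.
move=> /xle xi; rewrite /block j0 /= in_itv /= => /andP[jx _].
have := lt_le_trans jx xi; rewrite ltr_pM2r ?invr_gt0// ltr_nat.
by rewrite ltnNge ij.
Qed.

Let block_inj (i j : 'I_k) x : block R i x -> block R j x -> i = j.
Proof.
move=> bi bj; apply/val_inj; case: (ltngtP i j) => // ij.
  by case: (block_lt ij bi).
by case: (block_lt ij bj).
Qed.

Let step_fun_le1 x y : 0 <= step_fun p x y <= 1.
Proof.
apply/andP; split.
  apply: sumr_ge0 => i _; apply: sumr_ge0 => j _.
  rewrite !indicE -natrM mulr_ge0//.
  by have /andP[] := block_mx_ge0_le1 p i j.
have [[i bi]|nx] := pselect (exists i : 'I_k, block R i x); last first.
  rewrite /step_fun big1// => i _; rewrite big1// => j _.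
  rewrite indicE memNset ?mul0r ?mulr0// => bi; by apply: nx; exists i.
have [[j bj]|ny] := pselect (exists j : 'I_k, block R j y); last first.
  rewrite /step_fun big1// => i' _; rewrite big1// => j _.
  rewrite [X in _ * (_ * X)]indicE memNset ?mulr0// => bj; by apply: ny; exists j.
rewrite /step_fun (bigD1 i)//= (bigD1 j)//= !indicE !mem_set// mulr1.
rewrite !big1 ?addr0.
- by rewrite mulr1; have /andP[] := block_mx_ge0_le1 p i j.
- move=> i' ii'; rewrite big1// => j' _; rewrite indicE memNset ?mul0r ?mulr0//.
  by move=> bi'; move/eqP: ii'; apply; exact: block_inj bi' bi.
- move=> j' jj'; rewrite [X in _ * (_ * X)]indicE memNset ?mulr0//.
  by move=> bj'; move/eqP: jj'; apply; exact: block_inj bj' bj.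
Qed.

Let step_fun_sym x y : step_fun p x y = step_fun p y x.
Proof.
rewrite /step_fun exchange_big; apply: eq_bigr => i _; apply: eq_bigr => j _.
by rewrite block_mx_sym [\1__ x * _]mulrC.
Qed.

Let measurable_block (i : 'I_k) : measurable (block R i).
Proof. by rewrite /block; case: ifP => _; exact: measurable_itv. Qed.

Let step_fun_measurable :
  measurable_fun unitSq (fun z : mR R * mR R => step_fun p z.1 z.2).
Proof.
apply: measurable_funTS; apply: measurable_sum => i; apply: measurable_sum => j.
have mi (l : 'I_k) : measurable_fun setT (\1_(block R l) : mR R -> R).
  exact: measurable_indic.
apply: measurable_funM => //; apply: measurable_funM.
  exact: (measurableT_comp (mi i) measurable_fst).
exact: (measurableT_comp (mi j) measurable_snd).
Qed.

Definition block_graphon : graphon R :=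
  @Graphon R (step_fun p) step_fun_measurable
    (fun x y _ _ => step_fun_sym x y) (fun x y _ _ => step_fun_le1 x y).

End BlockGraphon.

(* A simple graph on {0, ..., n-1}: an irreflexive symmetric set of ordered
   pairs (an edge {i, j} is present as both (i, j) and (j, i)). *)
Definition is_sgraph (n : nat) (E : {set 'I_n * 'I_n}) : bool :=
  [forall i, (i, i) \notin E] &&
  [forall i, forall j, ((i, j) \in E) ==> ((j, i) \in E)].

Record sgraph (n : nat) := SGraph {
  edges :> {set 'I_n * 'I_n};
  edgesP : is_sgraph edges
}.

HB.instance Definition _ (n : nat) := [isSub for @edges n].
HB.instance Definition _ (n : nat) := [Finite of sgraph n by <:].

Definition regular (n d : nat) (G : sgraph n) : Prop :=
  forall i : 'I_n, #|[set j | (i, j) \in edges G]| = d.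

Section EmpiricalGraphon.
Variables (R : realType) (n : nat) (G : sgraph n).

Definition adjacency_mx : 'M[R]_n := \matrix_(i, j) ((i, j) \in edges G)%:R.

Let adjacency_sym i j : adjacency_mx i j = adjacency_mx j i.
Proof.
have /andP[_ /'forall_forallP sG] := edgesP G.
rewrite !mxE; congr (_%:R); congr nat_of_bool.
by apply/idP/idP; apply/implyP.
Qed.

Let adjacency_ge0_le1 i j : 0 <= adjacency_mx i j <= 1.
Proof. by rewrite mxE; case: (_ \in _); rewrite ?lexx ler01. Qed.

(* The cells of theta_N are the blocks with k = N, so f^G is the step function
   of the adjacency matrix. *)
Definition empirical_graphon : graphon R :=
  block_graphon (BlockMatrix adjacency_sym adjacency_ge0_le1).

End EmpiricalGraphon.

Section Cube.
Variable R : realType.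

Definition tuple_cons (n : nat) (z : mR R * n.-tuple (mR R)) :
  n.+1.-tuple (mR R) := [tuple of z.1 :: z.2].

Lemma measurable_tuple_cons n : measurable_fun setT (@tuple_cons n).
Proof. exact: measurable_cons. Qed.

HB.instance Definition _ n :=
  isMeasurableFun.Build _ _ _ _ (@tuple_cons n) (@measurable_tuple_cons n).

(* Lebesgue measure on [0,1]^n, as the n-fold product of the uniform
   probability on [0,1]. *)
Fixpoint cube_prob (n : nat) : probability (n.-tuple (mR R)) R :=
  if n is m.+1 then
    distribution (uniform_prob (@ltr01 R) \x cube_prob m)%E (@tuple_cons m)
  else dirac [tuple].

End Cube.

Definition hom_density (R : realType) (v : nat) (H : sgraph v)
    (f : R -> R -> R) : R :=
  \int[cube_prob R v]_x
    \prod_(e in edges H | (e.1 < e.2)%N) f (tnth x e.1) (tnth x e.2).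

(* t(H, .) on classes; it does not depend on the representative. *)
Definition class_density (R : realType) (v : nat) (H : sgraph v)
    (F : graphon_class R) : R := hom_density H (repr F).

(* h_p(u).  Since [ln 0 = 0], the convention 0 log 0 = 0 holds in the last
   branch. *)
Definition rel_entropy (R : realType) (p u : R) : \bar R :=
  if (p == 0) || (p == 1) then (if u == p then 0%E else +oo%E)
  else (u * ln (u / p) + (1 - u) * ln ((1 - u) / (1 - p)))%:E.

Section RateFunction.
Variables (R : realType) (W0 : graphon R).

Definition rate_I (f : graphon R) : \bar R :=
  ((2^-1)%:E *
   \int[leb2 R]_(z in unitSq) rel_entropy (W0 z.1 z.2) (f z.1 z.2))%E.

Definition Omega : set (mR R * mR R) :=
  unitSq `&` [set z | 0 < W0 z.1 z.2 < 1].

Definition W_Omega : set (graphon R) :=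
  [set f | {ae leb2 R, forall z, (unitSq `\` Omega) z -> f z.1 z.2 = W0 z.1 z.2}].

Definition Wtilde_Omega : set (graphon_class R) :=
  [set F | exists2 g, W_Omega g & mdist F (cls g) = 0].

Definition rate_J (F : graphon_class R) : \bar R :=
  if `[< Wtilde_Omega F >] then
    ereal_sup [set ereal_inf [set rate_I h | h in [set h | mdist F (cls h) <= eta]]
              | eta in [set eta : R | 0 < eta]]
  else +oo%E.

(* A maximum over a compact space, hence written as a supremum. *)
Definition t_max (v : nat) (H : sgraph v) : R :=
  sup [set class_density H F | F in Wtilde_Omega].

End RateFunction.

Definition set_entry (R : realType) (k : nat) (p : 'M[R]_k) (a b : 'I_k) (q : R) :
    'M[R]_k :=
  \matrix_(i, j)
    if ((i, j) == (a, b)) || ((i, j) == (b, a)) then q else p i j.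

Definition relevant (R : realType) (k v : nat) (H : sgraph v)
    (p : block_matrix R k) (a b : 'I_k) : Prop :=
  0 < p a b /\
  forall q : R, 0 <= q < p a b ->
    hom_density H (step_fun (set_entry p a b q)) <
    hom_density H (step_fun p).

Section FMax.
Variables (R : realType) (k v : nat) (H : sgraph v) (p : block_matrix R k).

Definition f_max_mx : 'M[R]_k :=
  \matrix_(i, j) if `[< relevant H p i j >] then 1 else p i j.

Let relevant_sym i j : relevant H p i j -> relevant H p j i.
Proof.
rewrite /relevant (block_mx_sym p i j) => -[p0 h]; split => // q /h.
congr (hom_density _ (step_fun _) < _).
by apply/matrixP => x y; rewrite !mxE orbC.
Qed.

Let f_max_sym i j : f_max_mx i j = f_max_mx j i.
Proof.
rewrite !mxE (block_mx_sym p i j).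
by congr (if _ then _ else _); apply/asboolP/asboolP; exact: relevant_sym.
Qed.

Let f_max_ge0_le1 i j : 0 <= f_max_mx i j <= 1.
Proof.
rewrite mxE; case: ifP => _; first by rewrite lexx ler01.
exact: block_mx_ge0_le1.
Qed.

Definition f_max : graphon R :=
  block_graphon (BlockMatrix f_max_sym f_max_ge0_le1).

End FMax.

Lemma vertex_block_subproof (k n : nat) (i : 'I_(k * n)) : (i %/ n < k)%N.
Proof.
by case: n i => [|n] i; [case: i => m; rewrite muln0 | rewrite ltn_divLR].
Qed.

(* ceil(i/n), with both vertices and blocks numbered from 0 *)
Definition vertex_block (k n : nat) (i : 'I_(k * n)) : 'I_k :=
  Ordinal (vertex_block_subproof i).

Section RandomGraph.
Variables (R : realType) (k : nat) (p : block_matrix R k) (n : nat).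

(* P(G_{kn} = G), the pairs i < j being independent edges. *)
Definition graph_pmf (G : sgraph (k * n)) : R :=
  \prod_(e : 'I_(k * n) * 'I_(k * n) | (e.1 < e.2)%N)
    let q := p (vertex_block e.1) (vertex_block e.2) in
    if e \in edges G then q else 1 - q.

Definition graphon_law (A : set (graphon R)) : R :=
  \sum_(G : sgraph (k * n) | `[< A (empirical_graphon R G) >]) graph_pmf G.

(* Conditional probability and expectation given B; these are junk values when
   [graphon_law B = 0].  For B = {t(H, .) >= t_max} this does happen: f^G
   vanishes on the diagonal cells, so B is null as soon as a diagonal block is
   relevant (e.g. k = 1, 0 < p, H = K_2, where t_max = 1 > t(H, G)). *)
Definition cond_law (A B : set (graphon R)) : R :=
  graphon_law (A `&` B) / graphon_law B.

Definition cond_expectation (phi : graphon_class R -> R) (B : set (graphon R)) : R :=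
  (\sum_(G : sgraph (k * n) | `[< B (empirical_graphon R G) >])
     graph_pmf G * phi (cls (empirical_graphon R G))) / graphon_law B.

End RandomGraph.

Definition unique_minimizer (R : realType) (T : Type) (A : set T)
    (J : T -> \bar R) (x : T) : Prop :=
  [/\ A x, forall y, A y -> (J x <= J y)%E
    & forall y, A y -> (forall z, A z -> (J y <= J z)%E) -> y = x].

(* Main.v *)
Require Import Defs.
From mathcomp Require Import all_boot all_order all_algebra.
From mathcomp Require Import all_classical all_reals all_analysis.
From mathcomp Require Import measurable_realfun ring lra.
Import Order.TTheory GRing.Theory Num.Theory.
Import numFieldNormedType.Exports.
Local Open Scope classical_set_scope.
Local Open Scope ring_scope.

(** The proof rests on a description of relevance.  Call a map from the vertices
of [H] to the blocks positive when it sends every edge to a block pair with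
positive entry.  The density of a step function is a sum over such maps, so a
block is relevant exactly when some positive map sends an edge to it
([pos_hom_relevant], [relevant_pos_hom]).  A graphon which agrees with [W0]
where [W0] is 0 or 1 lies below the indicator [f_pos] of the positive blocks,
and [f_pos], [f_max] and the indicator [f_rel] of the relevant blocks have the
same density, since only relevant blocks enter positive maps.  Hence the
maximal density is that of [f_max] ([t_maxE]).  Quantitatively, the density
missing from a graphon [h] below [f_pos] is at least a constant times the
integral of [1 - h] over the relevant blocks ([relevant_deficit]).

For the minimization, fix a small [s].  On an irrelevant block the entropy of
[h] is at least [s |h - W0|] up to an error of order [s^2]; on a relevant block
it is at least the entropy of the value 1 minus a multiple of [1 - h], up to
the same error ([entropy_gap]).  Both come from the variational lower bound
[rel_entropy_var].  Integrating, a graphon with nearly maximal density has rate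
at least that of [f_max] plus a multiple of [s] times its L1 distance to
[f_max], minus a multiple of [s^2] ([entropy_stability]).  The function [rate_J]
at a class [F] is a relaxation over graphons [h] close to [F].  By the counting
lemma ([hom_density_cut_delta]) these [h] have nearly maximal density when [F]
has the maximal one, so that [rate_J F] is at least the rate of [f_max], and in
case of equality the approximants converge to [f_max] as well as to [F].

For the conditional law, a graph in the support of the random graph has
density at least the maximal one exactly when every pair of vertices in
relevant blocks is an edge.  Conditioning on the upper tail therefore gives a
random graph with independent edges again, whose block matrix is that of
[f_max] ([conditional_pmf]).  Its empirical graphon is close to [f_max] in the
cut distance by Chernoff's bound: there are [4 ^ N] rectangles of vertices, and
each deviates with probability exponentially small in [N ^ 2]
([cut_deviation_le], [far_mass_le]).  Convergence of the conditional laws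
follows by splitting the expectation according to the distance to [f_max]. *)

Set Implicit Arguments.
Unset Strict Implicit.
Unset Printing Implicit Defensive.

(** * Integrals of bounded measurable functions against probabilities *)

(** Such functions are integrable for every probability, which keeps
integrability out of all side conditions below. *)
Definition bmeas {d} {T : measurableType d} {R : realType} (f : T -> R) : Prop :=
  measurable_fun setT f /\ exists M, forall x, `|f x| <= M.

Section BoundedMeasurable.
Context d (T : measurableType d) (R : realType).
Implicit Types f g : T -> R.

Lemma bmeas_measurable f : bmeas f -> measurable_fun setT f.
Proof. by case. Qed.

Lemma bmeas_cst (c : R) : bmeas (fun _ : T => c).
Proof. by split; [exact: measurable_cst | exists `|c|]. Qed.

Lemma bmeasD f g : bmeas f -> bmeas g -> bmeas (fun x => f x + g x).
Proof.
move=> [mf [M fM]] [mg [N gN]]; split; first exact: measurable_funD.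
by exists (M + N) => x; rewrite (le_trans (ler_normD _ _))// lerD.
Qed.

Lemma bmeasM f g : bmeas f -> bmeas g -> bmeas (fun x => f x * g x).
Proof.
move=> [mf [M fM]] [mg [N gN]]; split; first exact: measurable_funM.
by exists (M * N) => x; rewrite normrM ler_pM.
Qed.

Lemma bmeasN f : bmeas f -> bmeas (fun x => - f x).
Proof.
move=> [mf [M fM]]; split; first exact: measurableT_comp.
by exists M => x; rewrite normrN.
Qed.

Lemma bmeasB f g : bmeas f -> bmeas g -> bmeas (fun x => f x - g x).
Proof. by move=> bf bg; apply: bmeasD => //; exact: bmeasN. Qed.

Lemma bmeas_norm f : bmeas f -> bmeas (fun x => `|f x|).
Proof.
move=> [mf [M fM]]; split; first exact: measurableT_comp.
by exists M => x; rewrite normr_id.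
Qed.

Lemma bmeas_min f g : bmeas f -> bmeas g -> bmeas (fun x => Num.min (f x) (g x)).
Proof.
move=> [mf [M fM]] [mg [N gN]]; split; first exact: measurable_minr.
exists (M + N) => x.
have M0 : 0 <= M by exact: le_trans (fM x).
have N0 : 0 <= N by exact: le_trans (gN x).
by case: (leP (f x) (g x)) => _;
  [rewrite (le_trans (fM x))// lerDl | rewrite (le_trans (gN x))// lerDr].
Qed.

Lemma bmeas_indic (A : set T) : measurable A -> bmeas (\1_A : T -> R).
Proof.
move=> mA; split; first exact: measurable_indic.
by exists 1 => x; rewrite indicE; case: (_ \in _); rewrite ?normr1 ?normr0.
Qed.

Lemma bmeas_sum (I : Type) (s : seq I) (p : pred I) (F : I -> T -> R) :
  (forall i, p i -> bmeas (F i)) -> bmeas (fun x => \sum_(i <- s | p i) F i x).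
Proof.
move=> H; elim: s => [|i s IH].
  rewrite (_ : (fun _ => _) = fun=> 0); first exact: bmeas_cst.
  by apply/funext => x; rewrite big_nil.
have [pi|npi] := boolP (p i).
  rewrite (_ : (fun _ => _) = fun x => F i x + \sum_(j <- s | p j) F j x).
    by apply: bmeasD => //; exact: H.
  by apply/funext => x; rewrite big_cons pi.
rewrite (_ : (fun _ => _) = fun x => \sum_(j <- s | p j) F j x)//.
by apply/funext => x; rewrite big_cons (negbTE npi).
Qed.

Lemma bmeas_prod (I : Type) (s : seq I) (p : pred I) (F : I -> T -> R) :
  (forall i, p i -> bmeas (F i)) -> bmeas (fun x => \prod_(i <- s | p i) F i x).
Proof.
move=> H; elim: s => [|i s IH].
  rewrite (_ : (fun _ => _) = fun=> 1); first exact: bmeas_cst.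
  by apply/funext => x; rewrite big_nil.
have [pi|npi] := boolP (p i).
  rewrite (_ : (fun _ => _) = fun x => F i x * \prod_(j <- s | p j) F j x).
    by apply: bmeasM => //; exact: H.
  by apply/funext => x; rewrite big_cons pi.
rewrite (_ : (fun _ => _) = fun x => \prod_(j <- s | p j) F j x)//.
by apply/funext => x; rewrite big_cons (negbTE npi).
Qed.

End BoundedMeasurable.

Lemma bmeas_comp d d' (T : measurableType d) (T' : measurableType d')
    (R : realType) (f : T' -> R) (g : T -> T') :
  bmeas f -> measurable_fun setT g -> bmeas (fun x => f (g x)).
Proof.
move=> [mf [M fM]] mg; split; first exact: measurableT_comp.
by exists M.
Qed.

Lemma bmeas_fst d d' (T : measurableType d) (T' : measurableType d') (R : realType)
    (u : T -> R) : bmeas u -> bmeas (fun z : T * T' => u z.1).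
Proof. by move=> bu; exact: (bmeas_comp bu measurable_fst). Qed.

Lemma bmeas_snd d d' (T : measurableType d) (T' : measurableType d') (R : realType)
    (u : T' -> R) : bmeas u -> bmeas (fun z : T * T' => u z.2).
Proof. by move=> bu; exact: (bmeas_comp bu measurable_snd). Qed.

Arguments bmeas_fst {d d' T T' R u}.
Arguments bmeas_snd {d d' T T' R u}.

Section BoundedIntegral.
Context d (T : measurableType d) (R : realType) (P : probability T R).
Implicit Types f g : T -> R.

Lemma bmeas_integrable f : bmeas f -> P.-integrable setT (EFin \o f).
Proof.
move=> [mf [M fM]]; apply: measurable_bounded_integrable => //.
  by apply: (le_lt_trans (probability_le1 P _)); rewrite ?ltry.
exists M; split; first exact: num_real; move=> x Mx y _ /=;
  exact: le_trans (fM y) (ltW Mx).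
Qed.

Lemma EFin_bint f : bmeas f -> (\int[P]_x f x)%:E = (\int[P]_x (f x)%:E)%E.
Proof.
move=> /bmeas_integrable If; rewrite fineK//.
by apply: integrable_fin_num => //; exact: If.
Qed.

Lemma bint_cst (c : R) : \int[P]_x c = c.
Proof.
rewrite Rintegral_cst//.
by apply: (etrans (congr1 (fun r => c * fine r) (probability_setT P))); rewrite mulr1.
Qed.

Lemma bintD f g : bmeas f -> bmeas g ->
  \int[P]_x (f x + g x) = \int[P]_x f x + \int[P]_x g x.
Proof. by move=> bf bg; rewrite RintegralD//; exact: bmeas_integrable. Qed.

Lemma bintB f g : bmeas f -> bmeas g ->
  \int[P]_x (f x - g x) = \int[P]_x f x - \int[P]_x g x.
Proof. by move=> bf bg; rewrite RintegralB//; exact: bmeas_integrable. Qed.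

Lemma bintZl c f : bmeas f -> \int[P]_x (c * f x) = c * \int[P]_x f x.
Proof. by move=> bf; rewrite RintegralZl//; exact: bmeas_integrable. Qed.

Lemma bintZr c f : bmeas f -> \int[P]_x (f x * c) = \int[P]_x f x * c.
Proof. by move=> bf; rewrite RintegralZr//; exact: bmeas_integrable. Qed.

Lemma bintN f : bmeas f -> \int[P]_x (- f x) = - \int[P]_x f x.
Proof.
by move=> bf; rewrite -mulN1r -bintZl//; apply: eq_Rintegral => x _; rewrite mulN1r.
Qed.

Lemma bint_le f g : bmeas f -> bmeas g -> (forall x, f x <= g x) ->
  \int[P]_x f x <= \int[P]_x g x.
Proof. by move=> bf bg fg; apply: le_Rintegral => //; exact: bmeas_integrable. Qed.

Lemma bint_norm f : bmeas f -> `|\int[P]_x f x| <= \int[P]_x `|f x|.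
Proof. by move=> bf; apply: le_normr_Rintegral => //; exact: bmeas_integrable. Qed.

Lemma bint_norm_le f c : bmeas f -> (forall x, `|f x| <= c) ->
  `|\int[P]_x f x| <= c.
Proof.
move=> bf fc; apply: le_trans (bint_norm bf) _; rewrite -[leRHS]bint_cst.
by apply: bint_le => //; [exact: bmeas_norm | exact: bmeas_cst].
Qed.

Lemma bint_sum (I : Type) (s : seq I) (p : pred I) (F : I -> T -> R) :
  (forall i, p i -> bmeas (F i)) ->
  \int[P]_x (\sum_(i <- s | p i) F i x) = \sum_(i <- s | p i) \int[P]_x F i x.
Proof.
move=> H; elim: s => [|i s IH].
  by under eq_Rintegral do rewrite big_nil; rewrite bint_cst big_nil.
under eq_Rintegral do rewrite big_cons.
rewrite big_cons; case: ifPn => // pi.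
by rewrite bintD ?IH//; [exact: H | exact: bmeas_sum].
Qed.

End BoundedIntegral.

Section BoundedFubini.
Context d d' (T : measurableType d) (T' : measurableType d') (R : realType).
Variables (P : probability T R) (Q : probability T' R).
Implicit Types f : T * T' -> R.

Lemma bmeas_section1 f x : bmeas f -> bmeas (fun y => f (x, y)).
Proof. by move=> bf; apply: (bmeas_comp bf); exact: measurable_pair1. Qed.

Lemma bmeas_section2 f y : bmeas f -> bmeas (fun x => f (x, y)).
Proof. by move=> bf; apply: (bmeas_comp bf); exact: measurable_pair2. Qed.

Lemma bmeas_bint2 f : bmeas f -> bmeas (fun x => \int[Q]_y f (x, y)).
Proof.
move=> bf; have [mf [M fM]] := bf; split.
  apply/measurable_EFinP.
  rewrite (_ : _ \o _ = fubini_F Q (EFin \o f)).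
    by apply: measurable_fubini_F; exact: (@bmeas_integrable _ _ _ (P \x Q)%E).
  by apply/funext => x /=; rewrite (EFin_bint _ (bmeas_section1 x bf)).
by exists M => x; apply: bint_norm_le; first exact: bmeas_section1.
Qed.

Lemma bmeas_bint1 f : bmeas f -> bmeas (fun y => \int[P]_x f (x, y)).
Proof.
move=> bf; have [mf [M fM]] := bf; split.
  apply/measurable_EFinP.
  rewrite (_ : _ \o _ = fubini_G P (EFin \o f)).
    by apply: measurable_fubini_G; exact: (@bmeas_integrable _ _ _ (P \x Q)%E).
  by apply/funext => y /=; rewrite (EFin_bint _ (bmeas_section2 y bf)).
by exists M => y; apply: bint_norm_le; first exact: bmeas_section2.
Qed.

Lemma bint_prod f : bmeas f ->
  \int[(P \x Q)%E]_z f z = \int[P]_x (\int[Q]_y f (x, y)).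
Proof.
move=> bf; apply: EFin_inj; rewrite (EFin_bint (P \x Q)%E bf).
rewrite (EFin_bint _ (bmeas_bint2 bf)).
under [RHS]eq_integral do rewrite (EFin_bint _ (bmeas_section1 _ bf)).
by rewrite -(@integral12_prod_meas1 _ _ _ _ _ P Q (EFin \o f))//;
  exact: (@bmeas_integrable _ _ _ (P \x Q)%E).
Qed.

Lemma bint_swap f : bmeas f ->
  \int[P]_x (\int[Q]_y f (x, y)) = \int[Q]_y (\int[P]_x f (x, y)).
Proof.
move=> bf; rewrite -bint_prod//; apply: EFin_inj; rewrite (EFin_bint (P \x Q)%E bf).
rewrite (EFin_bint _ (bmeas_bint1 bf)).
under [RHS]eq_integral do rewrite (EFin_bint _ (bmeas_section2 _ bf)).
by rewrite -(@integral21_prod_meas1 _ _ _ _ _ P Q (EFin \o f))//;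
  exact: (@bmeas_integrable _ _ _ (P \x Q)%E).
Qed.

End BoundedFubini.

(** * The uniform laws on the unit interval and the unit square *)

Definition unif (R : realType) : probability (mR R) R := uniform_prob (@ltr01 R).

Notation unif2 R := (unif R \x unif R)%E.

Section Uniform.
Variable R : realType.
Local Notation I := (@unitI R).
Local Notation mu := (@lebesgue_measure R).

Lemma measurable_unitI : measurable I. Proof. exact: measurable_itv. Qed.

Lemma measurable_unitSq : measurable (@unitSq R).
Proof. by apply: measurableX; exact: measurable_unitI. Qed.

Lemma ge0_integral_unif (F : mR R -> \bar R) : measurable_fun setT F ->
  (forall x, 0 <= F x)%E -> (\int[unif R]_x F x = \int[mu]_(x in I) F x)%E.
Proof. by move=> mF F0; rewrite integral_uniform// subr0 invr1 mul1e. Qed.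

(** Both sides are the same iterated integral over [0, 1], by
Tonelli's theorem. *)
Lemma ge0_integral_unif2 (F : mR R * mR R -> \bar R) : measurable_fun setT F ->
  (forall z, 0 <= F z)%E ->
  (\int[unif2 R]_z F z = \int[leb2 R]_(z in unitSq) F z)%E.
Proof.
move=> mF F0.
rewrite (fubini_tonelli1 (m1 := unif R) (m2 := unif R))//.
rewrite /fubini_F.
rewrite ge0_integral_unif; first last.
- by move=> x; apply: integral_ge0.
- exact: (measurable_fun_fubini_tonelli_F (m2 := unif R)).
rewrite (eq_integral (fun x => \int[mu]_(y in I) F (x, y))%E); last first.
  move=> x _; rewrite ge0_integral_unif//.
  by apply: measurableT_comp => //; exact: measurable_pair1.
rewrite [RHS]integral_mkcond (fubini_tonelli1 (m1 := mu) (m2 := mu))//; last 2 first.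
- by apply/(measurable_restrictT _ measurable_unitSq); exact: measurable_funTS.
- by move=> z; rewrite patchE; case: ifP.
rewrite [LHS]integral_mkcond; apply: eq_integral => x _.
rewrite /fubini_F patchE; case: ifPn => [/set_mem Ix|/negP nIx].
  rewrite [LHS]integral_mkcond; apply: eq_integral => y _; rewrite !patchE.
  congr (if _ then _ else _); apply/idP/idP => /set_mem h; apply/mem_set => //.
  by case: h.
apply/esym; apply: integral0_eq => y _; rewrite patchE ifN//;
  apply/negP => /set_mem[/= ? _].
by apply: nIx; exact/mem_set.
Qed.

Lemma integral_unif2 (F : mR R * mR R -> \bar R) : measurable_fun setT F ->
  (\int[unif2 R]_z F z = \int[leb2 R]_(z in unitSq) F z)%E.
Proof.
move=> mF; rewrite integralE [RHS]integralE.
by rewrite !ge0_integral_unif2//;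
  [exact: measurable_funeneg | exact: measurable_funepos].
Qed.

Lemma eq_bint_unif (f g : mR R -> R) : bmeas f -> bmeas g ->
  (forall x, I x -> f x = g x) -> \int[unif R]_x f x = \int[unif R]_x g x.
Proof.
move=> bf bg fg; apply/eqP; rewrite -subr_eq0 -bintB// -normr_le0.
have bfg := bmeasB bf bg.
apply: le_trans (bint_norm _ bfg) _; rewrite /Rintegral ge0_integral_unif//.
- by rewrite integral0_eq// => x /fg ->; rewrite subrr normr0.
- by apply/measurable_EFinP; case: (bmeas_norm bfg).
Qed.

Lemma eq_bint_unif2 (f g : mR R * mR R -> R) : bmeas f -> bmeas g ->
  (forall z, unitSq z -> f z = g z) -> \int[unif2 R]_x f x = \int[unif2 R]_x g x.
Proof.
move=> bf bg fg; rewrite /Rintegral !integral_unif2; first last.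
- by apply/measurable_EFinP; case: bf.
- by apply/measurable_EFinP; case: bg.
by congr fine; apply: eq_integral => z /set_mem /fg ->.
Qed.

Lemma le_bint_unif2 (f g : mR R * mR R -> R) : bmeas f -> bmeas g ->
  (forall z, unitSq z -> f z <= g z) -> \int[unif2 R]_x f x <= \int[unif2 R]_x g x.
Proof.
move=> bf bg fg.
have b1 := bmeas_indic R measurable_unitSq.
rewrite (@eq_bint_unif2 f (fun z => f z * \1_unitSq z))//; first last.
- by move=> z Iz; rewrite indicE mem_set// mulr1.
- exact: bmeasM.
rewrite (@eq_bint_unif2 g (fun z => g z * \1_unitSq z))//; first last.
- by move=> z Iz; rewrite indicE mem_set// mulr1.
- exact: bmeasM.
apply: bint_le; [exact: bmeasM|exact: bmeasM|] => z.
by rewrite indicE; case: (boolP (_ \in _)) => [/set_mem/fg|_]; rewrite ?mulr1 ?mulr0.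
Qed.

Lemma Rintegral_rect (h : mR R * mR R -> R) (S T : set (mR R)) : bmeas h ->
  measurable S -> measurable T -> S `<=` I -> T `<=` I ->
  \int[leb2 R]_(z in S `*` T) h z =
  \int[unif2 R]_z (h z * (\1_S z.1 * \1_T z.2)).
Proof.
move=> bh mS mT SI TI.
have -> : S `*` T = unitSq `&` (S `*` T).
  by apply/seteqP; split => [z [Sz Tz]|z []//]; split=> //; split;
    [exact: SI | exact: TI].
rewrite Rintegral_mkcondr /Rintegral integral_unif2.
  congr fine; apply: eq_integral => z _; rewrite patchE; congr EFin.
  rewrite !indicE -natrM mulnb; case: ifPn => [/set_mem[/= Sz Tz]|nz].
    by rewrite !mem_set// mulr1.
  case: (boolP (_ && _)); last by rewrite mulr0.
  by move=> /andP[/set_mem Sz /set_mem Tz]; case/negP: nz; apply/mem_set.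
have bS : bmeas (fun z : mR R * mR R => \1_S z.1 : R) by apply: bmeas_fst;
  exact: bmeas_indic.
have bT : bmeas (fun z : mR R * mR R => \1_T z.2 : R) by apply: bmeas_snd;
  exact: bmeas_indic.
by apply/measurable_EFinP; case: (bmeasM bh (bmeasM bS bT)).
Qed.

End Uniform.

(** * Sets attain the cut norm *)

(** The left-hand side is linear in [u], so among weights valued
in [0, 1] it is largest at the indicator of the points where the partial
integral of [D] is positive. *)
Lemma bint_maximize d d' (T : measurableType d) (T' : measurableType d')
    (R : realType) (P : probability T R) (Q : probability T' R)
    (D : T * T' -> R) (u : T -> R) : bmeas D -> bmeas u ->
  (forall x, 0 <= u x <= 1) ->
  exists2 S : set T, measurable S &
    \int[(P \x Q)%E]_z (D z * u z.1) <= \int[(P \x Q)%E]_z (D z * \1_S z.1).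
Proof.
move=> bD bu u01; pose L x := \int[Q]_y D (x, y).
have bL : bmeas L := bmeas_bint2 P Q bD.
have mS : measurable [set x | 0 < L x].
  rewrite (_ : [set x | 0 < L x] = setT `&` L @^-1` `]0, +oo[%classic).
    by apply: (proj1 bL) => //; exact: measurable_itv.
  by rewrite setTI; apply/seteqP; split => x /=; rewrite in_itv /= andbT.
have E w : bmeas w -> \int[(P \x Q)%E]_z (D z * w z.1) = \int[P]_x (L x * w x).
  move=> bw; rewrite (bint_prod P Q (f := fun z => D z * w z.1)).
    by apply: eq_Rintegral => x _ /=; rewrite bintZr//; exact: bmeas_section1.
  by apply: bmeasM => //; exact: bmeas_fst.
exists [set x | 0 < L x] => //; rewrite !E//; last exact: bmeas_indic.
apply: bint_le; [exact: bmeasM|apply: bmeasM => //; exact: bmeas_indic|] => x.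
have /andP[u0 u1] := u01 x; rewrite indicE.
case: (boolP (_ \in _)) => [/set_mem /= L0|/negP nL].
  by rewrite mulr1 ler_piMr// ltW.
have {nL}L0 : L x <= 0 by rewrite leNgt; apply/negP => L0; apply: nL; exact/mem_set.
by rewrite mulr0 mulr_le0_ge0.
Qed.

Lemma bint_prodC d d' (T : measurableType d) (T' : measurableType d')
    (R : realType) (P : probability T R) (Q : probability T' R)
    (D : T * T' -> R) : bmeas D ->
  \int[(P \x Q)%E]_z D z = \int[(Q \x P)%E]_z D (z.2, z.1).
Proof.
move=> bD; rewrite bint_prod// bint_swap//; first last.
  by rewrite (bint_prod Q P (f := fun z => D (z.2, z.1)))//;
    apply: (bmeas_comp bD); exact: measurable_swap.
Qed.

(** The weights are replaced by indicators one after the other,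
with [bint_maximize] applied to each variable in turn. *)
Lemma cut_norm_le (R : realType) (D : mR R * mR R -> R) (c : R) : bmeas D ->
  (forall S T : set (mR R), measurable S -> measurable T -> S `<=` unitI -> T `<=`
    unitI ->
    \int[unif2 R]_z (D z * (\1_S z.1 * \1_T z.2)) <= c) ->
  forall u w : mR R -> R, bmeas u -> bmeas w ->
  (forall x, 0 <= u x <= 1) -> (forall x, 0 <= w x <= 1) ->
  \int[unif2 R]_z (D z * (u z.1 * w z.2)) <= c.
Proof.
move=> bD Hc u w bu bw u01 w01.
have [S mS leS] := bint_maximize (unif R) (unif R) (bmeasM bD (bmeas_snd bw)) bu u01.
have bS := bmeas_indic R mS.
have bD2 : bmeas (fun z : mR R * mR R => D (z.2, z.1) * \1_S z.2).
  by apply: bmeasM; [apply: (bmeas_comp bD); exact: measurable_swap|exact: bmeas_snd].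
have [T mT leT] := bint_maximize (unif R) (unif R) bD2 bw w01.
have bT := bmeas_indic R mT.
have mSI : measurable (S `&` unitI) by apply: measurableI => //;
  exact: measurable_unitI.
have mTI : measurable (T `&` unitI) by apply: measurableI => //;
  exact: measurable_unitI.
apply: le_trans (Hc _ _ mSI mTI (@subIsetr _ _ _) (@subIsetr _ _ _)).
rewrite (_ : \int[unif2 R]_z _ = \int[unif2 R]_z (D z * w z.2 * u z.1)); last first.
  by apply: eq_Rintegral => z _; rewrite mulrAC mulrA.
apply: le_trans leS _.
rewrite bint_prodC /=; last first.
  by apply: bmeasM; [apply: bmeasM => //; exact: bmeas_snd | exact: bmeas_fst].
rewrite (_ : \int[unif2 R]_z _ = \int[unif2 R]_z (D (z.2, z.1) * \1_S z.2 * w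
  z.1)); last first.
  by apply: eq_Rintegral => z _; rewrite mulrAC.
apply: le_trans leT _.
rewrite bint_prodC /=; last first.
  by apply: bmeasM => //; exact: bmeas_fst.
rewrite le_eqVlt; apply/orP; left; apply/eqP.
apply: eq_bint_unif2.
- apply: bmeasM; last exact: bmeas_snd.
  apply: bmeasM; last exact: bmeas_fst.
  by apply: (bmeas_comp bD); exact: measurable_fun_pair.
- apply: bmeasM; first by [].
  by apply: bmeasM; [apply: bmeas_fst|apply: bmeas_snd]; exact: bmeas_indic.
- move=> [x y] [/= Ix Iy]; rewrite mulrA; congr (_ * _ * _).
    by rewrite !indicE in_setI (mem_set Ix) andbT.
  by rewrite !indicE in_setI (mem_set Iy) andbT.
Qed.

(** * The uniform law on the cube *)

Section Cube.
Variable R : realType.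
Local Notation cube := (@cube_prob R).
Local Notation U := (unif R).

Lemma bmeas_cons n (F : n.+1.-tuple (mR R) -> R) : bmeas F ->
  bmeas (fun z : mR R * n.-tuple (mR R) => F (tuple_cons z)).
Proof. by move=> bF; apply: (bmeas_comp bF); exact: measurable_tuple_cons. Qed.

Lemma bint_cubeS n (F : n.+1.-tuple (mR R) -> R) : bmeas F ->
  \int[cube n.+1]_x F x = \int[U]_a (\int[cube n]_x F (tuple_cons (a, x))).
Proof.
move=> bF; have bF' := bmeas_cons bF.
rewrite -(bint_prod U (cube n) bF') /Rintegral; congr fine.
rewrite -[RHS]/(\int[(U \x cube n)%E]_x ((EFin \o F) \o @tuple_cons R n) x)%E.
apply: (integral_distribution (P := (U \x cube n)%E)
  (X := @tuple_cons R n) (f := EFin \o F)).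
  by apply/measurable_EFinP; case: bF.
exact: (bmeas_integrable (U \x cube n)%E bF').
Qed.

Lemma bmeas_tnth n (i : 'I_n) (u : mR R -> R) : bmeas u ->
  bmeas (fun x : n.-tuple (mR R) => u (tnth x i)).
Proof. by move=> bu; apply: (bmeas_comp bu); exact: measurable_tnth. Qed.

Lemma bmeas_tnth2 n (i j : 'I_n) (K : mR R * mR R -> R) : bmeas K ->
  bmeas (fun x : n.-tuple (mR R) => K (tnth x i, tnth x j)).
Proof.
move=> bK; apply: (bmeas_comp bK).
by apply: measurable_fun_pair; exact: measurable_tnth.
Qed.

Definition upd n (x : n.-tuple (mR R)) (i : 'I_n) (y : mR R) : n.-tuple (mR R) :=
  [tuple if l == i then y else tnth x l | l < n].

Lemma tnth_upd n (x : n.-tuple (mR R)) i y l :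
  tnth (upd x i y) l = if l == i then y else tnth x l.
Proof. by rewrite tnth_mktuple. Qed.

Lemma measurable_upd n (i : 'I_n) :
  measurable_fun setT (fun z : n.-tuple (mR R) * mR R => upd z.1 i z.2).
Proof.
apply/measurable_fun_tnthP => l.
have [->|li] := eqVneq l i.
  rewrite (_ : _ \o _ = snd)//.
  by apply/funext => z /=; rewrite tnth_upd eqxx.
rewrite (_ : _ \o _ = (@tnth n (mR R))^~ l \o fst).
  by apply: measurableT_comp; [exact: measurable_tnth | exact: measurable_fst].
by apply/funext => z /=; rewrite tnth_upd (negbTE li).
Qed.

Lemma bmeas_upd n (i : 'I_n) (F : n.-tuple (mR R) -> R) : bmeas F ->
  bmeas (fun z : n.-tuple (mR R) * mR R => F (upd z.1 i z.2)).
Proof. by move=> bF; exact: (bmeas_comp bF (@measurable_upd n i)). Qed.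

Lemma upd_cons0 n a (x : n.-tuple (mR R)) y :
  upd (tuple_cons (a, x)) ord0 y = tuple_cons (y, x).
Proof.
apply: eq_from_tnth => l; rewrite tnth_upd.
by case: (unliftP ord0 l) => [l' ->|->] /=; rewrite ?tnthS.
Qed.

Lemma upd_consS n a (x : n.-tuple (mR R)) y j :
  upd (tuple_cons (a, x)) (lift ord0 j) y = tuple_cons (a, upd x j y).
Proof.
apply: eq_from_tnth => l; rewrite tnth_upd.
case: (unliftP ord0 l) => [l' ->|->] //=.
by rewrite !tnthS tnth_upd (inj_eq (@lift_inj _ _)).
Qed.

(** The coordinates are independent, so drawing one of them afresh
leaves the law of the whole tuple unchanged. *)
Lemma bint_resample n (i : 'I_n) (F : n.-tuple (mR R) -> R) : bmeas F ->
  \int[cube n]_x F x = \int[cube n]_x (\int[U]_y F (upd x i y)).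
Proof.
elim: n i F => [|n IH] i F bF; first by case: i.
have bF' := bmeas_cons bF.
have bG : bmeas (fun x : n.+1.-tuple (mR R) => \int[U]_y F (upd x i y)).
  exact: (bmeas_bint2 (cube n.+1) U (bmeas_upd i bF)).
rewrite bint_cubeS// [RHS]bint_cubeS//.
case: (unliftP ord0 i) => [j|] ->.
  apply: eq_Rintegral => a _.
  rewrite (IH j _ (bmeas_section1 a bF')); apply: eq_Rintegral => x _.
  by apply: eq_Rintegral => y _; rewrite upd_consS.
under [RHS]eq_Rintegral => a _.
  under eq_Rintegral => x _.
    under eq_Rintegral => y _ do rewrite upd_cons0.
    over.
  over.
rewrite bint_cst; exact: (bint_swap U (cube n) bF').
Qed.

Lemma bint_resample2 n (i j : 'I_n) (F : n.-tuple (mR R) -> R) : bmeas F ->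
  \int[cube n]_x F x =
  \int[cube n]_x (\int[U]_y (\int[U]_z F (upd (upd x i y) j z))).
Proof.
move=> bF; rewrite (bint_resample j bF) (bint_resample i)//.
exact: (bmeas_bint2 (cube n) U (bmeas_upd j bF)).
Qed.

Lemma bmeas_resample2 n (i j : 'I_n) (F : n.-tuple (mR R) -> R) : bmeas F ->
  bmeas (fun x => \int[U]_y (\int[U]_z F (upd (upd x i y) j z))).
Proof.
move=> bF; have bG := bmeas_bint2 (cube n) U (bmeas_upd j bF).
exact: (bmeas_bint2 (cube n) U (bmeas_upd i bG)).
Qed.

Lemma bint_cube_prod n (F : 'I_n -> mR R -> R) : (forall l, bmeas (F l)) ->
  \int[cube n]_x (\prod_l F l (tnth x l)) = \prod_l (\int[U]_y F l y).
Proof.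
elim: n F => [|n IH] F bF.
  by under eq_Rintegral do rewrite big_ord0; rewrite bint_cst big_ord0.
rewrite bint_cubeS; last by apply: bmeas_prod => l _; exact: bmeas_tnth.
rewrite big_ord_recl -IH//.
have E a (x : n.-tuple (mR R)) : \prod_l F l (tnth (tuple_cons (a, x)) l) =
    F ord0 a * \prod_l F (lift ord0 l) (tnth x l).
  by rewrite big_ord_recl; congr (_ * _); apply: eq_bigr => l _; rewrite tnthS.
rewrite -bintZr//; apply: eq_Rintegral => a _.
rewrite -bintZl; last by apply: bmeas_prod => l _; exact: bmeas_tnth.
by apply: eq_Rintegral => x _; rewrite E.
Qed.

Lemma bint_cube_map n (phi : mR R -> mR R) (F : n.-tuple (mR R) -> R) :
  measurable_fun setT phi ->
  (forall u, bmeas u -> \int[U]_y u (phi y) = \int[U]_y u y) -> bmeas F ->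
  \int[cube n]_x F (map_tuple phi x) = \int[cube n]_x F x.
Proof.
move=> mphi phiU; elim: n F => [|n IH] F bF.
  by apply: eq_Rintegral => x _; rewrite (tuple0 x) (tuple0 (map_tuple _ _)).
have mmap m : measurable_fun setT (fun x : m.-tuple (mR R) => map_tuple phi x).
  apply/measurable_fun_tnthP => l.
  rewrite (_ : _ \o _ = phi \o (@tnth m (mR R))^~ l).
    by apply: measurableT_comp => //; exact: measurable_tnth.
  by apply/funext => x /=; rewrite tnth_map.
have bF' := bmeas_cons bF.
rewrite bint_cubeS; last exact: (bmeas_comp bF (mmap _)).
rewrite [RHS]bint_cubeS// -[RHS]phiU; last exact: (bmeas_bint2 U (cube n) bF').
apply: eq_Rintegral => a _; rewrite -[RHS]IH; last exact: (bmeas_section1 (phi a) bF').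
by apply: eq_Rintegral => x _; congr F; apply: val_inj.
Qed.

End Cube.

(** * The counting lemma *)

Section HomKernel.
Variable R : realType.
Local Notation cube := (@cube_prob R).
Local Notation U := (unif R).
Local Notation UU := (unif2 R).
Implicit Types K L : mR R * mR R -> R.

Definition unit_kernel K : Prop :=
  measurable_fun setT K /\ forall z, 0 <= K z <= 1.

Lemma kernel_bmeas K : unit_kernel K -> bmeas K.
Proof.
move=> [mK K01]; split=> //; exists 1 => z.
by have /andP[K0 K1] := K01 z; rewrite ger0_norm.
Qed.

Definition edge_val v (x : v.-tuple (mR R)) (e : 'I_v * 'I_v) : mR R * mR R :=
  (tnth x e.1, tnth x e.2).

Definition hom_kernel v (H : sgraph v) K : R :=
  \int[cube v]_x \prod_(e in edges H | (e.1 < e.2)%N) K (edge_val x e).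

Lemma prod01 (I : Type) (s : seq I) (p : pred I) (F : I -> R) :
  (forall i, 0 <= F i <= 1) -> 0 <= \prod_(i <- s | p i) F i <= 1.
Proof.
move=> F01; elim/big_rec: _ => [|i x _ /andP[x0 x1]]; first by rewrite ler01 lexx.
have /andP[F0 F1] := F01 i.
by rewrite mulr_ge0//= mulr_ile1.
Qed.

(** Fix all coordinates other than the two ends of [e0].  Every
other edge contains at most one of these ends, so the remaining product is a
weight at one end times a weight at the other, as in the definition of the cut
norm. *)
Lemma edge_cut_le v (e0 : 'I_v * 'I_v) (p : pred ('I_v * 'I_v))
    (K : 'I_v * 'I_v -> mR R * mR R -> R) (D : mR R * mR R -> R) (c : R) :
  (e0.1 < e0.2)%N -> (forall e, p e -> (e.1 < e.2)%N) ->
  (forall e, unit_kernel (K e)) -> bmeas D ->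
  (forall u w : mR R -> R, bmeas u -> bmeas w ->
    (forall x, 0 <= u x <= 1) -> (forall x, 0 <= w x <= 1) ->
    `|\int[UU]_z (D z * (u z.1 * w z.2))| <= c) ->
  `|\int[cube v]_x (D (edge_val x e0) *
      \prod_(e | p e && (e != e0)) K e (edge_val x e))| <= c.
Proof.
move=> lt0 ltp kK bD cD.
case: e0 lt0 => i j /= ij.
pose F (x : v.-tuple (mR R)) := D (edge_val x (i, j)) *
  \prod_(e | p e && (e != (i, j))) K e (edge_val x e).
have bK e : bmeas (K e) by exact: kernel_bmeas.
have bF : bmeas F.
  by apply: bmeasM; [|apply: bmeas_prod => e _]; exact: bmeas_tnth2.
rewrite -/F (bint_resample2 i j bF).
apply: bint_norm_le; [exact: bmeas_resample2|move=> x].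
(* The edges through j give the weight at j, all others the weight at i. *)
pose touch (e : 'I_v * 'I_v) := (e.1 == j) || (e.2 == j).
pose u y := \prod_(e | p e && (e != (i, j)) && ~~ touch e) K e (edge_val (upd x i y) e).
pose w z := \prod_(e | p e && (e != (i, j)) && touch e) K e (edge_val (upd x j z) e).
have bu : bmeas u.
  apply: bmeas_prod => e _.
  exact: (bmeas_section1 x (bmeas_upd i (bmeas_tnth2 e.1 e.2 (bK e)))).
have bw : bmeas w.
  apply: bmeas_prod => e _.
  exact: (bmeas_section1 x (bmeas_upd j (bmeas_tnth2 e.1 e.2 (bK e)))).
have u01 y : 0 <= u y <= 1 by apply: prod01 => e; exact: (proj2 (kK e)).
have w01 z : 0 <= w z <= 1 by apply: prod01 => e; exact: (proj2 (kK e)).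
have E y z : F (upd (upd x i y) j z) = D (y, z) * (u y * w z).
  have nij : i != j by apply: contraTN ij => /eqP ->; rewrite ltnn.
  rewrite /F (bigID touch) /= mulrC [_ * D _]mulrC; congr (_ * _).
    by rewrite /edge_val /= !tnth_upd eqxx (negbTE nij) eqxx.
  rewrite mulrC; congr (_ * _); apply: eq_bigr => e /andP[/andP[pe ne]].
    by rewrite negb_or => /andP[n1 n2];
      rewrite /edge_val !tnth_upd (negbTE n1) (negbTE n2).
  rewrite /touch /edge_val !tnth_upd; have := ltp e pe; move: ne.
  case: e {pe} => a b /= ne ab.
  move=> /orP[] /eqP ej; subst.
    rewrite eqxx; have [bj|bj] := eqVneq b j; first by rewrite bj ltnn in ab.
    have [bi|//] := eqVneq b i.
    by move: (ltn_trans ij ab); rewrite bi ltnn.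
  rewrite eqxx; have [aj|aj] := eqVneq a j; first by rewrite aj ltnn in ab.
  have [ai|//] := eqVneq a i.
  by rewrite ai eqxx in ne.
rewrite (_ : \int[U]_y _ = \int[UU]_z (D z * (u z.1 * w z.2))); first exact: cD.
rewrite (bint_prod U U (f := fun z => D z * (u z.1 * w z.2))).
  by apply: eq_Rintegral => y _; apply: eq_Rintegral => z _; rewrite E.
by apply: bmeasM => //; apply: bmeasM; [exact: bmeas_fst | exact: bmeas_snd].
Qed.

(** Counting lemma.  The kernel is changed on one edge at a
time, and each change costs at most the cut norm of the difference. *)
Lemma hom_kernel_counting v (H : sgraph v) K L (c : R) :
  unit_kernel K -> unit_kernel L ->
  (forall u w : mR R -> R, bmeas u -> bmeas w ->
    (forall x, 0 <= u x <= 1) -> (forall x, 0 <= w x <= 1) ->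
    `|\int[UU]_z ((K z - L z) * (u z.1 * w z.2))| <= c) ->
  `|hom_kernel H K - hom_kernel H L| <= #|edges H|%:R * c.
Proof.
move=> kK kL cKL.
have bK := kernel_bmeas kK; have bL := kernel_bmeas kL.
have c0 : 0 <= c.
  have b1 := @bmeas_cst _ (mR R) R 0.
  have h01 (x : mR R) : 0 <= (0 : R) <= 1 by rewrite lexx ler01.
  exact: le_trans (normr_ge0 _) (cKL _ _ b1 b1 h01 h01).
pose M (A : {set 'I_v * 'I_v}) e := if e \in A then K else L.
have kM A e : unit_kernel (M A e) by rewrite /M; case: ifP.
pose t A := \int[cube v]_x \prod_(e in edges H | (e.1 < e.2)%N) M A e (edge_val x e).
have bt A : bmeas (fun x : v.-tuple (mR R) =>
    \prod_(e in edges H | (e.1 < e.2)%N) M A e (edge_val x e)).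
  by apply: bmeas_prod => e _; apply: bmeas_tnth2; exact: kernel_bmeas.
have step (A : {set _}) e0 : e0 \notin A -> `|t (e0 |: A) - t A| <= c.
  move=> e0A; rewrite /t -bintB//.
  have M1 e : e != e0 -> M (e0 |: A) e = M A e by move=> ne;
    rewrite /M in_setU1 (negbTE ne).
  have [/andP[e0H lt0]|ne0] := boolP ((e0 \in edges H) && (e0.1 < e0.2)%N); last first.
    have E0 (r : R) : r = \int[cube v]_x 0 -> `|r| <= c.
      by move=> ->; rewrite bint_cst normr0.
    apply: E0.
    apply: eq_Rintegral => x _; apply/eqP; rewrite subr_eq0; apply/eqP.
    apply: eq_bigr => e he; rewrite M1//; apply: contraNneq ne0 => <-; exact: he.
  have := @edge_cut_le v e0 (fun e => (e \in edges H) && (e.1 < e.2)%N) (M A)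
    (fun z => K z - L z) c lt0 _ (kM A) (bmeasB bK bL) cKL.
  move=> /(_ (fun e h => proj2 (andP h))).
  congr (`| _ | <= _); apply: eq_Rintegral => x _.
  rewrite [X in _ = X - _](bigD1 e0) ?e0H//= [X in _ = _ - X](bigD1 e0) ?e0H//=.
  rewrite [X in _ = X * _ - _](_ : _ = K (edge_val x e0)); last by rewrite /M setU11.
  rewrite [X in _ = _ - X * _](_ : _ = L (edge_val x e0));
    last by rewrite /M (negbTE e0A).
  rewrite mulrBl; congr (_ * _ - _).
  by apply: eq_bigr => e /andP[_ ne]; rewrite M1.
have main (A : {set _}) : `|t A - t finset.set0| <= #|A|%:R * c.
  have [n] := ubnP #|A|; elim: n A => // n IH A.
  have [->|/set0Pn[e0 e0A]] := eqVneq A finset.set0.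
    by move=> _; rewrite subrr normr0 mulr_ge0.
  rewrite (cardsD1 e0) e0A add1n ltnS => ltn.
  have -> : t A - t finset.set0 =
      (t (e0 |: A :\ e0)%SET - t (A :\ e0)%SET) + (t (A :\ e0)%SET - t finset.set0).
    by rewrite finset.setD1K// addrA subrK.
  apply: le_trans (ler_normD _ _) _; rewrite -natr1 mulrDl mul1r addrC.
  by apply: lerD; [exact: IH | apply: step; rewrite setD11].
have := main (edges H).
congr (`| _ - _ | <= _); apply: eq_Rintegral => x _; apply: eq_bigr => e /andP[eH _].
  by rewrite /M eH.
by rewrite /M finset.in_set0.
Qed.

End HomKernel.

(** * Homomorphism densities of graphons *)

Section NullSets.
Import HBNNSimple.
Local Open Scope ereal_scope.

(** The integral of a function that need not be measurable
is a supremum over the simple functions below it, and setting these to zero on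
a null set does not change their integral.  This is needed because the
integrand of [hom_density] is arbitrary outside the unit cube. *)
Lemma eq_integral_off_null d (T : measurableType d) (R : realType)
    (mu : {measure set T -> \bar R}) (N : set T) (f g : T -> \bar R) :
  measurable N -> mu N = 0 -> (forall x, ~ N x -> f x = g x) ->
  \int[mu]_x f x = \int[mu]_x g x.
Proof.
move=> mN N0.
have half (f1 g1 : T -> \bar R) : (forall x, 0 <= f1 x) -> (forall x, 0 <= g1 x) ->
    (forall x, ~ N x -> f1 x = g1 x) -> \int[mu]_x f1 x <= \int[mu]_x g1 x.
  move=> f0 g0 fg; rewrite ge0_integralTE// ge0_integralTE//.
  apply: ge_ereal_sup => _ [h hf <-].
  pose h' := proj_nnsfun h (measurableC mN).
  have -> : sintegral mu h = sintegral mu h'.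
    rewrite -!integralT_nnsfun; apply: ae_eq_integral => //.
    - exact/measurable_EFinP.
    - exact/measurable_EFinP.
    exists N; split=> // x /= nE; apply: contrapT => nN; apply: nE => _.
    rewrite /h' /= mindicE; rewrite (_ : x \in _ = true) ?mulr1//.
    by apply/mem_set.
  apply: ereal_sup_ubound; exists h' => // x.
  rewrite /h' /= mindicE; case: (boolP (x \in _)) => [/set_mem nN|_].
    by rewrite mulr1 -fg.
  by rewrite mulr0.
move=> fg; rewrite integralE [RHS]integralE.
have fgp x : ~ N x -> f^\+ x = g^\+ x by move=> nN; rewrite !funeposE fg.
have fgn x : ~ N x -> f^\- x = g^\- x by move=> nN; rewrite !funenegE fg.
by congr (_ - _); apply/eqP; rewrite eq_le; apply/andP; split; apply: half => // x nN;
  rewrite ?fgp ?fgn.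
Qed.

End NullSets.

Section HomDensity.
Variable R : realType.
Local Notation cube := (@cube_prob R).
Local Notation U := (unif R).
Local Notation UU := (unif2 R).
Local Notation I := (@unitI R).
Implicit Types f g : graphon R.

(** Graphons are constrained on the unit square only; extension by zero
makes their measurability and their bounds global. *)
Definition ext (f : R -> R -> R) : mR R * mR R -> R :=
  fun z => if z \in unitSq then f z.1 z.2 else 0.

Lemma ext_in (f : R -> R -> R) (z : mR R * mR R) : unitSq z -> ext f z = f z.1 z.2.
Proof. by move=> Iz; rewrite /ext mem_set. Qed.

Lemma kernel_ext f : unit_kernel (ext f).
Proof.
split.
  apply/(measurable_restrictT _ (@measurable_unitSq R)); exact: gfun_measurable.
move=> [x y]; rewrite /ext; case: (boolP (_ \in _)) => [/set_mem[/= Ix Iy]|_].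
  exact: gfun_ge0_le1.
by rewrite lexx ler01.
Qed.

Lemma bmeas_ext f : bmeas (ext f).
Proof. exact: kernel_bmeas (kernel_ext f). Qed.

Lemma ext_sym f x y : ext f (x, y) = ext f (y, x).
Proof.
rewrite /ext; case: (boolP ((x, y) \in _)) => [/set_mem[/= Ix Iy]|/negP nxy].
  by rewrite mem_set//; exact: gfun_sym.
rewrite ifN//; apply/negP => /set_mem[/= Ix Iy]; apply: nxy.
exact/mem_set.
Qed.

Definition in_cube n : set (n.-tuple (mR R)) := [set x | forall i, I (tnth x i)].

Lemma in_cube_indic n (x : n.-tuple (mR R)) :
  \1_(@in_cube n) x = \prod_i \1_I (tnth x i) :> R.
Proof.
rewrite indicE; case: (boolP (_ \in _)) => [/set_mem h|/negP h].
  by rewrite big1// => i _; rewrite indicE mem_set.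
have [i ni] : exists i, ~ I (tnth x i).
  by apply/existsNP => hx; apply: h; exact/mem_set.
by rewrite (bigD1 i)//= indicE memNset// mul0r.
Qed.

Lemma measurable_in_cube n : measurable (@in_cube n).
Proof.
have -> : @in_cube n = \bigcap_(i in [set: 'I_n]) ((@tnth n (mR R))^~ i @^-1` I).
  by apply/seteqP; split=> x /= h i *; exact: h.
apply: fin_bigcap_measurable; first exact: finite_finset.
move=> i _; rewrite -[X in measurable X]setTI.
by apply: measurable_tnth => //; exact: measurable_unitI.
Qed.

Lemma in_cube_null n : cube n (~` @in_cube n) = 0%E.
Proof.
have mC := @measurable_in_cube n.
have E : (\int[cube n]_x \1_(@in_cube n) x)%R = 1.
  under eq_Rintegral do rewrite in_cube_indic.
  rewrite (bint_cube_prod (F := fun=> \1_I)); last first.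
    by move=> _; apply: bmeas_indic; exact: measurable_unitI.
  rewrite big1// => i _; rewrite -[RHS](bint_cst U).
  apply: eq_bint_unif; [|exact: bmeas_cst|].
    by apply: bmeas_indic; exact: measurable_unitI.
  by move=> x Ix; rewrite indicE mem_set.
rewrite probability_setC//.
have := EFin_bint (cube n) (bmeas_indic R mC).
rewrite E integral_indic// setIT => <-.
by rewrite subee.
Qed.

Lemma hom_density_ext v (H : sgraph v) f : hom_density H f = hom_kernel H (ext f).
Proof.
rewrite /hom_density /hom_kernel /Rintegral; congr fine.
apply: (eq_integral_off_null _ (@in_cube_null v)).
  by apply: measurableC; exact: measurable_in_cube.
move=> x /contrapT xI; congr EFin; apply: eq_bigr => e _.
by rewrite ext_in//; split; exact: xI.
Qed.

(** Integration against the uniform law asks for a map that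
is measurable on the whole line; the identity is used outside [0, 1]. *)
Lemma mp_bijection_unif (phi : mR R -> mR R) : mp_bijection phi ->
  exists phi' : mR R -> mR R, [/\ measurable_fun setT phi',
    forall u, bmeas u -> \int[U]_y u (phi' y) = \int[U]_y u y,
    forall x, I x -> phi' x = phi x & forall x, ~ I x -> ~ I (phi' x)].
Proof.
move=> hphi; have [[fI _ _] mphi _ pphi] := hphi.
pose phi' (x : mR R) : mR R := if x \in I then phi x else x.
have phi'I x : I x -> phi' x = phi x by move=> Ix; rewrite /phi' mem_set.
have phi'N x : ~ I x -> phi' x = x by move=> Ix; rewrite /phi' memNset.
have mphi' : measurable_fun setT phi'.
  rewrite -(setUv I); apply/measurable_funU => //; first exact: measurable_unitI.
    by apply: measurableC; exact: measurable_unitI.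
  split.
    by apply: eq_measurable_fun mphi => x xI; rewrite /phi' xI.
  have mid : measurable_fun (~` I) (@idfun (mR R)) by exact: measurable_id.
  by apply: eq_measurable_fun mid => x; rewrite in_setC /phi' => /negbTE ->.
exists phi'; split=> //; last by move=> x nI; rewrite phi'N.
have UE A : measurable A -> U A = lebesgue_measure (A `&` I).
  move=> mA; transitivity (\int[U]_x (\1_A x)%:E)%E;
    first by rewrite integral_indic// setIT.
  rewrite ge0_integral_unif//.
  - by rewrite integral_indic//; exact: measurable_unitI.
  - exact/measurable_EFinP/measurable_indic.
move=> u bu; rewrite /Rintegral; congr fine.
have bu' := bmeas_comp bu mphi'.
have mu : measurable_fun setT (EFin \o u) by apply/measurable_EFinP; case: bu.
have /esym E := integral_pushforward mphi' mu (bmeas_integrable U bu') measurableT.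
apply: (etrans E).
apply: eq_measure_integral => A mA _ /=.
rewrite /pushforward !UE//; last first.
  by rewrite -[X in measurable X]setTI; exact: mphi'.
have mAI : measurable (A `&` I) by apply: measurableI => //; exact: measurable_unitI.
rewrite -(pphi _ mAI (@subIsetr _ _ _)); congr lebesgue_measure.
apply/seteqP; split => x /=.
  by move=> [Ax Ix]; split=> //; split; [rewrite -phi'I | exact: fI].
by move=> [Ix [Ax _]]; split=> //; rewrite phi'I.
Qed.

Lemma hom_density_relabel v (H : sgraph v) (phi : mR R -> mR R) f g :
  mp_bijection phi -> gfun f = relabel phi g -> hom_density H f = hom_density H g.
Proof.
move=> hphi fE; have [phi' [mphi' Uphi' inI outI]] := mp_bijection_unif hphi.
have fI : forall x, I x -> I (phi x) by apply: mp_bij_in.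
rewrite !hom_density_ext /hom_kernel.
rewrite -[RHS](bint_cube_map mphi' Uphi'); last first.
  by apply: bmeas_prod => e _; apply: bmeas_tnth2; exact: bmeas_ext.
apply: eq_Rintegral => x _; apply: eq_bigr => e _.
rewrite /edge_val !tnth_map /ext.
set a := tnth x e.1; set b := tnth x e.2.
case: (boolP ((a, b) \in _)) => [/set_mem[/= Ia Ib]|/negP nab].
  have Iab : unitSq (phi' a, phi' b) by split; rewrite /= inI//; exact: fI.
  by rewrite (mem_set Iab) /= fE /relabel !inI.
rewrite ifN//; apply/negP => /set_mem[/= Ia Ib]; apply: nab; apply/mem_set; split => /=.
  by apply: contrapT => /outI.
by apply: contrapT => /outI.
Qed.

Lemma bint_rect f g (S T : set (mR R)) :
  measurable S -> measurable T -> S `<=` I -> T `<=` I ->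
  \int[leb2 R]_(z in S `*` T) (f z.1 z.2 - g z.1 z.2) =
  \int[UU]_z ((ext f z - ext g z) * (\1_S z.1 * \1_T z.2)).
Proof.
move=> mS mT SI TI; rewrite -Rintegral_rect//; last first.
  by apply: bmeasB; exact: bmeas_ext.
apply: eq_Rintegral => z /set_mem[/SI Iz1 /TI Iz2].
by rewrite !ext_in.
Qed.

Lemma cut_dist_bint f g (u w : mR R -> R) : bmeas u -> bmeas w ->
  (forall x, 0 <= u x <= 1) -> (forall x, 0 <= w x <= 1) ->
  `|\int[UU]_z ((ext f z - ext g z) * (u z.1 * w z.2))| <= cut_dist f g.
Proof.
move=> bu bw u01 w01.
have bD : bmeas (fun z => ext f z - ext g z) by apply: bmeasB; exact: bmeas_ext.
have bX (S T : set (mR R)) : measurable S -> measurable T ->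
    bmeas (fun z : mR R * mR R => (ext f z - ext g z) * (\1_S z.1 * \1_T z.2)).
  move=> mS mT; apply: bmeasM => //.
  by apply: bmeasM; [apply: bmeas_fst|apply: bmeas_snd]; exact: bmeas_indic.
rewrite ler_norml; apply/andP; split.
  rewrite lerNl -bintN; last first.
    by apply: bmeasM => //; apply: bmeasM; [exact: bmeas_fst|exact: bmeas_snd].
  under eq_Rintegral do rewrite -mulNr.
  apply: (cut_norm_le (D := fun z => - (ext f z - ext g z)) (bmeasN bD)) => //.
  move=> S T mS mT SI TI.
  under eq_Rintegral do rewrite mulNr.
  rewrite bintN; last exact: bX.
  rewrite -bint_rect// (le_trans _ (cut_dist_ub f g mS mT SI TI))//.
  by rewrite (le_trans (ler_norm _))// normrN.
apply: (cut_norm_le bD) => //.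
move=> S T mS mT SI TI; rewrite -bint_rect//.
by rewrite (le_trans _ (cut_dist_ub f g mS mT SI TI))// ler_norm.
Qed.

Lemma cut_dist_le_L1 f g : cut_dist f g <= \int[UU]_z `|ext f z - ext g z|.
Proof.
apply: cut_dist_le => S T mS mT SI TI; rewrite bint_rect//.
have bD : bmeas (fun z => ext f z - ext g z) by apply: bmeasB; exact: bmeas_ext.
have bX : bmeas (fun z : mR R * mR R => (ext f z - ext g z) * (\1_S z.1 * \1_T z.2)).
  apply: bmeasM => //.
  by apply: bmeasM; [apply: bmeas_fst|apply: bmeas_snd]; exact: bmeas_indic.
apply: le_trans (bint_norm _ bX) _.
apply: bint_le; [exact: bmeas_norm|exact: bmeas_norm|] => z.
rewrite normrM ler_piMr// !indicE.
by do 2 case: (_ \in _); rewrite ?mulr1 ?mulr0 ?normr0 ?normr1.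
Qed.

Lemma hom_density_cut_dist v (H : sgraph v) f g :
  `|hom_density H f - hom_density H g| <= #|edges H|%:R * cut_dist f g.
Proof.
rewrite !hom_density_ext; apply: hom_kernel_counting; [exact: kernel_ext..|].
by move=> u w *; exact: cut_dist_bint.
Qed.

(** The density is invariant under relabelling, so the
counting lemma holds for each relabelling and hence for the infimum. *)
Lemma hom_density_cut_delta v (H : sgraph v) f g :
  `|hom_density H f - hom_density H g| <= #|edges H|%:R * cut_delta f g.
Proof.
have [E0|E0] := posnP #|edges H|.
  by have := hom_density_cut_dist H f g; rewrite E0 !mul0r.
have E0' : 0 < #|edges H|%:R :> R by rewrite ltr0n.
rewrite mulrC -ler_pdivrMr//; apply: lb_le_inf.
  by case: (cut_delta_has_inf f g).
move=> _ [phi hphi <-]; have [g' g'E] := relabel_graphon g hphi.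
rewrite ler_pdivrMr// mulrC -g'E -(hom_density_relabel H hphi g'E).
exact: hom_density_cut_dist.
Qed.

Lemma class_density_cls v (H : sgraph v) f : class_density H (cls f) = hom_density H f.
Proof.
apply/eqP; rewrite -subr_eq0 -normr_le0.
by have := hom_density_cut_delta H (repr (cls f)) f; rewrite cut_delta_repr mulr0.
Qed.

End HomDensity.

(** * Blocks *)

Section Blocks.
Variables (R : realType) (k : nat).
Hypothesis k_gt0 : (0 < k)%N.
Local Notation I := (@unitI R).
Local Notation U := (unif R).
Implicit Types (i j : 'I_k) (x y : mR R).

Let k0 : 0 < k%:R :> R. Proof. by rewrite ltr0n. Qed.

Lemma measurable_block i : measurable (block R i).
Proof. by rewrite /block; case: ifP => _; exact: measurable_itv. Qed.

Lemma block_gt i x : block R i x -> (0 < i)%N -> i%:R / k%:R < x.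
Proof. by rewrite /block lt0n => + /negbTE i0; rewrite i0 /= in_itv => /andP[]. Qed.

Lemma block_ge i x : block R i x -> i%:R / k%:R <= x.
Proof.
rewrite /block; case: eqP => [->|_] /=; rewrite in_itv /= => /andP[].
  by rewrite mul0r.
by move=> /ltW.
Qed.

Lemma block_le i x : block R i x -> x <= i.+1%:R / k%:R.
Proof.
rewrite /block; case: eqP => [->|_] /=; rewrite in_itv /= => /andP[_] //.
by rewrite mul1r.
Qed.

Lemma blockI i x : (0 < i)%N -> i%:R / k%:R < x <= i.+1%:R / k%:R -> block R i x.
Proof. by rewrite /block lt0n => /negbTE -> /=; rewrite in_itv. Qed.

Lemma block_unitI i : block R i `<=` I.
Proof.
move=> x bx; rewrite /unitI /= in_itv /=; apply/andP; split.
  by apply: le_trans (block_ge bx); rewrite divr_ge0.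
by apply: le_trans (block_le bx) _; rewrite ler_pdivrMr// mul1r ler_nat.
Qed.

Lemma block_inj i j x : block R i x -> block R j x -> i = j.
Proof.
have lt i' j' : (i' < j')%N -> block R i' x -> ~ block R j' x.
  move=> ij bi bj; have := lt_le_trans (block_gt bj (leq_ltn_trans (leq0n _) ij))
    (block_le bi).
  by rewrite ltr_pM2r ?invr_gt0// ltr_nat ltnNge ij.
move=> bi bj; apply/val_inj; case: (ltngtP i j) => // ij.
  by case: (lt _ _ ij bi).
by case: (lt _ _ ij bj).
Qed.

Lemma block_cover x : I x -> exists i, block R i x.
Proof.
rewrite /unitI /= in_itv /= => /andP[x0 x1].
have ex : exists n, x <= n.+1%:R / k%:R.
  by exists k.-1; rewrite prednK// divff// gt_eqF.
have [n xn nmin] := ex_minnP ex.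
have nk : (n < k)%N.
  by rewrite -ltnS -[k in X in (_ < X)%N]prednK// ltnS; apply: nmin;
    rewrite prednK// divff// gt_eqF.
exists (Ordinal nk); rewrite /block /=; case: eqP => [n0|/eqP n0] /=; rewrite in_itv /=.
  by rewrite x0 -[leRHS]mul1r; move: xn; rewrite n0.
rewrite xn andbT ltNge; apply/negP => xn'.
have := nmin n.-1; rewrite prednK ?lt0n// => /(_ xn').
by rewrite leqNgt ltn_predL lt0n n0.
Qed.

Lemma bmeas_block i : bmeas (\1_(block R i) : mR R -> R).
Proof. exact: bmeas_indic (measurable_block i). Qed.

Lemma bint_block i : \int[U]_x \1_(block R i) x = k%:R^-1.
Proof.
have mb := measurable_block i.
rewrite /Rintegral ge0_integral_unif; last 2 first.
- by apply/measurable_EFinP; case: (bmeas_block i).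
- by move=> x; rewrite lee_fin.
rewrite integral_indic//; last exact: measurable_unitI.
rewrite setIidl; last exact: block_unitI.
suff E : lebesgue_measure (block R i) = (k%:R^-1)%:E by apply: (etrans (congr1 fine E)).
rewrite /block; case: eqP => [_|i0] /=; rewrite lebesgue_measure_itv /= lte_fin.
  by rewrite invr_gt0 k0 oppr0 adde0.
by rewrite ltr_pM2r ?invr_gt0// ltr_nat leqnn /= -EFinD -mulrBl -natrB// subSnn mul1r.
Qed.

Lemma step_fun_block (a : 'M[R]_k) i j x y :
  block R i x -> block R j y -> step_fun a x y = a i j.
Proof.
move=> bi bj; rewrite /step_fun (bigD1 i)//= (bigD1 j)//= !indicE !mem_set// mulr1.
rewrite !big1 ?addr0 ?mulr1//.
- move=> i' ii'; rewrite big1// => j' _; rewrite indicE memNset ?mul0r ?mulr0//.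
  by move=> bi'; move/eqP: ii'; apply; exact: block_inj bi' bi.
- move=> j' jj'; rewrite [X in _ * (_ * X)]indicE memNset ?mulr0//.
  by move=> bj'; move/eqP: jj'; apply; exact: block_inj bj' bj.
Qed.

Lemma ext_block (a : 'M[R]_k) i j x y :
  block R i x -> block R j y -> ext (step_fun a) (x, y) = a i j.
Proof.
move=> bi bj; rewrite ext_in; first exact: step_fun_block.
by split=> /=; [exact: block_unitI bi | exact: block_unitI bj].
Qed.

Lemma in_cube_block v (x : v.-tuple (mR R)) : in_cube x ->
  exists phi : 'I_v -> 'I_k, forall l, block R (phi l) (tnth x l).
Proof.
move=> xI; have [phi Hphi] := choice (fun l => block_cover (xI l)).
by exists phi.
Qed.

Definition box v (phi : 'I_v -> 'I_k) (x : v.-tuple (mR R)) : R :=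
  \prod_l \1_(block R (phi l)) (tnth x l).

Lemma bmeas_box v (phi : 'I_v -> 'I_k) : bmeas (box phi).
Proof. by apply: bmeas_prod => l _; apply: bmeas_tnth; exact: bmeas_block. Qed.

Lemma indic01 (T : Type) (A : set T) (x : T) : 0 <= (\1_A x : R) <= 1.
Proof. by rewrite indicE; case: (_ \in _); rewrite lexx ler01. Qed.

Lemma boxE v (phi : 'I_v -> 'I_k) (x : v.-tuple (mR R)) :
  (forall l, block R (phi l) (tnth x l)) /\ box phi x = 1 \/ box phi x = 0.
Proof.
have [h|/existsNP[l nl]] := pselect (forall l, block R (phi l) (tnth x l)).
  by left; split=> //; rewrite /box big1// => l _; rewrite indicE mem_set.
by right; rewrite /box (bigD1 l)//= indicE memNset// mul0r.
Qed.

Lemma bint_box_gt0 v (phi : 'I_v -> 'I_k) : 0 < \int[cube_prob R v]_x box phi x.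
Proof.
rewrite (bint_cube_prod (F := fun l => \1_(block R (phi l)))); last first.
  by move=> l; exact: bmeas_block.
by apply: prodr_gt0 => l _; rewrite bint_block invr_gt0.
Qed.

Lemma bmeas_hom v (H : sgraph v) (K : mR R * mR R -> R) : bmeas K ->
  bmeas (fun x : v.-tuple (mR R) =>
    \prod_(e in edges H | (e.1 < e.2)%N) K (edge_val x e)).
Proof. by move=> bK; apply: bmeas_prod => e _; exact: bmeas_tnth2. Qed.

Lemma le_hom_kernel v (H : sgraph v) (K L : mR R * mR R -> R) :
  unit_kernel K -> unit_kernel L -> (forall z, K z <= L z) ->
  hom_kernel H K <= hom_kernel H L.
Proof.
move=> kK kL KL; apply: bint_le; [exact/bmeas_hom/kernel_bmeas..|] => x.
by apply: ler_prod => e _; rewrite KL andbT; have /andP[] := proj2 kK (edge_val x e).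
Qed.

Lemma edges_sym v (H : sgraph v) (i j : 'I_v) : ((i, j) \in edges H) = ((j, i) \in
  edges H).
Proof.
have /andP[_ /'forall_forallP sH] := edgesP H.
by apply/idP/idP; apply/implyP.
Qed.

Lemma edges_irr v (H : sgraph v) (i : 'I_v) : (i, i) \in edges H = false.
Proof. by have /andP[/forallP h _] := edgesP H; apply/negbTE. Qed.

Lemma edge_lt v (H : sgraph v) (i j : 'I_v) : (i, j) \in edges H ->
  ((i, j) \in edges H) && (i < j)%N \/ ((j, i) \in edges H) && (j < i)%N.
Proof.
move=> eH; rewrite (edges_sym H j i) eH /=;
  case: (ltngtP i j) => [_|_|/val_inj ij]; [by left|by right|].
by rewrite ij edges_irr in eH.
Qed.

Lemma prod_edge_le v (H : sgraph v) (K : mR R * mR R -> R) (i j : 'I_v)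
    (x : v.-tuple (mR R)) :
  unit_kernel K -> (forall a b, K (a, b) = K (b, a)) -> (i, j) \in edges H ->
  \prod_(e in edges H | (e.1 < e.2)%N) K (edge_val x e) <= K (tnth x i, tnth x j).
Proof.
move=> [_ K01] sK; wlog : i j / (((i, j) \in edges H) && (i < j)%N).
  move=> wl eH; have [h|h] := edge_lt eH; first exact: wl.
  by rewrite sK; apply: wl => //; case/andP: h.
move=> h _; rewrite (bigD1 (i, j))//=.
have /andP[p0 p1] : 0 <= \prod_(e | (e \in edges H) && (e.1 < e.2)%N && (e != (i, j)))
    K (edge_val x e) <= 1 by apply: prod01 => e; exact: K01.
by rewrite ler_piMr//; have /andP[] := K01 (edge_val x (i, j)).
Qed.

(** On the box of [phi] the product for [L] is 1 and the product
for [K] is at most the factor of the edge [(i, j)]; outside the box the product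
for [K] is the smaller one.  Drawing the coordinates [i] and [j] afresh then
separates the integral of [1 - K] over the two blocks from the other
coordinates. *)
Lemma hom_kernel_gap v (H : sgraph v) (K L : mR R * mR R -> R)
    (phi : 'I_v -> 'I_k) (i j : 'I_v) :
  unit_kernel K -> unit_kernel L -> (forall z, K z <= L z) ->
  (forall a b, K (a, b) = K (b, a)) ->
  (forall e x y, e \in edges H -> block R (phi e.1) x -> block R (phi e.2) y ->
    L (x, y) = 1) ->
  (i, j) \in edges H ->
  (\int[cube_prob R v]_x box phi x) *
  \int[unif2 R]_z (\1_(block R (phi i)) z.1 * \1_(block R (phi j)) z.2 * (1 - K z))
  <= hom_kernel H L - hom_kernel H K.
Proof.
move=> kK kL KL sK L1 eH.
have bK := kernel_bmeas kK; have bL := kernel_bmeas kL.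
have nij : i != j by apply: contraTneq eH => ->; rewrite edges_irr.
have bF : bmeas (fun x : v.-tuple (mR R) => box phi x * (1 - K (tnth x i, tnth x j))).
  apply: bmeasM; first exact: bmeas_box.
  by apply: bmeasB; [exact: bmeas_cst | exact: bmeas_tnth2].
apply: (@le_trans _ _ (\int[cube_prob R v]_x (box phi x * (1 - K (tnth x i, tnth x
  j))))); last first.
  rewrite -bintB; [|exact: bmeas_hom..].
  apply: bint_le => //; first by apply: bmeasB; exact: bmeas_hom.
  move=> x; have [[bx ->]|->] := boxE phi x.
    rewrite mul1r lerB//; last exact: prod_edge_le.
    by rewrite big1// => e /andP[e' _]; rewrite /edge_val; apply: (L1 e).
  rewrite mul0r subr_ge0; apply: ler_prod => e _.
  by rewrite KL andbT; have /andP[] := proj2 kK (edge_val x e).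
rewrite (bint_resample2 i j bF).
pose B z := \1_(block R (phi i)) z.1 * \1_(block R (phi j)) z.2 * (1 - K z).
have bB : bmeas B.
  apply: bmeasM; last by apply: bmeasB => //; exact: bmeas_cst.
  by apply: bmeasM; [apply: bmeas_fst|apply: bmeas_snd]; exact: bmeas_block.
pose rest (x : v.-tuple (mR R)) :=
  \prod_(l | (l != i) && (l != j)) \1_(block R (phi l)) (tnth x l) : R.
have brest : bmeas rest by apply: bmeas_prod => l _; apply: bmeas_tnth;
  exact: bmeas_block.
have E (x : v.-tuple (mR R)) : \int[U]_y (\int[U]_z (box phi (upd (upd x i y) j z) *
    (1 - K (tnth (upd (upd x i y) j z) i, tnth (upd (upd x i y) j z) j)))) =
    rest x * \int[unif2 R]_z B z.
  rewrite (bint_prod U U bB) -bintZl; last exact: (bmeas_bint2 U U bB).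
  apply: eq_Rintegral => y _; rewrite -bintZl; last exact: bmeas_section1.
  apply: eq_Rintegral => z _.
  have -> : box phi (upd (upd x i y) j z) =
      \1_(block R (phi i)) y * (\1_(block R (phi j)) z * rest x).
    rewrite /box (bigD1 i)//= (bigD1 j)//=; last by rewrite eq_sym.
    rewrite !tnth_upd !eqxx (negbTE nij); congr (_ * (_ * _)).
    by apply: eq_bigr => l /andP[li lj]; rewrite !tnth_upd (negbTE li) (negbTE lj).
  by rewrite !tnth_upd !eqxx (negbTE nij) /B /=; ring.
have -> : \int[cube_prob R v]_x (\int[U]_y (\int[U]_z (box phi (upd (upd x i y) j z) *
    (1 - K (tnth (upd (upd x i y) j z) i, tnth (upd (upd x i y) j z) j))))) =
    \int[cube_prob R v]_x (rest x * \int[unif2 R]_z B z).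
  by apply: eq_Rintegral => x _; exact: E.
rewrite bintZr// ler_wpM2r//.
  apply: Rintegral_ge0 => z _; rewrite /B !mulr_ge0//.
  by rewrite subr_ge0; have /andP[] := proj2 kK z.
apply: bint_le => //; first exact: bmeas_box.
move=> x; rewrite /box (bigD1 i)//= (bigD1 j)//=; last by rewrite eq_sym.
have /andP[r0 r1] : 0 <= rest x <= 1 by apply: prod01 => l; exact: indic01.
by rewrite -/(rest x) mulrA ler_piMl// mulr_ile1.
Qed.

End Blocks.

(** * Relevant blocks and the maximal density *)

Section Relevance.
Variables (R : realType) (k : nat).
Hypothesis k_gt0 : (0 < k)%N.
Variables (v : nat) (H : sgraph v).
Local Notation I := (@unitI R).
Local Notation UU := (unif2 R).
Implicit Types (p M : block_matrix R k) (a b : 'I_k) (phi : 'I_v -> 'I_k).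

(** Pointwise facts about extended step functions reduce to
their values on pairs of blocks. *)
Lemma block_pair_cases (P : mR R * mR R -> Prop) :
  (forall a b x y, block R a x -> block R b y -> P (x, y)) ->
  (forall z, ~ unitSq z -> P z) -> forall z, P z.
Proof.
move=> Pin Pout z; have [[/= Ix Iy]|] := pselect (unitSq z); last exact: Pout.
have [a ha] := block_cover k_gt0 Ix; have [b hb] := block_cover k_gt0 Iy.
by case: z Ix Iy ha hb => x y *; exact: (Pin a b).
Qed.

Lemma ext_out (f : R -> R -> R) (z : mR R * mR R) : ~ unitSq z -> ext f z = 0.
Proof. by move=> nz; rewrite /ext memNset. Qed.

Lemma le_ext_block M M' : (forall a b, M' a b <= M a b) ->
  forall z, ext (block_graphon M') z <= ext (block_graphon M) z.
Proof.
move=> le; apply: block_pair_cases => [a b x y xa yb|z nz]; last by rewrite !ext_out.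
by rewrite !(ext_block k_gt0 _ xa yb).
Qed.

(** Value of the integrand of the density of [M] on the box of
[phi]. *)
Definition hom_weight M phi : R :=
  \prod_(e in edges H | (e.1 < e.2)%N) M (phi e.1) (phi e.2).

Lemma prod_ext_block M phi (x : v.-tuple (mR R)) :
  (forall l, block R (phi l) (tnth x l)) ->
  \prod_(e in edges H | (e.1 < e.2)%N) ext (block_graphon M) (edge_val x e) =
  hom_weight M phi.
Proof. by move=> bx; apply: eq_bigr => e _;
  rewrite (ext_block k_gt0 _ (bx _) (bx _)). Qed.

(** Every box has positive measure, so it is enough to lower
the weight of a single map. *)
Lemma hom_density_block_lt M M' phi : (forall a b, M' a b <= M a b) ->
  hom_weight M' phi < hom_weight M phi ->
  hom_density H (block_graphon M') < hom_density H (block_graphon M).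
Proof.
move=> le lt; rewrite !hom_density_ext -subr_gt0 -bintB;
  [|exact/bmeas_hom/bmeas_ext..].
apply: (@lt_le_trans _ _ (\int[cube_prob R v]_x ((hom_weight M phi - hom_weight M'
  phi) * box phi x))).
  by rewrite bintZl ?mulr_gt0 ?subr_gt0 ?bint_box_gt0//; exact: bmeas_box.
apply: bint_le.
- by apply: bmeasM; [exact: bmeas_cst | exact: bmeas_box].
- by apply: bmeasB; exact/bmeas_hom/bmeas_ext.
move=> x; have [[bx ->]|->] := boxE phi x;
  first by rewrite mulr1 !(prod_ext_block _ bx).
rewrite mulr0 subr_ge0; apply: ler_prod => e _.
by rewrite le_ext_block// andbT;
  have /andP[] := proj2 (kernel_ext (block_graphon M')) (edge_val x e).
Qed.

Lemma eq_hom_density_block M M' : (forall phi, hom_weight M phi = hom_weight M' phi) ->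
  hom_density H (block_graphon M) = hom_density H (block_graphon M').
Proof.
move=> eM; rewrite /hom_density /Rintegral; congr fine.
apply: (eq_integral_off_null _ (@in_cube_null R v)).
  by apply: measurableC; exact: measurable_in_cube.
move=> x /contrapT xI; congr EFin.
have [phi bx] := in_cube_block k_gt0 xI.
have E N : \prod_(e in edges H | (e.1 < e.2)%N) block_graphon N (tnth x e.1) (tnth
  x e.2) =
    hom_weight N phi.
  by rewrite -(prod_ext_block _ bx); apply: eq_bigr => e _; rewrite ext_in//;
    split; exact: xI.
by rewrite !E.
Qed.

Section FixedMatrix.
Variable p : block_matrix R k.

(** A homomorphism from [H] to the graph of the positive blocks, in
which loops are allowed. *)
Definition pos_hom phi := forall e, e \in edges H -> 0 < p (phi e.1) (phi e.2).

Lemma block_mx_ge0 M a b : 0 <= M a b.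
Proof. by have /andP[] := block_mx_ge0_le1 M a b. Qed.

Lemma block_mx_le1 M a b : M a b <= 1.
Proof. by have /andP[] := block_mx_ge0_le1 M a b. Qed.

Lemma not_pos_hom_weight M phi : ~ pos_hom phi -> (forall a b, p a b = 0 -> M a b =
  0) ->
  hom_weight M phi = 0.
Proof.
move=> /existsNP[[i j] /not_implyP[eH /negP]].
rewrite -leNgt /= => p0 Mp.
have {}p0 : p (phi i) (phi j) = 0 by apply/eqP; rewrite eq_le p0 block_mx_ge0.
have [/andP[h1 h2]|/andP[h1 h2]] := edge_lt eH.
  by rewrite /hom_weight (bigD1 (i, j)) ?h1//= Mp// mul0r.
by rewrite /hom_weight (bigD1 (j, i)) ?h1//= block_mx_sym Mp// mul0r.
Qed.

Lemma set_entry_block a b q : 0 <= q <= 1 ->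
  exists M : block_matrix R k, M = set_entry p a b q :> 'M[R]_k.
Proof.
move=> q01.
have s i j : set_entry p a b q i j = set_entry p a b q j i.
  by rewrite !mxE (block_mx_sym p i j) !xpair_eqE orbC [(j == b) && _]andbC [(j ==
    a) && _]andbC.
have h i j : 0 <= set_entry p a b q i j <= 1.
  by rewrite mxE; case: ifP => // _; exact: block_mx_ge0_le1.
by exists (BlockMatrix s h).
Qed.

Lemma set_entry_le a b q i j : q <= p a b -> set_entry p a b q i j <= p i j.
Proof.
move=> qp; rewrite mxE; case: ifP => // /orP[] /eqP[-> ->] //.
by rewrite block_mx_sym.
Qed.

(** Lowering the entry lowers the factor of the edge [e] in the
weight of [phi], whose other factors are positive; no weight increases. *)
Lemma pos_hom_relevant phi e : pos_hom phi -> e \in edges H ->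
  relevant H p (phi e.1) (phi e.2).
Proof.
case: e => i j ph eH /=; split; first exact: (ph (i, j)).
move=> q /andP[q0 qp].
have q1 : 0 <= q <= 1 by rewrite q0 (le_trans (ltW qp))// block_mx_le1.
have [M ME] := set_entry_block (phi i) (phi j) q1.
rewrite -ME; apply: (@hom_density_block_lt p M phi).
  by move=> a b; rewrite ME set_entry_le// ltW.
wlog : i j eH qp ME / (i < j)%N.
  move=> wl; have [/andP[_ ij]|/andP[jH ji]] := edge_lt eH; first exact: (wl i j).
  apply: (wl j i) => //; first by rewrite block_mx_sym.
  by rewrite ME; apply/matrixP => a b; rewrite !mxE orbC.
move=> ij; rewrite /hom_weight (bigD1 (i, j)) ?eH//= [ltRHS](bigD1 (i, j)) ?eH//=.
rewrite ME mxE eqxx /=.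
apply: (@le_lt_trans _ _ (q * \prod_(e | (e \in edges H) && (e.1 < e.2)%N && (e !=
  (i, j)))
    p (phi e.1) (phi e.2))).
  apply: ler_wpM2l => //; apply: ler_prod => e _.
  by rewrite -ME block_mx_ge0 ME set_entry_le// ltW.
by rewrite ltr_pM2r//; apply: prodr_gt0 => e /andP[/andP[eH' _] _]; exact: ph.
Qed.

(** If no positive homomorphism used the block, then setting its
entry to 0 would change no weight, and the density would not drop. *)
Lemma relevant_pos_hom a b : relevant H p a b ->
  exists2 phi, pos_hom phi & exists e, [/\ e \in edges H, phi e.1 = a & phi e.2 = b].
Proof.
move=> [pab /(_ 0)]; rewrite lexx pab => /(_ isT) lt.
apply: contrapT => no.
(* The extreme case q = 0 of the hypothesis already detects every use of the block. *)
have [M ME] : exists M : block_matrix R k, M = set_entry p a b 0 :> 'M[R]_k.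
  by apply: set_entry_block; rewrite lexx ler01.
suff E : hom_density H (block_graphon M) = hom_density H (block_graphon p).
  by move: lt; rewrite -ME [X in X < _]E ltxx.
apply: eq_hom_density_block => phi.
have [ph|nph] := pselect (pos_hom phi); last first.
  rewrite !(not_pos_hom_weight nph)//.
  move=> i j pij; apply/eqP; rewrite eq_le block_mx_ge0 andbT -pij ME.
  by apply: set_entry_le; exact: ltW.
apply: eq_bigr => -[i j] /andP[eH _] /=; rewrite ME mxE; case: ifPn => //.
case/orP => /eqP[E1 E2]; exfalso; apply: no; exists phi => //.
  by exists (i, j).
by exists (j, i); rewrite edges_sym.
Qed.

Definition pos_mx : 'M[R]_k := \matrix_(a, b) (0 < p a b)%R%:R.
Definition rel_mx : 'M[R]_k := \matrix_(a, b) (`[< relevant H p a b >])%:R.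

Lemma relevant_sym a b : relevant H p a b -> relevant H p b a.
Proof.
case=> [pab lt]; split; first by rewrite block_mx_sym.
move=> q; rewrite block_mx_sym => /lt.
congr (hom_density _ (step_fun _) < _).
by apply/matrixP => x y; rewrite !mxE orbC.
Qed.

Lemma relevantC a b : `[< relevant H p a b >] = `[< relevant H p b a >].
Proof. by apply/asboolP/asboolP; exact: relevant_sym. Qed.

Fact pos_mx_sym a b : pos_mx a b = pos_mx b a.
Proof. by rewrite !mxE block_mx_sym. Qed.
Fact pos_mx_ge0_le1 a b : 0 <= pos_mx a b <= 1.
Proof. by rewrite mxE; case: (_ < _); rewrite lexx ler01. Qed.
Fact rel_mx_sym a b : rel_mx a b = rel_mx b a.
Proof. by rewrite !mxE relevantC. Qed.
Fact rel_mx_ge0_le1 a b : 0 <= rel_mx a b <= 1.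
Proof. by rewrite mxE; case: `[< _ >]; rewrite lexx ler01. Qed.

(** The pointwise upper bound of all graphons that agree with the step
function of [p] wherever the latter is 0 or 1. *)
Definition f_pos : graphon R := block_graphon (BlockMatrix pos_mx_sym pos_mx_ge0_le1).
Definition f_rel : graphon R := block_graphon (BlockMatrix rel_mx_sym rel_mx_ge0_le1).

Lemma hom_weight_pos M phi : pos_hom phi ->
  (forall a b, relevant H p a b -> M a b = 1) -> hom_weight M phi = 1.
Proof.
move=> ph M1; rewrite /hom_weight big1// => e /andP[eH _].
by apply: M1; exact: pos_hom_relevant.
Qed.

Lemma irrelevant0 a b : p a b = 0 -> ~ relevant H p a b.
Proof. by move=> p0 [+ _]; rewrite p0 ltxx. Qed.

(** A positive homomorphism uses relevant blocks only, where
both step functions are 1; any other map meets a block on which both vanish. *)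
Lemma hom_density_f_pos : hom_density H f_pos = hom_density H (f_max H p).
Proof.
apply: eq_hom_density_block => phi.
have [ph|nph] := pselect (pos_hom phi).
  rewrite !hom_weight_pos// => a b [p0 h] /=; rewrite mxE.
    by rewrite ifT//; apply/asboolP.
  by rewrite p0.
rewrite !(not_pos_hom_weight nph)// => a b p0 /=; rewrite mxE.
  by rewrite ifN//; apply/asboolPn; exact: irrelevant0.
by rewrite p0 ltxx.
Qed.

Lemma hom_density_f_rel : hom_density H f_rel = hom_density H (f_max H p).
Proof.
apply: eq_hom_density_block => phi.
have [ph|nph] := pselect (pos_hom phi).
  rewrite !hom_weight_pos// => a b h /=; rewrite mxE.
    by rewrite ifT//; apply/asboolP.
  by rewrite (_ : `[< _ >] = true)//; apply/asboolP.
rewrite !(not_pos_hom_weight nph)// => a b p0 /=; rewrite mxE.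
  by rewrite ifN//; apply/asboolPn; exact: irrelevant0.
by rewrite (_ : `[< _ >] = false)//; apply/asboolPn; exact: irrelevant0.
Qed.

(** States that [h <= f_pos] almost everywhere, as a vanishing integral
because this is the form that the counting lemma takes. *)
Definition dominated (h : graphon R) :=
  \int[UU]_z (ext h z - Num.min (ext h z) (ext f_pos z)) = 0.

Lemma unit_kernel_min (K L : mR R * mR R -> R) : unit_kernel K -> unit_kernel L ->
  unit_kernel (fun z => Num.min (K z) (L z)).
Proof.
move=> kK kL; split; first by case: (bmeas_min (kernel_bmeas kK) (kernel_bmeas kL)).
by move=> z; case: (leP (K z) (L z)) => _; [exact: (proj2 kK) | exact: (proj2 kL)].
Qed.

(** Truncation changes the graphon on a null set only,
so the cut norm of the change is 0. *)
Lemma hom_kernel_dominated h : dominated h ->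
  hom_density H h = hom_kernel H (fun z => Num.min (ext h z) (ext f_pos z)).
Proof.
move=> dh; rewrite hom_density_ext; apply/eqP; rewrite -subr_eq0 -normr_le0.
have kK := unit_kernel_min (kernel_ext h) (kernel_ext f_pos).
rewrite -[X in _ <= X](mulr0 #|edges H|%:R).
apply: hom_kernel_counting => //; first exact: kernel_ext.
move=> u w bu bw u01 w01.
have bD := bmeasB (bmeas_ext h) (kernel_bmeas kK).
have bX : bmeas (fun z : mR R * mR R => u z.1 * w z.2).
  by apply: bmeasM; [exact: bmeas_fst | exact: bmeas_snd].
apply: le_trans (bint_norm _ (bmeasM bD bX)) _.
rewrite -[X in _ <= X]dh; apply: bint_le => //; first by apply/bmeas_norm/bmeasM.
move=> z; have /andP[u0 u1] := u01 z.1; have /andP[w0 w1] := w01 z.2.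
have d0 : 0 <= ext h z - Num.min (ext h z) (ext f_pos z) by rewrite subr_ge0 ge_min
  lexx.
by rewrite ger0_norm ?mulr_ge0// ler_piMr// mulr_ile1.
Qed.

Lemma dominated_le h : dominated h -> hom_density H h <= hom_density H (f_max H p).
Proof.
move=> dh; rewrite hom_kernel_dominated// -hom_density_f_pos hom_density_ext.
apply: le_hom_kernel; [exact: unit_kernel_min (kernel_ext _) (kernel_ext _)|exact:
  kernel_ext|].
by move=> z; rewrite ge_min lexx orbT.
Qed.

(** The constant is the least measure of the boxes of finitely many
positive homomorphisms, one for each relevant block. *)
Lemma relevant_gap : exists2 c : R, 0 < c & forall h a b, dominated h -> relevant H
  p a b ->
  c * \int[UU]_z (\1_(block R a) z.1 * \1_(block R b) z.2 * (1 - ext h z)) <=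
  hom_density H (f_max H p) - hom_density H h.
Proof.
have wit ab : exists phi : 'I_v -> 'I_k, relevant H p ab.1 ab.2 ->
    pos_hom phi /\ exists e, [/\ e \in edges H, phi e.1 = ab.1 & phi e.2 = ab.2].
  have [r|nr] := pselect (relevant H p ab.1 ab.2).
    by have [phi ph e] := relevant_pos_hom r; exists phi.
  by exists (fun=> Ordinal k_gt0).
have [Phi HPhi] := choice wit.
pose c ab := \int[cube_prob R v]_x box (Phi ab) x.
have c0 ab : 0 < c ab by exact: bint_box_gt0.
have [c1 c1_gt0 c1_le] : exists2 c1 : R, 0 < c1 & forall ab, c1 <= c ab.
  exists (\big[Num.min/1]_ab c ab); last by move=> ab; exact: bigmin_le.
  by elim/big_rec: _ => [|ab x _ x0]; rewrite ?ltr01// lt_min c0.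
exists c1 => // h a b dh rab.
have [ph [e [eH ea eb]]] := HPhi (a, b) rab; rewrite /= in ea eb.
have kK := unit_kernel_min (kernel_ext h) (kernel_ext f_pos).
have bb := bmeas_block R.
have bab : bmeas (fun z : mR R * mR R => \1_(block R a) z.1 * \1_(block R b) z.2 : R).
  by apply: bmeasM; [apply: bmeas_fst|apply: bmeas_snd]; exact: bmeas_block.
rewrite -hom_density_f_pos (hom_kernel_dominated dh) hom_density_ext.
have := @hom_kernel_gap R k v H _ (ext f_pos) (Phi (a, b)) e.1 e.2 kK (kernel_ext _).
rewrite ea eb => gap; apply: le_trans (gap _ _ _ _).
- apply: ler_pM; [exact: ltW| |exact: c1_le|].
    apply: Rintegral_ge0 => z _; rewrite !mulr_ge0// subr_ge0.
    by have /andP[] := proj2 (kernel_ext h) z.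
  apply: bint_le.
  + by apply: bmeasM => //; apply: bmeasB; [exact: bmeas_cst | exact: bmeas_ext].
  + by apply: bmeasM => //; apply: bmeasB; [exact: bmeas_cst | exact: kernel_bmeas].
  move=> z; rewrite ler_wpM2l ?mulr_ge0//.
  by rewrite lerB// ge_min lexx.
- by move=> z; rewrite ge_min lexx orbT.
- by move=> x y; rewrite (ext_sym h) (ext_sym f_pos).
- move=> e' x y eH' bx by'; rewrite (ext_block k_gt0 _ bx by') mxE.
  by rewrite (ph e' eH').
- by rewrite -surjective_pairing.
Qed.

End FixedMatrix.
End Relevance.

(** * Relative entropy of Bernoulli laws *)

Section Entropy.
Variable R : realType.
Implicit Types p q u w l s : R.

Lemma ln_le_subr1 w : 0 < w -> ln w <= w - 1.
Proof. by move=> w0; rewrite -[w in ln w](subrK 1) addrC le_ln1Dx// ltrBrDr addrC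
  subrr. Qed.

(** Comes from [expR (- l) >= 1 - l] and
[(1 - l) (1 + l + 2 l^2) >= 1]. *)
Lemma expR_le_quad l : l <= 1 / 2 -> expR l <= 1 + l + 2 * l ^+ 2.
Proof.
move=> l2; have l1 : 0 < 1 - l by lra.
have h := expR_ge1Dx (- l); rewrite expRN in h.
have e0 := expR_gt0 l.
have h1 : (1 - l) * expR l <= 1.
  by rewrite -[leRHS](mulVf (lt0r_neq0 e0)) ler_wpM2r// ltW.
rewrite -(ler_pM2l l1); apply: le_trans h1 _.
by nra.
Qed.

(** Serves twice: it makes the entropy grow away from its mean,
and it bounds the exponential moments of the random graph. *)
Lemma mgf_bernoulli_le q l : 0 <= q <= 1 -> l <= 1 / 2 ->
  q * expR l + (1 - q) <= expR (q * l + 2 * l ^+ 2).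
Proof.
move=> /andP[q0 q1] l2; apply: le_trans (expR_ge1Dx _).
have h := expR_le_quad l2.
have h2 : q * expR l <= q * (1 + l + 2 * l ^+ 2) by exact: ler_wpM2l.
have h3 := sqr_ge0 l; have : q * (l ^+ 2) <= l ^+ 2 by rewrite ler_piMl.
nra.
Qed.

(** This is [ln y <= y - 1] at [y = w p / u], multiplied by [u],
when [u] is positive. *)
Lemma gibbs_term p u w : 0 < p -> 0 <= u -> 0 < w ->
  u * ln w - u * ln (u / p) <= p * w - u.
Proof.
move=> p0; rewrite le_eqVlt => /orP[/eqP<-|u0] w0.
  by rewrite !mul0r !subr0 mulr_ge0 ?ltW.
rewrite -mulrBr -ln_div ?posrE ?divr_gt0//.
have h : ln (w / (u / p)) <= w / (u / p) - 1 by apply: ln_le_subr1; rewrite !divr_gt0.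
apply: le_trans (ler_wpM2l (ltW u0) h) _.
rewrite le_eqVlt; apply/orP; left; apply/eqP; field.
by rewrite !gt_eqF.
Qed.

(** Gibbs' variational bound: the relative entropy dominates
every affine function of [u] coming from the logarithmic moment generating
function. *)
Lemma rel_entropy_var p u l : 0 < p < 1 -> 0 <= u <= 1 ->
  l * u - ln (p * expR l + (1 - p)) <=
  u * ln (u / p) + (1 - u) * ln ((1 - u) / (1 - p)).
Proof.
move=> /andP[p0 p1] /andP[u0 u1]; set Z := p * expR l + (1 - p).
have e0 := expR_gt0 l.
have Z0 : 0 < Z by rewrite /Z addr_gt0 ?mulr_gt0// subr_gt0.
have h1 : u * ln (expR l / Z) - u * ln (u / p) <= p * (expR l / Z) - u.
  by apply: gibbs_term => //; rewrite divr_gt0.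
have h2 : (1 - u) * ln (Z^-1) - (1 - u) * ln ((1 - u) / (1 - p)) <=
    (1 - p) * Z^-1 - (1 - u).
  by apply: gibbs_term; rewrite ?subr_gt0 ?subr_ge0 ?invr_gt0.
have e1 : ln (expR l / Z) = l - ln Z by rewrite ln_div ?posrE// expRK.
have e2 : ln (Z^-1) = - ln Z by rewrite lnV ?posrE.
have e3 : p * (expR l / Z) + (1 - p) * Z^-1 = 1.
  by rewrite mulrA -mulrDl -/Z divff// gt_eqF.
rewrite e1 in h1; rewrite e2 in h2.
nra.
Qed.

Lemma rel_entropy_ge0 p u : 0 <= p <= 1 -> 0 <= u <= 1 -> (0 <= rel_entropy p u)%E.
Proof.
move=> /andP[p0 p1] u01; rewrite /rel_entropy; case: ifPn => [_|].
  by case: ifP => // _; exact: leey.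
rewrite negb_or => /andP[p0' p1'].
have := rel_entropy_var (p := p) 0 _ u01.
have -> : p * expR 0 + (1 - p) = 1 by rewrite expR0; ring.
rewrite ln1 mul0r subr0 lee_fin; apply.
by rewrite !lt_neqAle p0 p1 eq_sym p0' p1'.
Qed.

(** The variational bound at [l = s] and [l = - s]; a
substitute for Pinsker's inequality that is linear in the distance to the mean. *)
Lemma rel_entropy_near_mean p u s : 0 < p < 1 -> 0 <= u <= 1 -> 0 <= s <= 1 / 2 ->
  ((s * `|u - p|)%:E <= rel_entropy p u + (2 * s ^+ 2)%:E)%E.
Proof.
move=> p01 u01 /andP[s0 s1]; have /andP[p0 p1] := p01.
rewrite /rel_entropy (gt_eqF p0) (lt_eqF p1) /= -EFinD lee_fin -lerBlDr.
have key l : l <= 1 / 2 -> l * (u - p) - 2 * l ^+ 2 <=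
    u * ln (u / p) + (1 - u) * ln ((1 - u) / (1 - p)).
  move=> l2; apply: le_trans (rel_entropy_var l p01 u01).
  have Z0 : 0 < p * expR l + (1 - p).
    by rewrite addr_gt0 ?mulr_gt0 ?expR_gt0 ?subr_gt0.
  have pp : 0 <= p <= 1 by rewrite !ltW.
  have := mgf_bernoulli_le pp l2.
  rewrite -ler_ln ?posrE ?expR_gt0// expRK => h.
  by nra.
have [up|up] := leP p u.
  by rewrite ger0_norm ?subr_ge0//; exact: key.
rewrite ltr0_norm ?subr_lt0//.
have := key (- s); rewrite sqrrN => h; have := h ltac:(lra).
by rewrite mulrN mulNr.
Qed.

(** The variational bound at a large slope [l], for which
[ln (p e^l + 1 - p)] is close to [l + ln p]. *)
Lemma rel_entropy_near_one p u l : 0 < p < 1 -> 0 <= u <= 1 -> 0 <= l ->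
  (rel_entropy p 1 <= rel_entropy p u + (l * (1 - u) + expR (- l) / p)%:E)%E.
Proof.
move=> p01 u01 l0; have /andP[p0 p1] := p01.
rewrite /rel_entropy (gt_eqF p0) (lt_eqF p1) /= -EFinD lee_fin.
rewrite subrr !mul0r addr0 mul1r div1r lnV ?posrE//.
have h := rel_entropy_var l p01 u01.
have e0 := expR_gt0 l; have eN0 := expR_gt0 (- l).
suff : ln (p * expR l + (1 - p)) <= l + ln p + expR (- l) / p.
  by move=> h2; nra.
have r0 : 0 < expR (- l) / p by rewrite divr_gt0.
have -> : p * expR l + (1 - p) = expR l * p * (1 + (1 - p) * (expR (- l) / p)).
  by rewrite expRN; field; rewrite !gt_eqF.
have q0 : 0 <= (1 - p) * (expR (- l) / p) by rewrite mulr_ge0 ?subr_ge0// ltW.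
rewrite lnM ?posrE ?mulr_gt0//; last by rewrite ltr_wpDr.
rewrite lnM ?posrE// expRK lerD2l.
apply: le_trans (le_ln1Dx _) _; first by rewrite (lt_le_trans _ q0)// ltrN10.
by apply: ler_piMl; [exact: ltW | lra].
Qed.

End Entropy.

(** * The maximal density and the pointwise entropy inequality *)

Lemma mdist_cls (R : realType) (f g : graphon R) : mdist (cls f) (cls g) =
  cut_delta f g.
Proof. exact: class_dist_cls. Qed.

(** The quotients are replaced by differences of
logarithms: [u ln (u / q) = u (ln u - ln q)] holds at [u = 0] as well. *)
Lemma measurable_rel_entropy (R : realType) (f g : graphon R) :
  measurable_fun unitSq
    (fun z : mR R * mR R => rel_entropy (f z.1 z.2) (g z.1 z.2)).
Proof.
pose F z := ext f z; pose G z := ext g z.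
have [mF F01] : unit_kernel F := kernel_ext f.
have [mG G01] : unit_kernel G := kernel_ext g.
pose E z : \bar R := if (F z == 0) || (F z == 1) then
    (if G z == F z then 0%E else +oo%E)
  else (G z * (ln (G z) - ln (F z)) +
        (1 - G z) * (ln (1 - G z) - ln (1 - F z)))%:E.
have mE : measurable_fun setT E.
  apply: measurable_fun_ifT.
  - by apply: measurable_or; apply: measurable_fun_eqr => //; exact: measurable_cst.
  - by apply: measurable_fun_ifT => //; exact: measurable_fun_eqr.
  have mln (K : mR R * mR R -> R) : measurable_fun setT K ->
      measurable_fun setT (fun z => ln (K z)).
    by move=> mK; apply: measurableT_comp => //; exact: measurable_ln.
  have m1 (K : mR R * mR R -> R) : measurable_fun setT K ->
      measurable_fun setT (fun z => 1 - K z).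
    by move=> mK; apply: measurable_funB => //; exact: measurable_cst.
  apply/measurable_EFinP; apply: measurable_funD; apply: measurable_funM => //.
  - by apply: measurable_funB; exact: mln.
  - exact: m1.
  - by apply: measurable_funB; apply: mln; exact: m1.
apply: eq_measurable_fun (measurable_funTS mE) => z /set_mem Iz.
rewrite /E /rel_entropy /F /G !ext_in//.
case: ifPn => //; rewrite negb_or => /andP[n0 n1].
have /andP[f0 f1] := F01 z; have /andP[g0 g1] := G01 z.
rewrite /F /G !ext_in// in f0 f1 g0 g1.
have lnE (u q : R) : 0 <= u -> 0 < q -> u * (ln u - ln q) = u * ln (u / q).
  rewrite le_eqVlt => /orP[/eqP<-|u0] q0; first by rewrite !mul0r.
  by rewrite ln_div ?posrE.
rewrite !lnE// ?subr_ge0// ?subr_gt0 lt_neqAle.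
- by rewrite n1.
- by rewrite eq_sym n0.
Qed.

Lemma integral_unitSq (R : realType) (f : mR R * mR R -> R) : bmeas f ->
  (\int[leb2 R]_(z in unitSq) (f z)%:E = (\int[unif2 R]_z f z)%:E)%E.
Proof.
move=> bf; rewrite (EFin_bint (unif2 R) bf) integral_unif2//.
by apply/measurable_EFinP; case: bf.
Qed.

Section MaximalDensity.
Variables (R : realType) (k : nat).
Hypothesis k_gt0 : (0 < k)%N.
Variables (v : nat) (H : sgraph v) (p : block_matrix R k).
Local Notation UU := (unif2 R).
Local Notation W0 := (block_graphon p).
Local Notation fmax := (f_max H p).
Local Notation frel := (f_rel H p).

Lemma dominated_W_Omega h : W_Omega W0 h -> dominated p h.
Proof.
move=> hW; rewrite /dominated.
pose D z := ext h z - Num.min (ext h z) (ext (f_pos p) z).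
have bD : bmeas D.
  by apply: bmeasB; [|apply: bmeas_min]; exact: bmeas_ext.
apply: EFin_inj; rewrite -integral_unitSq//.
rewrite (_ : 0%:E = \int[leb2 R]_(z in unitSq) (cst 0%E z))%E;
  last by rewrite integral0.
apply: ae_eq_integral => //.
- exact: measurable_unitSq.
- by apply/measurable_EFinP/measurable_funTS; case: bD.
case: hW => N [mN N0 hN]; exists N; split=> // z /= nz; apply: hN => /= hz;
  apply: nz => Iz.
have /andP[h0 h1] := proj2 (kernel_ext h) z.
congr EFin; apply/eqP; rewrite /D subr_eq0 eq_sym; apply/eqP/min_idPl.
case: z Iz hz h0 h1 => x y [/= Ix Iy] hz h0 h1.
have [a ha] := block_cover k_gt0 Ix; have [b hb] := block_cover k_gt0 Iy.
rewrite (ext_block k_gt0 _ ha hb) mxE.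
have [pab|pab] := ltP 0 (p a b); first exact: h1.
have W0E : step_fun p x y = p a b by exact: step_fun_block.
rewrite ext_in//= hz ?W0E//; split=> //; rewrite /Omega /= W0E => -[_ /andP[]].
by rewrite ltNge pab.
Qed.

Lemma W_Omega_f_max : W_Omega W0 fmax.
Proof.
apply: aeW => -[x y] [[/= Ix Iy] nO].
have [a ha] := block_cover k_gt0 Ix; have [b hb] := block_cover k_gt0 Iy.
rewrite /= !(step_fun_block k_gt0 _ ha hb) mxE; case: asboolP => // -[p0 _].
apply/esym/eqP; rewrite eq_le block_mx_le1 leNgt; apply/negP => p1; apply: nO.
by split=> //=; rewrite (step_fun_block k_gt0 _ ha hb) p0.
Qed.

Lemma Wtilde_f_max : Wtilde_Omega W0 (cls fmax).
Proof. by exists fmax; [exact: W_Omega_f_max | rewrite mdist_cls cut_deltaxx]. Qed.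

Lemma class_density_le F : Wtilde_Omega W0 F -> class_density H F <= hom_density H fmax.
Proof.
move=> [g /dominated_W_Omega dg].
rewrite -[F]reprK mdist_cls => d0.
rewrite [class_density _ _](class_density_cls H (repr F)).
apply: le_trans (dominated_le k_gt0 H dg).
have := hom_density_cut_delta H (repr F) g; rewrite d0 mulr0 normr_le0 subr_eq0.
by move=> /eqP ->.
Qed.

(** The function [f_max] itself competes in the supremum, because it
differs from [W0] only on blocks with entry in ]0, 1[. *)
Lemma t_maxE : t_max W0 H = hom_density H fmax.
Proof.
have ub : ubound [set class_density H F | F in Wtilde_Omega W0] (hom_density H fmax).
  by move=> _ [F WF <-]; exact: class_density_le.
have mem : [set class_density H F | F in Wtilde_Omega W0] (hom_density H fmax).
  by exists (cls fmax); [exact: Wtilde_f_max | exact: class_density_cls].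
apply/eqP; rewrite eq_le; apply/andP; split.
  by apply: ge_sup => //; exists (hom_density H fmax).
by apply: ub_le_sup => //; exists (hom_density H fmax).
Qed.

(** Sums [relevant_gap] over the relevant blocks. *)
Lemma relevant_deficit : exists2 c : R, 0 < c & forall h, dominated p h ->
  \int[UU]_z (ext frel z * (1 - ext h z)) <=
  c * (hom_density H fmax - hom_density H h).
Proof.
have [c c0 gap] := relevant_gap k_gt0 H p.
exists (k%:R * k%:R * c^-1); first by rewrite !mulr_gt0 ?invr_gt0 ?ltr0n.
move=> h dh.
pose B (a b : 'I_k) (z : mR R * mR R) := \1_(block R a) z.1 * \1_(block R b) z.2 *
  (1 - ext h z).
have bB a b : bmeas (B a b).
  apply: bmeasM; last by apply: bmeasB; [exact: bmeas_cst | exact: bmeas_ext].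
  by apply: bmeasM; [apply: bmeas_fst|apply: bmeas_snd]; exact: bmeas_block.
have E : \int[UU]_z (ext frel z * (1 - ext h z)) =
    \sum_a \sum_b rel_mx H p a b * \int[UU]_z B a b z.
  have bS a : bmeas (fun z => \sum_b rel_mx H p a b * B a b z).
    by apply: bmeas_sum => b _; apply: bmeasM => //; exact: bmeas_cst.
  rewrite (@eq_bint_unif2 _ _ (fun z => \sum_a \sum_b rel_mx H p a b * B a b z)).
  - rewrite bint_sum//; apply: eq_bigr => a _.
    rewrite bint_sum; first by apply: eq_bigr => b _; rewrite bintZl.
    by move=> b _; apply: bmeasM => //; exact: bmeas_cst.
  - apply: bmeasM; first exact: bmeas_ext.
    by apply: bmeasB; [exact: bmeas_cst | exact: bmeas_ext].
  - exact: bmeas_sum.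
  move=> z Iz; rewrite [ext frel z]ext_in// mulr_suml; apply: eq_bigr => a _.
  by rewrite mulr_suml; apply: eq_bigr => b _; rewrite /B !mulrA.
rewrite E; set t := _ - _ in gap *.
have t0 : 0 <= t by rewrite subr_ge0; exact: dominated_le.
apply: (@le_trans _ _ (\sum_(a < k) \sum_(b < k) c^-1 * (hom_density H fmax -
  hom_density H h))).
  apply: ler_sum => a _; apply: ler_sum => b _; rewrite mxE.
  case: asboolP => r /=; last by rewrite mul0r mulr_ge0// invr_ge0 ltW.
  by rewrite mul1r mulrC ler_pdivlMr// mulrC; exact: gap.
by rewrite !sumr_const !card_ord -mulrnA -[leLHS]mulr_natl natrM !mulrA.
Qed.

(** On irrelevant blocks [f_max] is the minimizer [u = p a b] of the
entropy, which grows at least linearly up to an error; on relevant blocks a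
value [u < 1] may have smaller entropy than 1, by at most a multiple of
[1 - u]. *)
Lemma entropy_gap s : 0 < s <= 1 / 2 -> exists2 l : R, 0 <= l &
  forall a b u, 0 <= u <= 1 ->
  (rel_entropy (p a b) (f_max_mx H p a b) +
     (s * (`|u - f_max_mx H p a b| * (1 - rel_mx H p a b)))%:E <=
   rel_entropy (p a b) u +
     (l * (rel_mx H p a b * (1 - u)) + 3 * s ^+ 2)%:E)%E.
Proof.
move=> /andP[s0 s2]; have ss : 0 < s ^+ 2 by exact: exprn_gt0.
(* Slopes for which the error expR (- l) / p is at most s ^+ 2. *)
pose L ab : R := - ln (s ^+ 2 * p ab.1 ab.2).
pose l := \big[Num.max/0]_ab L ab.
have l0 : 0 <= l by exact: bigmax_ge_id.
exists l => // a b u u01; have /andP[u0 u1] := u01.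
have pp := block_mx_ge0_le1 p a b.
rewrite !mxE; case: asboolP => r /=; last first.
  have -> : rel_entropy (p a b) (p a b) = 0%E.
    rewrite /rel_entropy eqxx; case: ifPn => //; rewrite negb_or => /andP[n0 n1].
    by rewrite !divff ?subr_eq0 ?[1 == _]eq_sym// ln1 !mulr0 addr0.
  rewrite add0e subr0 mulr1 mul0r mulr0 add0r.
  have [p01|np01] := boolP (0 < p a b < 1).
    apply: le_trans (rel_entropy_near_mean p01 u01 _) _; first by rewrite ltW.
    by apply: leeD2l; rewrite lee_fin ler_wpM2r ?sqr_ge0// ler_nat.
  have : (p a b == 0) || (p a b == 1).
    move: np01; rewrite negb_and -!leNgt; case/andP: pp => q0 q1.
    by case/orP => h; apply/orP; [left|right]; rewrite eq_le ?h ?q0 ?q1.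
  rewrite /rel_entropy => ->; case: eqP => [->|_].
    by rewrite subrr normr0 mulr0 add0e lee_fin mulr_ge0// ltW.
  by rewrite addye// leey.
have p0 : 0 < p a b by exact: (proj1 r).
rewrite subrr !mulr0 adde0 mul1r.
have [p1|p1] := ltP (p a b) 1.
  apply: le_trans (rel_entropy_near_one _ u01 l0) _; first by rewrite p0.
  apply: leeD2l; rewrite lee_fin lerD2l ler_pdivrMr//.
  apply: (@le_trans _ _ (s ^+ 2 * p a b)); last first.
    by rewrite ler_pM2r//; lra.
  rewrite -[leRHS]lnK ?posrE ?mulr_gt0// ler_expR lerNl.
  exact: (@le_bigmax _ _ _ _ L (a, b)).
have -> : p a b = 1 by apply/eqP; rewrite eq_le p1; case/andP: pp => _ ->.
rewrite {1}/rel_entropy eqxx orbT /=.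
apply: adde_ge0; first by apply: rel_entropy_ge0 => //; rewrite ler01 lexx.
by rewrite lee_fin addr_ge0 ?mulr_ge0 ?subr_ge0// ltW.
Qed.

End MaximalDensity.

(** * Stability of the entropy near the maximal density *)

Section Stability.
Variables (R : realType) (k : nat).
Hypothesis k_gt0 : (0 < k)%N.
Variables (v : nat) (H : sgraph v) (p : block_matrix R k).
Local Notation UU := (unif2 R).
Local Notation W0 := (block_graphon p).
Local Notation fmax := (f_max H p).
Local Notation frel := (f_rel H p).

Definition L1_dist (f g : graphon R) := \int[UU]_z `|ext f z - ext g z|.

(** Integrates [entropy_gap]; the part of the L1 distance over the
relevant blocks is itself the integral of [1 - h] there. *)
Lemma rate_I_stable s : 0 < s <= 1 / 2 -> exists2 l : R, 0 <= l & forall h : graphon R,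
  (rate_I W0 fmax + (s / 2 * L1_dist h fmax)%:E <=
   rate_I W0 h +
     (l * \int[UU]_z (ext frel z * (1 - ext h z)) + 3 / 2 * s ^+ 2)%:E)%E.
Proof.
move=> s12; have [l l0 gap] := entropy_gap H p s12; have /andP[s0 s2] := s12.
exists ((l + s) / 2); first by rewrite divr_ge0// addr_ge0// ltW.
move=> h; set D := \int[UU]_z (ext frel z * (1 - ext h z)).
pose q z := s * (`|ext h z - ext fmax z| * (1 - ext frel z)).
pose r z := l * (ext frel z * (1 - ext h z)) + 3 * s ^+ 2.
have b1 : bmeas (fun z => `|ext h z - ext fmax z| * (1 - ext frel z)).
  apply: bmeasM; first by apply/bmeas_norm/bmeasB; exact: bmeas_ext.
  by apply: bmeasB; [exact: bmeas_cst | exact: bmeas_ext].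
have b2 : bmeas (fun z => ext frel z * (1 - ext h z)).
  apply: bmeasM; first exact: bmeas_ext.
  by apply: bmeasB; [exact: bmeas_cst | exact: bmeas_ext].
have bq : bmeas q by apply: bmeasM => //; exact: bmeas_cst.
have br : bmeas r.
  by apply: bmeasD; [apply: bmeasM => //; exact: bmeas_cst | exact: bmeas_cst].
have q0 z : 0 <= q z.
  have /andP[_ f1] := proj2 (kernel_ext frel) z.
  by rewrite /q; apply: mulr_ge0; [exact: ltW | apply: mulr_ge0; rewrite ?subr_ge0].
have r0 z : 0 <= r z.
  have /andP[f0 _] := proj2 (kernel_ext frel) z.
  have /andP[_ h1] := proj2 (kernel_ext h) z.
  rewrite /r; apply: addr_ge0; last by apply: mulr_ge0 => //; exact: sqr_ge0.
  by apply: mulr_ge0 => //; apply: mulr_ge0; rewrite ?subr_ge0.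
have ent_ge0 (g : graphon R) z : unitSq z -> (0 <= rel_entropy (W0 z.1 z.2) (g z.1
  z.2))%E.
  by move=> [Iz1 Iz2]; apply: rel_entropy_ge0; exact: gfun_ge0_le1.
have mSq := @measurable_unitSq R.
have mE (f : mR R * mR R -> R) : bmeas f -> measurable_fun unitSq (EFin \o f).
  by move=> [mf _]; apply/measurable_EFinP; exact: measurable_funTS.
have main : (\int[leb2 R]_(z in unitSq) rel_entropy (W0 z.1 z.2) (fmax z.1 z.2) +
    (\int[UU]_z q z)%:E <=
    \int[leb2 R]_(z in unitSq) rel_entropy (W0 z.1 z.2) (h z.1 z.2) +
    (\int[UU]_z r z)%:E)%E.
  have addE (g : graphon R) f : bmeas f -> (forall z, 0 <= f z) ->
      (\int[leb2 R]_(z in unitSq) rel_entropy (W0 z.1 z.2) (g z.1 z.2) +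
       (\int[UU]_z f z)%:E =
       \int[leb2 R]_(z in unitSq) (rel_entropy (W0 z.1 z.2) (g z.1 z.2) + (f z)%:E))%E.
    move=> bf f0; rewrite -integral_unitSq// ge0_integralD//.
    - by move=> z; exact: ent_ge0.
    - exact: measurable_rel_entropy.
    - by move=> z _; rewrite lee_fin.
    - exact: mE.
  rewrite !addE//.
  apply: ge0_le_integral => //.
  - by move=> z Iz; apply: adde_ge0; [exact: ent_ge0 | rewrite lee_fin].
  - by apply: emeasurable_funD; [exact: measurable_rel_entropy | exact: mE].
  - by apply: emeasurable_funD; [exact: measurable_rel_entropy | exact: mE].
  move=> [x y] Iz; have [/= Ix Iy] := Iz.
  have [a ha] := block_cover k_gt0 Ix; have [b hb] := block_cover k_gt0 Iy.
  have u01 := gfun_ge0_le1 h Ix Iy.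
  have := gap a b _ u01; rewrite /q /r !(ext_block k_gt0 _ ha hb) /=
    !(step_fun_block k_gt0 _ ha hb).
  by rewrite [ext h _]ext_in.
have Er : \int[UU]_z r z = l * D + 3 * s ^+ 2.
  by rewrite bintD ?bint_cst ?bintZl//; [apply: bmeasM => //;
    exact: bmeas_cst | exact: bmeas_cst].
have Eq : s * L1_dist h fmax <= \int[UU]_z q z + s * D.
  rewrite /D -[s * D]bintZl// -bintD//; last by apply: bmeasM => //; exact: bmeas_cst.
  rewrite /L1_dist -bintZl; last by apply/bmeas_norm/bmeasB; exact: bmeas_ext.
  apply: le_bint_unif2.
  - by apply: bmeasM; [exact: bmeas_cst | apply/bmeas_norm/bmeasB; exact: bmeas_ext].
  - by apply: bmeasD => //; apply: bmeasM => //; exact: bmeas_cst.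
  move=> [x y] Iz; have [/= Ix Iy] := Iz.
  have [a ha] := block_cover k_gt0 Ix; have [b hb] := block_cover k_gt0 Iy.
  have /andP[h0 h1] := proj2 (kernel_ext h) (x, y).
  rewrite /q !(ext_block k_gt0 _ ha hb) -mulrDr ler_wpM2l ?(ltW s0)// !mxE.
  case: asboolP => _ /=; last by rewrite subr0 mulr1 mul0r addr0.
  by rewrite subrr mulr0 add0r mul1r distrC ger0_norm ?subr_ge0.
rewrite /rate_I.
have h2 : (0 <= (2^-1)%:E :> \bar R)%E by rewrite lee_fin invr_ge0.
have := lee_wpmul2l h2 main.
have mulD (A : \bar R) (x : R) : (0 <= A)%E -> 0 <= x ->
    ((2^-1)%:E * (A + x%:E) = (2^-1)%:E * A + (2^-1 * x)%:E)%E.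
  by move=> A0 x0; rewrite ge0_muleDr// EFinM.
have int_ge0 (g : graphon R) :
    (0 <= \int[leb2 R]_(z in unitSq) rel_entropy (W0 z.1 z.2) (g z.1 z.2))%E.
  by apply: integral_ge0 => z; exact: ent_ge0.
rewrite !mulD//; [move=> {}main|exact: Rintegral_ge0..].
have Eq' : s / 2 * L1_dist h fmax <= 2^-1 * (\int[UU]_z q z) + s / 2 * D by lra.
apply: (le_trans (leeD2l _ (_ : (_ <= (2^-1 * (\int[UU]_z q z) + s / 2 * D)%:E)%E))).
  by rewrite lee_fin.
rewrite EFinD addeA; apply: le_trans (leeD2r _ main) _.
rewrite -addeA -EFinD; apply: leeD2l; rewrite lee_fin Er; lra.
Qed.

(** Off [Omega] the entropy is infinite unless the two graphons
agree. *)
Lemma W_Omega_finite h : (rate_I W0 h < +oo)%E -> W_Omega W0 h.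
Proof.
move=> fin.
have ent_ge0 z : unitSq z -> (0 <= rel_entropy (W0 z.1 z.2) (h z.1 z.2))%E.
  by move=> [Iz1 Iz2]; apply: rel_entropy_ge0; exact: gfun_ge0_le1.
have fin' : (\int[leb2 R]_(z in unitSq) rel_entropy (W0 z.1 z.2) (h z.1 z.2) < +oo)%E.
  rewrite ltey; apply/eqP => E; move: fin; rewrite /rate_I E.
  by rewrite gt0_muley ?ltxx// lte_fin invr_gt0.
have int : (leb2 R).-integrable unitSq
    (fun z : mR R * mR R => rel_entropy (W0 z.1 z.2) (h z.1 z.2)).
  apply/integrableP; split; first exact: measurable_rel_entropy.
  rewrite (eq_integral (fun z : mR R * mR R => rel_entropy (W0 z.1 z.2) (h z.1 z.2)))//.
  by move=> z /set_mem Iz; rewrite gee0_abs//; exact: ent_ge0.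
have := integrable_ae (@measurable_unitSq R) int.
case=> N [mN N0 hN]; exists N; split=> // z /= nz; apply: hN => /= hz;
  apply: nz => -[Iz nO].
have := hz Iz; have [Iz1 Iz2] := Iz.
have /andP[w0 w1] := gfun_ge0_le1 W0 Iz1 Iz2.
have -> : rel_entropy (W0 z.1 z.2) (h z.1 z.2) =
    if h z.1 z.2 == W0 z.1 z.2 then 0%E else +oo%E.
  rewrite /rel_entropy ifT//; apply: contrapT => /negP; rewrite negb_or => /andP[n0 n1].
  by apply: nO; split=> //=; rewrite !lt_neqAle eq_sym n0 n1 w0 w1.
by case: eqP.
Qed.

Lemma rate_I_fmax_fin : rate_I W0 fmax \is a fin_num.
Proof.
have fin a b : rel_entropy (p a b) (f_max_mx H p a b) \is a fin_num.
  rewrite /rel_entropy !mxE; case: ifPn => // /orP pp; case: asboolP => r.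
    case: pp => /eqP E; last by rewrite E eqxx.
    by case: (irrelevant0 (H := H) E).
  by rewrite eqxx.
pose M := \matrix_(a, b) fine (rel_entropy (p a b) (f_max_mx H p a b)).
have bM : bmeas (ext (step_fun M)).
  split.
    apply/(measurable_restrictT _ (@measurable_unitSq R)); apply: measurable_funTS.
    apply: (bmeas_measurable (f := fun z : mR R * mR R => step_fun M z.1 z.2)).
    apply: bmeas_sum => a _; apply: bmeas_sum => b _; apply: bmeasM;
      first exact: bmeas_cst.
    by apply: bmeasM; [apply: bmeas_fst|apply: bmeas_snd]; exact: bmeas_block.
  exists (\sum_a \sum_b `|M a b|);
    apply: (block_pair_cases k_gt0) => [a b x y ha hb|z nz].
    rewrite (ext_block k_gt0 _ ha hb) (bigD1 a)//= (bigD1 b)//= -addrA lerDl.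
    by rewrite addr_ge0 ?sumr_ge0// => *; exact: sumr_ge0.
  by rewrite ext_out// normr0 sumr_ge0// => *; exact: sumr_ge0.
rewrite /rate_I (eq_integral (fun z => (ext (step_fun M) z)%:E)).
  by rewrite integral_unitSq// -EFinM.
move=> [x y] /set_mem[/= Ix Iy].
have [a ha] := block_cover k_gt0 Ix; have [b hb] := block_cover k_gt0 Iy.
rewrite (ext_block k_gt0 _ ha hb) /= !(step_fun_block k_gt0 _ ha hb) /M.
by rewrite [X in _ = (X%:E)]mxE fineK.
Qed.

(** For a graphon of finite rate the term in [1 - h] is at most
a multiple of the missing density, by [relevant_deficit]. *)
Lemma entropy_stability s : 0 < s <= 1 / 2 -> exists2 eta : R, 0 < eta &
  forall h : graphon R, hom_density H fmax - eta <= hom_density H h ->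
  (rate_I W0 fmax + (s / 2 * L1_dist h fmax)%:E <= rate_I W0 h + (2 * s ^+ 2)%:E)%E.
Proof.
move=> s12; have /andP[s0 s2] := s12.
have [l l0 stable] := rate_I_stable s12.
have [c c0 deficit] := relevant_deficit k_gt0 H p.
have ss : 0 < s ^+ 2 by exact: exprn_gt0.
have lc0 : 0 <= l * c by rewrite mulr_ge0// ltW.
(* Keeps the term in 1 - h below s ^+ 2 / 2. *)
exists (s ^+ 2 / 2 / (l * c + 1)); first by rewrite !divr_gt0// ltr_wpDl.
move=> h th.
have [fin|] := ltP (rate_I W0 h) +oo%E; last first.
  by rewrite leye_eq => /eqP ->; rewrite addye// leey.
apply: le_trans (stable h) _; apply: leeD2l; rewrite lee_fin.
have D := deficit h (dominated_W_Omega k_gt0 (W_Omega_finite fin)).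
have lD := ler_wpM2l l0 D.
suff : l * (c * (hom_density H fmax - hom_density H h)) <= s ^+ 2 / 2 by lra.
have t1 : hom_density H fmax - hom_density H h <= s ^+ 2 / 2 / (l * c + 1) by lra.
rewrite mulrA; apply: le_trans (ler_wpM2l lc0 t1) _.
rewrite mulrCA ler_piMr//; first by rewrite divr_ge0// ltW.
by rewrite ler_pdivrMr ?ltr_wpDl// mul1r lerDl.
Qed.

End Stability.

(** * The minimizer of the rate function *)

Section Minimizer.
Variables (R : realType) (k : nat).
Hypothesis k_gt0 : (0 < k)%N.
Variables (v : nat) (H : sgraph v) (p : block_matrix R k).
Local Notation W0 := (block_graphon p).
Local Notation fmax := (f_max H p).

Lemma cut_delta_le_L1 (f g : graphon R) : cut_delta f g <= L1_dist f g.
Proof.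
apply: le_trans (cut_delta_lb f g (mp_bijection_id R)) _.
exact: cut_dist_le_L1.
Qed.

Lemma class_density_near (F : graphon_class R) (h : graphon R) eta :
  mdist F (cls h) <= eta ->
  class_density H F - #|edges H|%:R * eta <= hom_density H h.
Proof.
rewrite -[F]reprK mdist_cls [class_density _ _](class_density_cls H (repr F)) => d.
rewrite lerBlDr -lerBlDl; apply: le_trans (ler_norm _) _.
by apply: le_trans (hom_density_cut_delta H (repr F) h) _; rewrite ler_wpM2l.
Qed.

(** By the counting lemma, a graphon close to the class [F] has
nearly the density of [F]. *)
Lemma class_stability s : 0 < s <= 1 / 2 -> exists2 eta : R, 0 < eta &
  forall F h, hom_density H fmax <= class_density H F -> mdist F (cls h) <= eta ->
  (rate_I W0 fmax + (s / 2 * L1_dist h fmax)%:E <= rate_I W0 h + (2 * s ^+ 2)%:E)%E.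
Proof.
move=> s12; have [eta eta0 stable] := entropy_stability k_gt0 H p s12.
have E0 : 0 < #|edges H|%:R + 1 :> R by rewrite ltr_wpDl.
exists (eta / (#|edges H|%:R + 1)); first by rewrite divr_gt0.
move=> F h tF d; apply: stable.
apply: le_trans (class_density_near d); apply: lerB => //.
by rewrite mulrCA ler_piMr ?(ltW eta0)// ler_pdivrMr// mul1r lerDl.
Qed.

Lemma rate_J_le F h : Wtilde_Omega W0 F -> mdist F (cls h) = 0 ->
  (rate_J W0 F <= rate_I W0 h)%E.
Proof.
move=> WF d0; rewrite /rate_J asboolT//; apply: ge_ereal_sup => _ [eta eta0 <-].
by apply: ereal_inf_lbound; exists h => //=; rewrite d0 ltW.
Qed.

Lemma L1_dist_ge0 (f g : graphon R) : 0 <= L1_dist f g.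
Proof. exact: Rintegral_ge0. Qed.

Lemma rate_J_ge F : hom_density H fmax <= class_density H F ->
  (rate_I W0 fmax <= rate_J W0 F)%E.
Proof.
move=> tF; rewrite /rate_J; case: asboolP => WF; last by rewrite leey.
apply/lee_addgt0Pr => e e0.
pose s := Num.min (1 / 2) (e / 2).
have s0 : 0 < s by rewrite lt_min !divr_gt0.
have s12 : 0 < s <= 1 / 2 by rewrite s0 ge_min lexx.
have [eta eta0 stable] := class_stability s12.
rewrite -leeBlDr//.
apply: le_trans (ereal_sup_ubound _); last by exists eta.
apply: le_ereal_inf_tmp => _ [h d <-].
rewrite leeBlDr//.
have := stable F h tF d => h1.
apply: (@le_trans _ _ (rate_I W0 h + (2 * s ^+ 2)%:E)%E).
  apply: le_trans h1; rewrite leeDl// lee_fin mulr_ge0 ?L1_dist_ge0//.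
  by rewrite divr_ge0// ltW.
apply: leeD2l; rewrite lee_fin.
have se : s <= e / 2 by rewrite ge_min lexx orbT.
have s2 : s <= 1 / 2 by case/andP: s12.
nra.
Qed.

Lemma unique_minimizer_f_max :
  unique_minimizer [set F : graphon_class R | t_max W0 H <= class_density H F]
    (rate_J W0) (cls fmax).
Proof.
have le7 (x y : R) : x <= y / 7 -> x + 6 * x <= y by move=> ?; lra.
rewrite (t_maxE k_gt0).
have Afmax : hom_density H fmax <= class_density H (cls fmax).
  by rewrite class_density_cls.
have Jfmax : (rate_J W0 (cls fmax) <= rate_I W0 fmax)%E.
  by apply: rate_J_le; [exact: Wtilde_f_max | rewrite mdist_cls cut_deltaxx].
split; [exact: Afmax | move=> F /= tF | move=> F /= tF minF].
  exact: le_trans Jfmax (rate_J_ge tF).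
have JF : (rate_J W0 F <= rate_I W0 fmax)%E by exact: le_trans (minF _ Afmax) Jfmax.
have If := rate_I_fmax_fin k_gt0 H p.
have WF : Wtilde_Omega W0 F.
  apply: contrapT => nWF; move: JF; rewrite /rate_J asboolF//.
  by rewrite leye_eq => /eqP E; rewrite E in If.
apply: mdist_positivity; apply/eqP; rewrite eq_le mdist_ge0 andbT.
apply/ler_addgt0Pr => e e0; rewrite add0r.
(* An approximant within s of F will be within 6 s of f_max. *)
pose s := Num.min (1 / 2) (e / 7).
have s0 : 0 < s by rewrite lt_min !divr_gt0.
have s12 : 0 < s <= 1 / 2 by rewrite s0 ge_min lexx.
have [eta eta0 stable] := class_stability s12.
pose eta' := Num.min eta s.
have eta'0 : 0 < eta' by rewrite lt_min eta0.
have ss : 0 < s ^+ 2 by exact: exprn_gt0.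
have [_ [h /= d <-] Ih] : exists2 y, [set rate_I W0 h | h in [set h | mdist F (cls
  h) <= eta']] y &
    (y < rate_I W0 fmax + (s ^+ 2)%:E)%E.
  apply: ereal_inf_lt; apply: (@le_lt_trans _ _ (rate_I W0 fmax)); last first.
    by rewrite lteDl// lte_fin.
  apply: le_trans JF; rewrite /rate_J asboolT//.
  by apply: ereal_sup_ubound; exists eta'.
have d1 : mdist F (cls h) <= eta by rewrite (le_trans d)// ge_min lexx.
have d2 : mdist F (cls h) <= s by rewrite (le_trans d)// ge_min lexx orbT.
have := stable F h tF d1.
move/le_trans => /(_ _ (leeD2r _ (ltW Ih))).
rewrite -addeA -EFinD leeD2lE// lee_fin => hs.
have L : L1_dist h fmax <= 6 * s.
  rewrite -(ler_pM2l s0); lra.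
apply: le_trans (metric_triangle F (cls h) (cls fmax)) _.
rewrite mdist_cls; apply: le_trans (lerD d2 (le_trans (cut_delta_le_L1 h fmax) L)) _.
have se : s <= e / 7 by rewrite ge_min lexx orbT.
exact: le7 se.
Qed.

End Minimizer.

(** * Exponential moments of the inhomogeneous random graph *)

Section RandomGraphSums.
Variables (R : realType) (N : nat).
Local Notation pairs := ('I_N * 'I_N)%type.
Implicit Types (G : sgraph N) (J : {set pairs}) (e : pairs).

Definition upper : {set pairs} := [set e : pairs | (e.1 < e.2)%N].

Definition sym_edges J : {set pairs} :=
  [set e : pairs | ((e \in J) && (e.1 < e.2)%N) || (((e.2, e.1) \in J) && (e.2 <
    e.1)%N)].

Fact sym_edgesP J : is_sgraph (sym_edges J).
Proof.
apply/andP; split; first by apply/forallP => i; rewrite inE /= ltnn !andbF.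
by apply/'forall_forallP => i j; rewrite !inE /= orbC; apply/implyP.
Qed.

(** The pairs [i < j] can be chosen freely, and they determine the
graph. *)
Definition sgraph_of_upper J : sgraph N := SGraph (sym_edgesP J).

Lemma mem_sgraph_of_upper J e : (e.1 < e.2)%N ->
  (e \in edges (sgraph_of_upper J)) = (e \in J).
Proof.
move=> lt; rewrite inE lt andbT.
by rewrite [(e.2 < e.1)%N]ltnNge (ltnW lt) /= andbF orbF.
Qed.

Lemma sgraph_of_upperK G : sgraph_of_upper (edges G :&: upper)%SET = G.
Proof.
apply: val_inj; apply/setP => -[i j]; rewrite !inE /=.
rewrite [(j, i) \in _]edges_sym -!andbA !andbb -andb_orr.
have [->|ij] := eqVneq i j; first by rewrite edges_irr.
by rewrite -neq_ltn ij andbT.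
Qed.

(** Independence of the edges: a sum over all graphs of a product
over the pairs is a product over the pairs. *)
Lemma sum_sgraph_prod (F : pairs -> bool -> R) :
  \sum_(G : sgraph N) \prod_(e : pairs | (e.1 < e.2)%N) F e (e \in edges G) =
  \prod_(e : pairs | (e.1 < e.2)%N) (F e true + F e false).
Proof.
rewrite (reindex_onto sgraph_of_upper (fun G => edges G :&: upper)%SET); last first.
  by move=> G _; exact: sgraph_of_upperK.
pose F1 e := if (e.1 < e.2)%N then F e true else 0.
pose F0 e := if (e.1 < e.2)%N then F e false else 1.
have -> : \prod_(e : pairs | (e.1 < e.2)%N) (F e true + F e false) =
    \prod_(e : pairs) (F1 e + F0 e).
  rewrite big_mkcond /=; apply: eq_bigr => e _; rewrite /F1 /F0.
  by case: ifP => //; rewrite add0r.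
rewrite bigA_distr [RHS](bigID (fun J => J \subset upper)) /=.
rewrite [X in _ = _ + X]big1 ?addr0; last first.
  move=> J /subsetPn[e eJ]; rewrite inE => eU.
  by rewrite (bigD1 e)//= eJ /F1 (negbTE eU) mul0r.
apply: eq_big => J.
  apply/eqP/idP => [<-|/fintype.subsetP JU]; first exact: finset.subsetIr.
  apply/setP => e; rewrite !inE /=; have [lt|nlt] := boolP (e.1 < e.2)%N.
    by rewrite !andbT [(e.2 < e.1)%N]ltnNge (ltnW lt) /= andbF orbF.
  by rewrite !andbF; apply/esym/negbTE; apply: contraNN nlt => /JU; rewrite inE.
move=> /eqP JU; rewrite big_mkcond /=; apply: eq_bigr => e _; rewrite /F1 /F0.
case: ifPn => [lt|nlt]; first by rewrite mem_sgraph_of_upper//; case: (e \in J).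
by rewrite -JU inE [e \in upper]inE (negbTE nlt) andbF.
Qed.

Variable q : 'I_N -> 'I_N -> R.
Hypothesis q_sym : forall i j, q i j = q j i.
Hypothesis q01 : forall i j, 0 <= q i j <= 1.

Definition sgraph_pmf G : R :=
  \prod_(e : pairs | (e.1 < e.2)%N) if e \in edges G then q e.1 e.2 else 1 - q e.1 e.2.

Lemma sgraph_pmf_ge0 G : 0 <= sgraph_pmf G.
Proof.
by apply: prodr_ge0 => e _; have /andP[? ?] := q01 e.1 e.2; case: ifP;
  rewrite ?subr_ge0.
Qed.

Lemma sum_sgraph_pmf : \sum_G sgraph_pmf G = 1.
Proof.
rewrite (sum_sgraph_prod (fun e b => if b then q e.1 e.2 else 1 - q e.1 e.2)).
by rewrite big1// => e _; rewrite addrC subrK.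
Qed.

Definition dev G i j : R := ((i, j) \in edges G)%:R - q i j.

Lemma sgraph_exp_moment (l : pairs -> R) : (forall e, `|l e| <= 1 / 2) ->
  \sum_G sgraph_pmf G * expR (\sum_(e : pairs | (e.1 < e.2)%N) l e * dev G e.1 e.2) <=
  expR (\sum_(e : pairs | (e.1 < e.2)%N) 2 * l e ^+ 2).
Proof.
move=> l12.
pose F e (b : bool) := (if b then q e.1 e.2 else 1 - q e.1 e.2) *
  expR (l e * (b%:R - q e.1 e.2)).
rewrite [leLHS](eq_bigr (fun G => \prod_(e : pairs | (e.1 < e.2)%N) F e (e \in
  edges G))); last first.
  move=> G _; rewrite expR_sum -big_split /=; apply: eq_bigr => e _.
  by rewrite /F /dev -surjective_pairing.
rewrite sum_sgraph_prod expR_sum; apply: ler_prod => e _; rewrite /F.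
have /andP[q0 q1] := q01 e.1 e.2; have := l12 e; rewrite ler_norml => /andP[_ l2].
rewrite addr_ge0 ?mulr_ge0 ?expR_ge0 ?subr_ge0//= sub0r.
rewrite mulrBr mulr1 mulrN !expRD mulrA -mulrDl.
have := mgf_bernoulli_le (q01 e.1 e.2) l2.
rewrite expRD => h; apply: (@le_trans _ _ (expR (q e.1 e.2 * l e) * expR (2 * l e
  ^+ 2) *
   expR (- (l e * q e.1 e.2)))).
  by apply: ler_wpM2r => //; exact: expR_ge0.
by rewrite mulrAC -expRD [q _ _ * _]mulrC subrr expR0 mul1r.
Qed.

Lemma sum_pairs_triangle (F : pairs -> R) :
  \sum_e F e = \sum_(e : pairs | (e.1 < e.2)%N) (F e + F (e.2, e.1)) + \sum_i F (i, i).
Proof.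
rewrite big_split /= (bigID (fun e : pairs => (e.1 < e.2)%N)) /= -addrA; congr (_ + _).
rewrite (bigID (fun e : pairs => (e.2 < e.1)%N)) /=; congr (_ + _).
  rewrite [RHS](reindex_onto (fun e => (e.2, e.1)) (fun e => (e.2, e.1))) /=;
    last by case.
  apply: eq_big => [[i j]|[i j] _] //=.
  by rewrite eqxx andbT; case: ltngtP.
rewrite (reindex_onto (fun i => (i, i)) fst) /=; last first.
  by move=> [i j] /=; rewrite -!leqNgt -eqn_leq => /eqP/val_inj ->.
by apply: eq_bigl => i; rewrite !ltnn eqxx.
Qed.

(** An unordered pair is counted at most twice in the
rectangle, so the tilt of each edge is at most [2 t].  The diagonal entries are
not random and contribute at most [N]. *)
Lemma sgraph_rect_moment (S T : {set 'I_N}) t : `|t| <= 1 / 4 ->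
  \sum_G sgraph_pmf G * expR (t * \sum_(i in S) \sum_(j in T) dev G i j) <=
  expR (8 * t ^+ 2 * N%:R ^+ 2 + `|t| * N%:R).
Proof.
move=> t4.
pose c (e : pairs) : R := (e.1 \in S)%:R * (e.2 \in T)%:R.
have c01 e : 0 <= c e <= 1.
  by rewrite /c; do 2 case: (_ \in _); rewrite ?mulr1 ?mulr0 lexx ler01.
pose l e := t * (c e + c (e.2, e.1)).
have devC G i j : dev G i j = dev G j i by rewrite /dev q_sym edges_sym.
have E G : t * \sum_(i in S) \sum_(j in T) dev G i j =
    \sum_(e : pairs | (e.1 < e.2)%N) l e * dev G e.1 e.2 +
    t * \sum_i c (i, i) * dev G i i.
  have -> : \sum_(i in S) \sum_(j in T) dev G i j = \sum_(e : pairs) c e * dev G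
    e.1 e.2.
    rewrite pair_big_dep big_mkcond /=; apply: eq_bigr => -[i j] _ /=.
    by rewrite /c /=; do 2 case: (_ \in _); rewrite /= ?mulr1 ?mulr0 ?mul0r ?mul1r.
  rewrite sum_pairs_triangle mulrDr /= mulr_sumr; congr (_ + _).
  by apply: eq_bigr => e _; rewrite [dev G e.2 e.1]devC /l -mulrDl mulrA.
have diag G : t * \sum_i c (i, i) * dev G i i <= `|t| * N%:R.
  apply: le_trans (ler_norm _) _; rewrite normrM ler_wpM2l//.
  apply: le_trans (ler_norm_sum _ _ _) _.
  rewrite -[N in leRHS]card_ord -sumr_const; apply: ler_sum => i _.
  have /andP[c0 c1] := c01 (i, i); have /andP[q0 q1] := q01 i i.
  rewrite normrM (ger0_norm c0) /dev edges_irr sub0r normrN ger0_norm//.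
  exact: mulr_ile1.
have l12 e : `|l e| <= 1 / 2.
  have /andP[c0 c1] := c01 e; have /andP[c0' c1'] := c01 (e.2, e.1).
  rewrite /l normrM [X in _ * X]ger0_norm ?addr_ge0//.
  have t0 := normr_ge0 t; nra.
apply: (@le_trans _ _ (expR (`|t| * N%:R) * \sum_G sgraph_pmf G *
    expR (\sum_(e : pairs | (e.1 < e.2)%N) l e * dev G e.1 e.2))).
  rewrite mulr_sumr; apply: ler_sum => G _; rewrite E expRD mulrA [leRHS]mulrC.
  apply: ler_wpM2l; last by rewrite ler_expR.
  by rewrite mulr_ge0 ?sgraph_pmf_ge0 ?expR_ge0.
rewrite [_ + `|t| * _]addrC expRD; apply: ler_wpM2l; first exact: expR_ge0.
apply: le_trans (sgraph_exp_moment l12) _; rewrite ler_expR.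
apply: (@le_trans _ _ (\sum_(e : pairs) 8 * t ^+ 2)).
  rewrite big_mkcond /=; apply: ler_sum => e _.
  have t0 := sqr_ge0 t; case: ifP => _; last by rewrite mulr_ge0.
  have /andP[c0 c1] := c01 e; have /andP[c0' c1'] := c01 (e.2, e.1).
  rewrite /l exprMn; set d := _ + _.
  have d2 : d ^+ 2 <= 4 by rewrite /d; nra.
  nra.
by rewrite sumr_const card_prod card_ord -[leLHS]mulr_natr natrM expr2.
Qed.

End RandomGraphSums.

(** * Concentration in the cut distance *)

(** The finite counterpart of [bint_maximize]. *)
Lemma sum_weight_le (R : realType) (I : finType) (w c : I -> R) :
  (forall i, 0 <= w i <= 1) ->
  exists S : {set I}, \sum_i w i * c i <= \sum_(i in S) c i.
Proof.
move=> w01; exists [set i | 0 < c i]%SET; rewrite [leRHS]big_mkcond /=.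
apply: ler_sum => i _; have /andP[w0 w1] := w01 i; rewrite inE.
case: ltP => ci; first by rewrite ler_piMl// ltW.
by rewrite mulr_ge0_le0.
Qed.

Lemma bilinear_le (R : realType) (I : finType) (D : I -> I -> R) (c : R) (s t : I
  -> R) :
  (forall S T : {set I}, \sum_(i in S) \sum_(j in T) D i j <= c) ->
  (forall i, 0 <= s i <= 1) -> (forall i, 0 <= t i <= 1) ->
  \sum_i \sum_j s i * t j * D i j <= c.
Proof.
move=> Dc s01 t01.
have [S leS] := sum_weight_le (fun i => \sum_j t j * D i j) s01.
have [T leT] := sum_weight_le (fun j => \sum_(i in S) D i j) t01.
apply: le_trans (Dc S T).
rewrite (eq_bigr (fun i => s i * \sum_j t j * D i j)); last first.
  by move=> i _; rewrite mulr_sumr; apply: eq_bigr => j _; rewrite mulrA.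
apply: le_trans leS _; rewrite [leRHS]exchange_big /=; apply: le_trans leT.
rewrite exchange_big /=; apply: ler_sum => j _.
by rewrite mulr_sumr.
Qed.

Section Cells.
Variables (R : realType) (N : nat).
Hypothesis N_gt0 : (0 < N)%N.
Local Notation U := (unif R).

Let N0 : 0 < N%:R :> R. Proof. by rewrite ltr0n. Qed.

(** The difference is constant on the cells, so its integral over
a rectangle is a bilinear form in the fractions of each cell that the two sides
cover.  By [bilinear_le] it is largest when these are 0 or 1. *)
Lemma cut_dist_cells (f g : graphon R) (D : 'M[R]_N) (c : R) :
  (forall i j x y, block R i x -> block R j y -> f x y - g x y = D i j) ->
  (forall S T : {set 'I_N}, `|\sum_(i in S) \sum_(j in T) D i j| <= c) ->
  cut_dist f g <= c / N%:R ^+ 2.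
Proof.
move=> DE Dc; apply: cut_dist_le => S T mS mT SI TI; rewrite bint_rect//.
have bS (i : 'I_N) : bmeas (\1_(block R i `&` S) : mR R -> R).
  by apply: bmeas_indic; apply: measurableI => //; exact: measurable_block.
have bT (i : 'I_N) : bmeas (\1_(block R i `&` T) : mR R -> R).
  by apply: bmeas_indic; apply: measurableI => //; exact: measurable_block.
pose s (i : 'I_N) : R := N%:R * \int[U]_x \1_(block R i `&` S) x.
pose t (i : 'I_N) : R := N%:R * \int[U]_x \1_(block R i `&` T) x.
have w01 (X : set (mR R)) (i : 'I_N) : measurable X ->
    0 <= N%:R * \int[U]_x \1_(block R i `&` X) x <= 1.
  move=> mX; apply/andP; split; first by rewrite mulr_ge0// Rintegral_ge0.
  rewrite -ler_pdivlMl// mulr1 -(bint_block R N_gt0 i); apply: bint_le.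
  - by apply: bmeas_indic; apply: measurableI => //; exact: measurable_block.
  - exact: bmeas_block.
  move=> x; rewrite !indicE in_setI; case: (x \in block R i) => //=.
  by rewrite -[leRHS]/(1%:R) ler_nat leq_b1.
have s01 i : 0 <= s i <= 1 by exact: w01.
have t01 i : 0 <= t i <= 1 by exact: w01.
have b2 (i j : 'I_N) : bmeas (fun z : mR R * mR R =>
    \1_(block R i `&` S) z.1 * \1_(block R j `&` T) z.2 : R).
  by apply: bmeasM; [exact: (bmeas_fst (bS i)) | exact: (bmeas_snd (bT j))].
have E : \int[unif2 R]_z ((ext f z - ext g z) * (\1_S z.1 * \1_T z.2)) =
    N%:R ^- 2 * \sum_i \sum_j s i * t j * D i j.
  transitivity (\int[unif2 R]_z \sum_i \sum_j (D i j *
      (\1_(block R i `&` S) z.1 * \1_(block R j `&` T) z.2))).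
    apply: eq_bint_unif2.
    - apply: bmeasM; first by apply: bmeasB; exact: bmeas_ext.
      by apply: bmeasM; [apply: bmeas_fst|apply: bmeas_snd]; exact: bmeas_indic.
    - by apply: bmeas_sum => i _; apply: bmeas_sum => j _; apply: bmeasM => //;
      exact: bmeas_cst.
    move=> [x y] Iz; have [/= Ix Iy] := Iz; rewrite !ext_in//=.
    have [i xi] := block_cover N_gt0 Ix; have [j yj] := block_cover N_gt0 Iy.
    rewrite (DE i j)// (bigD1 i)//= (bigD1 j)//=.
    rewrite [X in _ + X + _]big1 ?addr0; last first.
      move=> j' jj'; rewrite ![\1_(block R j' `&` _) _]indicE in_setI (_ : y \in
        block R j' = false) ?mulr0//.
      by apply: memNset => yj'; move/eqP: jj'; apply; exact: block_inj yj' yj.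
    rewrite [X in _ + X]big1 ?addr0; last first.
      move=> i' ii'; rewrite big1// => j' _.
      rewrite [\1_(block R i' `&` _) _]indicE in_setI (_ : x \in block R i' =
        false) ?mul0r ?mulr0//.
      by apply: memNset => xi'; move/eqP: ii'; apply; exact: block_inj xi' xi.
    by rewrite !indicE !in_setI (mem_set xi) (mem_set yj).
  rewrite bint_sum; last first.
    by move=> i _; apply: bmeas_sum => j _; apply: bmeasM => //; exact: bmeas_cst.
  rewrite mulr_sumr; apply: eq_bigr => i _.
  rewrite bint_sum; last by move=> j _; apply: bmeasM => //; exact: bmeas_cst.
  rewrite mulr_sumr; apply: eq_bigr => j _.
  rewrite bintZl// (bint_prod U U (b2 i j)) /=.
  have -> : \int[U]_x (\int[U]_y (\1_(block R i `&` S) x * \1_(block R j `&` T) y)) =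
      \int[U]_x (\1_(block R i `&` S) x * \int[U]_y \1_(block R j `&` T) y).
    by apply: eq_Rintegral => x _; rewrite bintZl.
  rewrite bintZr// /s /t; field.
  by rewrite gt_eqF.
have N2 : 0 < N%:R ^+ 2 :> R by rewrite exprn_gt0.
rewrite E normrM normfV (gtr0_norm N2) mulrC ler_pM2r ?invr_gt0//.
rewrite ler_norml; apply/andP; split; last first.
  by apply: bilinear_le => // S' T'; apply: le_trans (ler_norm _) _.
rewrite lerNl.
have -> : - (\sum_i \sum_j s i * t j * D i j) = \sum_i \sum_j s i * t j * - D i j.
  rewrite -sumrN; apply: eq_bigr => i _; rewrite -sumrN; apply: eq_bigr => j _.
  by rewrite mulrN.
apply: (bilinear_le (D := fun i j => - D i j)) => // S' T'.
under eq_bigr do rewrite sumrN.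
by rewrite sumrN; apply: le_trans (ler_norm _) _; rewrite normrN.
Qed.

End Cells.

Section Tail.
Variables (R : realType) (N : nat) (q : 'I_N -> 'I_N -> R).
Hypothesis q_sym : forall i j, q i j = q j i.
Hypothesis q01 : forall i j, 0 <= q i j <= 1.

Definition cut_deviates (c : R) (G : sgraph N) : bool :=
  [exists S : {set 'I_N}, exists T : {set 'I_N},
     c < `|\sum_(i in S) \sum_(j in T) dev q G i j|].

(** Chernoff's bound for each of the [4 ^ N] rectangles and both
signs, followed by a union bound. *)
Lemma cut_deviation_le (c t : R) : 0 <= t <= 1 / 4 ->
  \sum_(G | cut_deviates c G) sgraph_pmf q G <=
  2 * 4 ^+ N * expR (8 * t ^+ 2 * N%:R ^+ 2 + t * N%:R - t * c).
Proof.
move=> /andP[t0 t4].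
pose X (ST : {set 'I_N} * {set 'I_N}) G := \sum_(i in ST.1) \sum_(j in ST.2) dev q
  G i j.
pose Y ST G := expR (t * X ST G) + expR (- t * X ST G).
apply: (@le_trans _ _ (\sum_G sgraph_pmf q G * \sum_ST (expR (- (t * c)) * Y ST G))).
  rewrite big_mkcond /=; apply: ler_sum => G _.
  have p0 := sgraph_pmf_ge0 q01 G.
  have Y0 ST : 0 <= expR (- (t * c)) * Y ST G.
    by rewrite mulr_ge0 ?addr_ge0 ?expR_ge0.
  case: ifPn => [/existsP[S /existsP[T cX]]|_]; last by rewrite mulr_ge0// sumr_ge0.
  rewrite -[leLHS]mulr1; apply: ler_wpM2l => //.
  rewrite (bigD1 (S, T))//=; apply: ler_wpDr; first exact: sumr_ge0.
  rewrite mulrDr -!expRD -(expR0 R).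
  have := cX; rewrite -[\sum_(i in S) _]/(X (S, T) G).
  have [X0|X0] := ger0P (X (S, T) G) => cX'.
    rewrite ler_wpDr ?expR_ge0// ler_expR.
    by rewrite addrC subr_ge0 ler_wpM2l// ltW.
  rewrite ler_wpDl ?expR_ge0// ler_expR.
  by rewrite addrC subr_ge0 mulNr -mulrN ler_wpM2l// ltW.
under eq_bigr do rewrite mulr_sumr.
rewrite exchange_big /=.
apply: (@le_trans _ _ (\sum_(ST : {set 'I_N} * {set 'I_N}) 2 * expR (8 * t ^+ 2 *
  N%:R ^+ 2 + t * N%:R - t * c))).
  apply: ler_sum => ST _.
  have t41 : `|t| <= 1 / 4 by rewrite ger0_norm.
  have t41' : `|- t| <= 1 / 4 by rewrite normrN.
  have := sgraph_rect_moment q_sym q01 ST.1 ST.2 t41.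
  have := sgraph_rect_moment q_sym q01 ST.1 ST.2 t41'.
  rewrite sqrrN normrN ger0_norm// => h1 h2.
  rewrite (eq_bigr (fun G => expR (- (t * c)) *
      (sgraph_pmf q G * expR (t * X ST G) + sgraph_pmf q G * expR (- t * X ST
        G)))); last first.
    by move=> G _; rewrite /Y -mulrDr mulrCA.
  rewrite -mulr_sumr big_split /= [_ + _ - _]addrC expRD mulrCA.
  apply: ler_wpM2l; first exact: expR_ge0.
  apply: le_trans (lerD h2 h1) _; set e := expR _; lra.
have card_sets : #|{set 'I_N}| = (2 ^ N)%N.
  by rewrite -cardsT -powersetT card_powerset cardsT card_ord.
rewrite sumr_const card_prod card_sets -expnMn -[leLHS]mulr_natl natrX mulrA.
by rewrite [_ * 2]mulrC.
Qed.

End Tail.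

(** * Conditioning on the upper tail *)

Section Conditioning.
Variables (R : realType) (k : nat).
Hypothesis k_gt0 : (0 < k)%N.
Variables (v : nat) (H : sgraph v) (p : block_matrix R k).
Local Notation fmax := (f_max H p).

Fact f_max_mx_sym a b : f_max_mx H p a b = f_max_mx H p b a.
Proof. by rewrite !mxE relevantC block_mx_sym. Qed.

Fact f_max_mx_ge0_le1 a b : 0 <= f_max_mx H p a b <= 1.
Proof.
by rewrite mxE; case: ifP => _; [rewrite ler01 lexx | exact: block_mx_ge0_le1].
Qed.

Definition f_max_matrix : block_matrix R k := BlockMatrix f_max_mx_sym f_max_mx_ge0_le1.

Variable n : nat.
Hypothesis n_gt0 : (0 < n)%N.
Local Notation N := (k * n)%N.
Implicit Types (G : sgraph N).

Let N_gt0 : (0 < N)%N. Proof. by rewrite muln_gt0 k_gt0. Qed.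

(** The cells of the empirical graphon refine the blocks. *)
Lemma block_vertex (i : 'I_N) x : block R i x -> block R (vertex_block i) x.
Proof.
move=> bi; have n0 : 0 < n%:R :> R by rewrite ltr0n.
have k0 : 0 < k%:R :> R by rewrite ltr0n.
have E (m : nat) : m%:R / k%:R = (m * n)%:R / N%:R :> R.
  by rewrite !natrM; field; rewrite !gt_eqF.
have N0 : 0 < N%:R :> R by rewrite ltr0n.
have xle : x <= (vertex_block i).+1%:R / k%:R.
  apply: le_trans (block_le bi) _; rewrite E ler_pM2r ?invr_gt0// ler_nat /=.
  by rewrite -ltn_divLR// ltnS.
have [v0|v0] := posnP (vertex_block i).
  rewrite /block v0 /= in_itv /= -[k%:R^-1]mul1r.
  rewrite v0 in xle; rewrite xle andbT.
  by apply: le_trans (block_ge bi); rewrite divr_ge0.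
apply: blockI => //; rewrite xle andbT.
have i0 : (0 < i)%N.
  by move: v0; rewrite /= divn_gt0//; exact: leq_trans.
apply: le_lt_trans (block_gt bi i0); rewrite E ler_pM2r ?invr_gt0// ler_nat.
exact: leq_divM.
Qed.

Local Notation vb := (@vertex_block k n).

Definition vertex_mx (M : block_matrix R k) (i j : 'I_N) : R := M (vb i) (vb j).

Lemma vertex_mx_sym M i j : vertex_mx M i j = vertex_mx M j i.
Proof. exact: block_mx_sym. Qed.

Lemma vertex_mx01 M i j : 0 <= vertex_mx M i j <= 1.
Proof. exact: block_mx_ge0_le1. Qed.

Lemma graph_pmfE M G : graph_pmf M G = sgraph_pmf (vertex_mx M) G.
Proof. by []. Qed.

Lemma graph_pmf_pos G i j : graph_pmf p G != 0 -> (i, j) \in edges G ->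
  0 < p (vb i) (vb j).
Proof.
move=> pG; wlog ij : i j / (i < j)%N.
  move=> wl ijG; have [/andP[_ ij]|/andP[jiG ji]] := edge_lt ijG; first exact: wl.
  by rewrite block_mx_sym; exact: wl.
move=> ijG; rewrite lt_neqAle eq_sym block_mx_ge0 andbT.
apply: contraNneq pG => p0; rewrite graph_pmfE /sgraph_pmf (bigD1 (i, j))//= ijG.
by rewrite /vertex_mx p0 mul0r.
Qed.

(** The pairs include [i = j], which is never an edge. *)
Definition full G := forall i j, relevant H p (vb i) (vb j) -> (i, j) \in edges G.

Lemma adjacency_block G (i j : 'I_N) x y : block R i x -> block R j y ->
  empirical_graphon R G x y = ((i, j) \in edges G)%:R.
Proof. by move=> bi bj; rewrite /= (step_fun_block N_gt0 _ bi bj) mxE. Qed.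

Lemma ext_adjacency_block G (i j : 'I_N) x y : block R i x -> block R j y ->
  ext (empirical_graphon R G) (x, y) = ((i, j) \in edges G)%:R.
Proof. by move=> bi bj; rewrite /= (ext_block N_gt0 _ bi bj) mxE. Qed.

(** In the support of the random graph, blocks with entry 0
carry no edges. *)
Lemma dominated_empirical G : graph_pmf p G != 0 -> dominated p (empirical_graphon R G).
Proof.
move=> pG; rewrite /dominated -[RHS](bint_cst (unif2 R)%E); apply: eq_Rintegral => z _.
apply/eqP; rewrite subr_eq0 eq_sym; apply/eqP/min_idPl.
move: z; apply: (block_pair_cases N_gt0) => [i j x y bi bj|z nz];
  last by rewrite !ext_out.
rewrite (ext_adjacency_block G bi bj).
rewrite (ext_block k_gt0 _ (block_vertex bi) (block_vertex bj)) mxE.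
case: (boolP (_ \in edges G)) => [/(graph_pmf_pos pG) ->//|_].
exact: ler0n.
Qed.

(** A missing relevant pair is a whole cell of positive measure
where the empirical graphon vanishes, so that [relevant_gap] forces a strictly
smaller density. *)
Lemma upper_tail_full G : graph_pmf p G != 0 ->
  hom_density H fmax <= hom_density H (empirical_graphon R G) -> full G.
Proof.
move=> pG tG i j rij; have [c c0 gap] := relevant_gap k_gt0 H p.
have := gap _ _ _ (dominated_empirical pG) rij.
apply: contraPT => ijG; apply/negP; rewrite -ltNge.
apply: (@le_lt_trans _ _ 0); first by rewrite subr_le0.
apply: mulr_gt0 => //.
have bI (l : 'I_N) := bmeas_block R l.
have bK (a : 'I_k) := bmeas_block R a.
have bij : bmeas (fun z : mR R * mR R => \1_(block R i) z.1 * \1_(block R j) z.2 : R).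
  by apply: bmeasM; [exact: (bmeas_fst (bI i)) | exact: (bmeas_snd (bI j))].
apply: (@lt_le_trans _ _ (\int[unif2 R]_z (\1_(block R i) z.1 * \1_(block R j) z.2))).
  rewrite (bint_prod (unif R) (unif R) bij) /=.
  have -> : \int[unif R]_x (\int[unif R]_y (\1_(block R i) x * \1_(block R j) y)) =
      \int[unif R]_x (\1_(block R i) x * N%:R^-1).
    by apply: eq_Rintegral => x _; rewrite bintZl// bint_block.
  by rewrite bintZr// bint_block// mulr_gt0// invr_gt0 ltr0n.
apply: bint_le => //.
  apply: bmeasM; last by apply: bmeasB; [exact: bmeas_cst | exact: bmeas_ext].
  by apply: bmeasM; [exact: (bmeas_fst (bK _)) | exact: (bmeas_snd (bK _))].
move=> [x y] /=; have e01 := proj2 (kernel_ext (empirical_graphon R G)) (x, y).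
have ind0 (T : Type) (A : set T) (t : T) : 0 <= (\1_A t : R) by case/andP: (indic01
  R A t).
have e1 : 0 <= 1 - ext (empirical_graphon R G) (x, y).
  by rewrite subr_ge0; case/andP: e01.
have [bx|nbx] := pselect (block R i x); last first.
  by rewrite [X in X * _ <= _]indicE memNset// mul0r !mulr_ge0.
have [by'|nby] := pselect (block R j y); last first.
  by rewrite [X in _ * X <= _]indicE memNset// mulr0 !mulr_ge0.
rewrite !indicE !mem_set//; try exact: block_vertex.
by rewrite !mul1r -/(ext _ _) (ext_adjacency_block G bx by') (negbTE ijG) subr0.
Qed.

(** The empirical graphon then lies above [f_rel], which already
has the maximal density. *)
Lemma full_upper_tail G : full G ->
  hom_density H fmax <= hom_density H (empirical_graphon R G).
Proof.
move=> fG; rewrite -hom_density_f_rel// !hom_density_ext.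
apply: le_hom_kernel; [exact: kernel_ext..|].
apply: (block_pair_cases N_gt0) => [i j x y bi bj|z nz]; last by rewrite !ext_out.
rewrite (ext_adjacency_block G bi bj).
rewrite (ext_block k_gt0 _ (block_vertex bi) (block_vertex bj)) mxE.
case: asboolP => [/fG ->//|_]; exact: ler0n.
Qed.

(** Graphs have no loops, so the vertices of a relevant
diagonal block would contradict fullness. *)
Lemma full_irrelevant_diag G : full G -> forall a, ~ relevant H p a a.
Proof.
move=> fG a raa.
have ltN : (a * n < N)%N by rewrite ltn_pmul2r.
pose i : 'I_N := Ordinal ltN.
have vi : vb i = a by apply: val_inj; rewrite /= mulnK.
have := fG i i; rewrite vi => /(_ raa).
by rewrite edges_irr.
Qed.

(** Probability that every relevant pair is an edge. *)
Definition relevant_mass : R :=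
  \prod_(e : 'I_N * 'I_N | (e.1 < e.2)%N)
    if `[< relevant H p (vb e.1) (vb e.2) >] then p (vb e.1) (vb e.2) else 1.

Lemma relevant_mass_gt0 : 0 < relevant_mass.
Proof. by apply: prodr_gt0 => e _; case: asboolP => // -[]. Qed.

Lemma graph_pmf_full G : full G ->
  graph_pmf p G = relevant_mass * graph_pmf f_max_matrix G.
Proof.
move=> fG; rewrite /relevant_mass !graph_pmfE /sgraph_pmf -big_split /=.
apply: eq_bigr => e lt; rewrite /vertex_mx /= mxE.
case: asboolP => r; last by rewrite mul1r.
have := fG _ _ r; rewrite -surjective_pairing => ->.
by rewrite mulr1.
Qed.

Lemma full_of_pmf G : (forall a, ~ relevant H p a a) ->
  graph_pmf f_max_matrix G != 0 -> full G.
Proof.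
move=> nd pG i j; wlog ij : i j / (i < j)%N.
  move=> wl rij; have [ij|ji|/val_inj ij] := ltngtP i j; first exact: wl.
    by rewrite edges_sym; apply: wl => //; exact: relevant_sym.
  by case: (nd (vb i)); rewrite [X in relevant _ _ _ (vb X)]ij.
move=> rij; apply: contraNT pG => nijG.
rewrite graph_pmfE /sgraph_pmf (bigD1 (i, j))//= (negbTE nijG).
by rewrite /vertex_mx /= mxE asboolT// subrr mul0r.
Qed.

Local Notation upper_tail := [set f : graphon R | hom_density H fmax <= hom_density
  H f].

(** The upper tail event is, up to probability 0, the presence of
all relevant pairs.  Conditioning a product law on it replaces the entries of
the relevant blocks by 1 and keeps the other edges independent. *)
Lemma conditional_pmf : graphon_law p n upper_tail != 0 -> forall G,
  (if `[< upper_tail (empirical_graphon R G) >] then graph_pmf p G else 0) =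
  relevant_mass * graph_pmf f_max_matrix G.
Proof.
move=> law0.
have [G0 /andP[tG0 pG0]] : exists G, `[< upper_tail (empirical_graphon R G) >] &&
  (graph_pmf p G != 0).
  apply: contrapT => no; move/eqP: law0; apply; rewrite /graphon_law big1// => G tG.
  by apply/eqP; apply: contrapT => /negP pG; apply: no; exists G; rewrite tG.
have nd : forall a, ~ relevant H p a a.
  by apply: full_irrelevant_diag (upper_tail_full pG0 _); exact/asboolP.
move=> G; have [fG|nfG] := pselect (full G).
  by rewrite asboolT ?graph_pmf_full//; exact: full_upper_tail.
have -> : graph_pmf f_max_matrix G = 0.
  by apply/eqP; apply: contrapT => /negP /(full_of_pmf nd).
rewrite mulr0; case: asboolP => // tG; apply/eqP; apply: contrapT => /negP pG.
by apply: nfG; exact: upper_tail_full.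
Qed.

Lemma graphon_law_tail : graphon_law p n upper_tail != 0 ->
  graphon_law p n upper_tail = relevant_mass.
Proof.
move=> law0; rewrite /graphon_law big_mkcond /=.
rewrite (eq_bigr _ (fun G _ => conditional_pmf law0 G)) -mulr_sumr.
have -> : \sum_(G : sgraph N) graph_pmf f_max_matrix G = 1 :> R.
  exact: (sum_sgraph_pmf (vertex_mx f_max_matrix)).
by rewrite mulr1.
Qed.

Lemma cond_lawE A : graphon_law p n upper_tail != 0 ->
  cond_law p n A upper_tail = graphon_law f_max_matrix n A.
Proof.
move=> law0; have m0 := relevant_mass_gt0.
rewrite /cond_law graphon_law_tail// /graphon_law.
have -> : \sum_(G : sgraph N | `[< (A `&` upper_tail) (empirical_graphon R G) >])
  graph_pmf p G =
    relevant_mass * \sum_(G : sgraph N | `[< A (empirical_graphon R G) >])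
      graph_pmf f_max_matrix G.
  rewrite mulr_sumr big_mkcond [RHS]big_mkcond /=; apply: eq_bigr => G _.
  rewrite -conditional_pmf//; case: (asboolP (A _)) => aG.
    congr (if _ then _ else _).
    by apply/asboolP/asboolP => [[]|].
  by rewrite asboolF// => -[].
by rewrite [relevant_mass * _]mulrC mulfK// gt_eqF.
Qed.

Lemma cond_expectationE (phi : graphon_class R -> R) : graphon_law p n upper_tail
  != 0 ->
  cond_expectation p n phi upper_tail =
  \sum_(G : sgraph N) graph_pmf f_max_matrix G * phi (cls (empirical_graphon R G)).
Proof.
move=> law0; have m0 := relevant_mass_gt0.
rewrite /cond_expectation graphon_law_tail//.
have -> : \sum_(G : sgraph N | `[< upper_tail (empirical_graphon R G) >])
      graph_pmf p G * phi (cls (empirical_graphon R G)) =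
    relevant_mass *
      \sum_(G : sgraph N) graph_pmf f_max_matrix G * phi (cls (empirical_graphon R G)).
  rewrite mulr_sumr big_mkcond /=; apply: eq_bigr => G _.
  by rewrite mulrA -conditional_pmf//; case: ifP => _; rewrite ?mul0r.
by rewrite [relevant_mass * _]mulrC mulfK// gt_eqF.
Qed.

(** The difference of the empirical graphon and [f_max] is constant
on the cells, where it is the deviation of an edge from its mean. *)
Lemma far_deviates G eps : 0 < eps -> eps <= mdist (cls (empirical_graphon R G))
  (cls fmax) ->
  cut_deviates (vertex_mx f_max_matrix) (eps / 2 * N%:R ^+ 2) G.
Proof.
move=> eps0; rewrite mdist_cls; apply: contraTT => nd.
have N2 : 0 < N%:R ^+ 2 :> R by rewrite exprn_gt0// ltr0n.
rewrite -ltNge; apply: (@le_lt_trans _ _ (eps / 2)); last first.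
  by rewrite ltr_pdivrMr// ltr_pMr// ltr1n.
apply: le_trans (cut_delta_lb _ _ (mp_bijection_id R)) _.
rewrite -[eps / 2](mulfK (lt0r_neq0 N2)).
apply: (cut_dist_cells N_gt0 (D := \matrix_(i, j) dev (vertex_mx f_max_matrix) G i j)).
  move=> i j x y bi bj; rewrite (adjacency_block G bi bj) mxE /dev; congr (_ - _).
  exact: (step_fun_block k_gt0 _ (block_vertex bi) (block_vertex bj)).
move=> S T; rewrite leNgt; apply: contraNN nd => lt.
apply/existsP; exists S; apply/existsP; exists T.
by move: lt; under eq_bigr do under eq_bigr do rewrite mxE.
Qed.

End Conditioning.

(** A tilt [t] proportional to [eps] makes the gain [t eps N^2]
exceed the variance term [8 t^2 N^2], while the number of rectangles is only
exponential in [N]. *)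
Lemma tail_asymptotics (R : realType) (eps : R) : 0 < eps ->
  exists t C : R, [/\ 0 <= t <= 1 / 4, 0 < C & exists n0 : nat, forall N : nat, (n0
    <= N)%N ->
    2 * 4 ^+ N * expR (8 * t ^+ 2 * N%:R ^+ 2 + t * N%:R - t * (eps * N%:R ^+ 2)) <=
    expR (- (C * N%:R ^+ 2))].
Proof.
move=> eps0; pose t := Num.min (1 / 4) (eps / 16).
have t0 : 0 < t by rewrite lt_min !divr_gt0.
have t4 : t <= 1 / 4 by rewrite ge_min lexx.
have te : t <= eps / 16 by rewrite ge_min lexx orbT.
have teps : 0 < t * eps by rewrite mulr_gt0.
exists t, (t * eps / 4); split; [by rewrite ltW | by rewrite divr_gt0|].
exists (Num.bound (20 / (t * eps))).+1 => N leN.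
have N1 : 1 <= N%:R :> R by rewrite ler1n; exact: leq_trans leN.
have N20 : 20 <= t * eps * N%:R.
  rewrite mulrC -ler_pdivrMr//.
  have a0 : 0 <= 20 / (t * eps) by rewrite divr_ge0// ltW.
  apply: ltW; apply: lt_le_trans (archi_boundP a0) _.
  by rewrite ler_nat; exact: ltnW.
have e2 : 2 <= expR 1 :> R by have := expR_ge1Dx (1 : R); lra.
have e4 : 4 <= expR 3 :> R by have := expR_ge1Dx (3 : R); lra.
have e4N : 4 ^+ N <= expR (3 * N%:R) :> R.
  by rewrite expRM_natr lerXn2r// nnegrE ?expR_ge0.
set Y := _ - _.
apply: (@le_trans _ _ (expR (1 + 3 * N%:R + Y))).
  rewrite [leRHS]expRD; apply: ler_wpM2r; first exact: expR_ge0.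
  by rewrite expRD; apply: ler_pM => //; exact: exprn_ge0.
rewrite ler_expR /Y.
have tN : t * N%:R <= N%:R by rewrite ler_piMl//; lra.
have tt : 8 * t ^+ 2 <= t * eps / 2.
  have : t * t <= t * (eps / 16) by rewrite ler_wpM2l// ltW.
  by rewrite expr2; lra.
have N2 : 0 <= N%:R ^+ 2 :> R by exact: sqr_ge0.
have ttN := ler_wpM2r N2 tt.
have NN : 20 * N%:R <= t * eps * N%:R ^+ 2.
  by rewrite expr2 mulrA; apply: ler_wpM2r N20; rewrite ler0n.
have -> : t * (eps * N%:R ^+ 2) = t * eps * N%:R ^+ 2 by rewrite mulrA.
move: NN ttN; rewrite -[t * eps / 4 * _]mulrAC -[t * eps / 2 * _]mulrAC.
set X := t * eps * _; lra.
Qed.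

(** * The theorem *)

Section Concentration.
Variables (R : realType) (k : nat).
Hypothesis k_gt0 : (0 < k)%N.
Variables (v : nat) (H : sgraph v) (p : block_matrix R k).
Local Notation fmax := (f_max H p).

Lemma far_mass_le eps : 0 < eps -> exists2 C : R, 0 < C & exists n0 : nat,
  forall n, (n0 <= n)%N -> (0 < n)%N /\
  \sum_(G : sgraph (k * n) | eps <= mdist (cls (empirical_graphon R G)) (cls fmax))
     graph_pmf (f_max_matrix H p) G <= expR (- (C * n%:R ^+ 2)).
Proof.
move=> eps0; have [|t [C [t4 C0 [n0 tail]]]] := @tail_asymptotics R (eps / 2).
  by rewrite divr_gt0.
exists C => //; exists n0.+1 => n len; have n1 : (0 < n)%N by exact: leq_trans len.
split=> //; have lenN : (n <= k * n)%N by rewrite leq_pmull.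
have q01 := @vertex_mx01 R k n (f_max_matrix H p).
apply: (@le_trans _ _ (expR (- (C * (k * n)%:R ^+ 2)))); last first.
  by rewrite ler_expR lerN2 ler_pM2l// lerXn2r ?nnegrE ?ler0n// ler_nat.
apply: le_trans (tail _ (leq_trans (ltnW len) lenN)).
apply: le_trans (@cut_deviation_le R _ _ (@vertex_mx_sym R k n (f_max_matrix H p)) q01
  (eps / 2 * (k * n)%:R ^+ 2) t t4).
rewrite big_mkcond [leRHS]big_mkcond /=; apply: ler_sum => G _.
have p0 : 0 <= graph_pmf (f_max_matrix H p) G := sgraph_pmf_ge0 q01 G.
case: ifPn => [far|_]; last by case: ifP.
by rewrite (far_deviates k_gt0 n1 eps0 far).
Qed.

End Concentration.

Theorem theorem1p21 (R : realType) (k : nat) (k_gt0 : (0 < k)%N)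
    (p : block_matrix R k) (v d : nat) (H : sgraph v) (H_reg : regular d H) :
  let W0 := block_graphon p in
  let tmax := t_max W0 H in
  let Fmax := cls (f_max H p) in
  let upper_tail := [set f : graphon R | tmax <= hom_density H f] in
  [/\ unique_minimizer
        [set F : graphon_class R | tmax <= class_density H F] (rate_J W0) Fmax,
      forall eps : R, 0 < eps -> exists2 C : R, 0 < C &
        \forall n \near \oo, graphon_law p n upper_tail != 0 ->
          1 - expR (- (C * n%:R ^+ 2)) <=
          cond_law p n [set f : graphon R | mdist (cls f) Fmax < eps] upper_tail
    & forall phi : graphon_class R -> R, continuous phi -> bounded_fun phi ->
        cond_expectation p n phi upper_tail
          @[n --> within [set n : nat | graphon_law p n upper_tail != 0] \oo]
        --> phi Fmax ].
Proof.
move=> W0 tmax Fmax upper_tail; split.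
- exact: unique_minimizer_f_max.
- move=> eps eps0; have [C C0 [n0 far]] := far_mass_le k_gt0 H p eps0.
  exists C => //; exists n0 => // n /= len;
    rewrite /upper_tail /tmax /W0 (t_maxE k_gt0) => law0.
  have [n1 farn] := far n len.
  rewrite (cond_lawE k_gt0 n1 _ law0) /graphon_law lerBlDl.
  have S1 : \sum_(G : sgraph (k * n)) graph_pmf (f_max_matrix H p) G = 1 :> R.
    exact: (sum_sgraph_pmf (vertex_mx (f_max_matrix H p))).
  rewrite -[leLHS]S1 (bigID (fun G => eps <= mdist (cls (empirical_graphon R G))
    Fmax)) /=.
  apply: lerD => //; rewrite le_eqVlt; apply/orP; left; apply/eqP; apply: eq_bigl => G.
  by rewrite -ltNge asboolb.
move=> phi cphi bphi.
have [M M0 phiM] : exists2 M : R, 0 < M & forall F, `|phi F| <= M.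
  have [M0 [_ hM]] := bphi; exists (`|M0| + 1); first by rewrite ltr_wpDl.
  by move=> F; apply: hM => //; rewrite ltr_pwDr// ler_norm.
apply/cvgrPdist_lt => e e0.
have /cvgrPdist_lt /(_ (e / 2)) := cphi Fmax.
rewrite divr_gt0// => /(_ isT) /nbhs_ballP[eps /= eps0 close].
have [C C0 [n0 far]] := far_mass_le k_gt0 H p eps0.
have a0 : 0 <= 4 * M / e / C by rewrite !divr_ge0// ?mulr_ge0// ltW.
exists (maxn n0 (Num.bound (4 * M / e / C)).+1) => // n /=.
rewrite geq_max => /andP[len lenM].
rewrite /upper_tail /tmax /W0 (t_maxE k_gt0) => law0.
have [n1 farn] := far n len.
rewrite (cond_expectationE k_gt0 n1 phi law0).
have S1 : \sum_(G : sgraph (k * n)) graph_pmf (f_max_matrix H p) G = 1 :> R.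
  exact: (sum_sgraph_pmf (vertex_mx (f_max_matrix H p))).
have p0 (G : sgraph (k * n)) : 0 <= graph_pmf (f_max_matrix H p) G :> R.
  exact: (sgraph_pmf_ge0 (@vertex_mx01 R k n (f_max_matrix H p)) G).
have -> : phi Fmax = \sum_(G : sgraph (k * n)) graph_pmf (f_max_matrix H p) G * phi
  Fmax.
  by rewrite -mulr_suml S1 mul1r.
rewrite -sumrB; apply: le_lt_trans (ler_norm_sum _ _ _) _.
(* Near graphs contribute at most e / 2, far ones at most 2 M each. *)
pose isfar (G : sgraph (k * n)) := eps <= mdist (cls (empirical_graphon R G)) Fmax.
apply: (@le_lt_trans _ _ (e / 2 + 2 * M * \sum_(G | isfar G) graph_pmf
  (f_max_matrix H p) G)).
  have -> : e / 2 = \sum_(G : sgraph (k * n)) graph_pmf (f_max_matrix H p) G * (e / 2).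
    by rewrite -mulr_suml S1 mul1r.
  rewrite mulr_sumr [X in _ <= _ + X]big_mkcond -big_split /=; apply: ler_sum => G _.
  rewrite -mulrBr normrM ger0_norm//.
  case: ifPn => [_|]; last first.
    rewrite addr0 -ltNge => near_; apply: ler_wpM2l => //; apply/ltW/close.
    by rewrite ballEmdist /= metric_sym.
  apply: ler_wpDl; first by rewrite mulr_ge0// divr_ge0// ltW.
  rewrite [2 * M * _]mulrC ler_wpM2l//; apply: le_trans (ler_normB _ _) _.
  apply: le_trans (lerD (phiM _) (phiM _)) _; rewrite -mulr2n mulr_natl//.
rewrite [X in _ < X](splitr e) ltrD2l.
have a1 : 4 * M / e / C < n%:R.
  by apply: lt_trans (archi_boundP a0) _; rewrite ltr_nat.
have a2 : 4 * M / e < C * n%:R ^+ 2.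
  rewrite [C * _]mulrC -ltr_pdivrMr//; apply: lt_le_trans a1 _.
  by rewrite -natrX ler_nat expnS expn1 leq_pmull.
have M2 : 0 < 2 * M by rewrite mulr_gt0.
apply: (@le_lt_trans _ _ (2 * M * expR (- (C * n%:R ^+ 2)))).
  by rewrite ler_pM2l//; exact: farn.
rewrite expRN ltr_pdivrMr ?expR_gt0//.
apply: (@lt_le_trans _ _ (e / 2 * (C * n%:R ^+ 2))).
  move: a2; rewrite ltr_pdivrMr// => a2.
  by move: (C * n%:R ^+ 2) a2 => X a2; lra.
apply: ler_wpM2l; first by rewrite divr_ge0// ltW.
by apply: le_trans (expR_ge1Dx _); rewrite lerDr.
Qed.
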